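(* Let $\Gamma$ be a finitely generated nilpotent group and let $1<p\le\infty$. Then $\Gamma$ is $p$-stable if and only if $\Gamma$ is virtually cyclic.
   Context: Let $U(k)$ be the group of $k\times k$ complex unitary matrices. For a matrix $M$ and $1\le p<\infty$, $\|M\|_p=(\operatorname{Tr}((M^*M)^{p/2}))^{1/p}$ is the unnormalized Schatten $p$-norm ($\operatorname{Tr}$ is the unnormalized trace), and $\|M\|_\infty$ is the operator norm. Let $\Gamma$ be a countable discrete group. A $p$-asymptotic representation of $\Gamma$ is a sequence of functions $\rho_n:\Gamma\to U(k_n)$ such that for all $x,y\in\Gamma$, $\|\rho_n(xy)-\rho_n(x)\rho_n(y)\|_p\to 0$. It is $p$-perturbable to a genuine representation if there is a sequence of unitary representations (group homomorphisms) $\tilde\rho_n:\Gamma\to U(k_n)$ such that for all $x\in\Gamma$, $\|\tilde\rho_n(x)-\rho_n(x)\|_p\to 0$. The group $\Gamma$ is $p$-stable if every $p$-asymptotic representation of $\Gamma$ is $p$-perturbable to a genuine representation. A group is virtually cyclic if it has a cyclic (possibly trivial) subgroup of finite index. *)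

(* Defs.v *)
From HB Require Import structures.
From mathcomp Require Import all_boot all_order all_algebra.
From mathcomp Require Import sesquilinear spectral complex.
From mathcomp Require Import all_classical all_reals all_analysis.

Set Implicit Arguments.
Unset Strict Implicit.
Unset Printing Implicit Defensive.

Import Order.TTheory GRing.Theory Num.Theory numFieldNormedType.Exports.

Local Open Scope classical_set_scope.
Local Open Scope ring_scope.
Local Open Scope complex_scope.
Local Open Scope sesquilinear_scope.

Definition is_subgroup (G : groupType) (H : set G) : Prop :=
  [/\ H 1%g,
      (forall x y, H x -> H y -> H (x * y)%g) &
      (forall x, H x -> H (x^-1)%g)].

Definition generated (G : groupType) (S : set G) : set G :=
  smallest (@is_subgroup G) S.

Definition finitely_generated (G : groupType) : Prop :=
  exists2 S : set G, finite_set S & generated S = setT.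

Fixpoint lower_central (G : groupType) (n : nat) : set G :=
  if n is m.+1 then
    generated [set [~ x, y]%g | x in @lower_central G m & y in setT]
  else setT.

Arguments lower_central : clear implicits.

Definition nilpotent_group (G : groupType) : Prop :=
  exists n : nat, lower_central G n = [set 1%g].

Definition left_coset (G : groupType) (H : set G) (x : G) : set G :=
  [set (x * h)%g | h in H].

Definition finite_index (G : groupType) (H : set G) : Prop :=
  finite_set (range (left_coset H)).

Definition cyclic_subgroup (G : groupType) (H : set G) : Prop :=
  exists a : G, H = generated [set a].

Definition virtually_cyclic (G : groupType) : Prop :=
  exists2 H : set G, cyclic_subgroup H & finite_index H.

(* A `^ s for a positive semidefinite A, by functional calculus on the unitary
   diagonalization A = P^-1 *m diag_mx d *m P (unspecified for other A). *)
Definition psdmx_pow (R : realType) (k : nat) (A : 'M[R[i]]_k) (s : R) :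
    'M[R[i]]_k :=
  invmx (spectralmx A)
  *m diag_mx (map_mx (fun z => (complex.Re z `^ s)%:C) (spectral_diag A))
  *m spectralmx A.

Definition euclidean_norm (R : realType) (k : nat) (x : 'cV[R[i]]_k) : R :=
  Num.sqrt (\sum_(i < k) (complex.Re `|x i 0|) ^+ 2).

Definition operator_norm (R : realType) (k : nat) (M : 'M[R[i]]_k) : R :=
  sup [set euclidean_norm (M *m x) |
         x in [set x : 'cV[R[i]]_k | euclidean_norm x <= 1]].

(* p ranges over [1, +oo]; the -oo branch is junk. The trace is a nonnegative
   real complex number, and complex.Re transports it to R. *)
Definition schatten_norm (R : realType) (p : \bar R) (k : nat)
    (M : 'M[R[i]]_k) : R :=
  match p with
  | r%:E => complex.Re (\tr (psdmx_pow (M ^t* *m M) (r / 2))) `^ r^-1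
  | +oo%E => operator_norm M
  | -oo%E => 0
  end.

Definition asymptotic_representation (R : realType) (p : \bar R)
    (G : groupType) (k : nat -> nat) (rho : forall n, G -> 'M[R[i]]_(k n)) :
    Prop :=
  (forall n x, rho n x \is unitarymx) /\
  (forall x y : G,
     (fun n => schatten_norm p (rho n (x * y)%g - rho n x *m rho n y)) @ \oo
       --> (0 : R)).

Definition unitary_representation (R : realType) (G : groupType) (k : nat)
    (pi : G -> 'M[R[i]]_k) : Prop :=
  (forall x, pi x \is unitarymx) /\
  (forall x y : G, pi (x * y)%g = pi x *m pi y).

Definition perturbable (R : realType) (p : \bar R) (G : groupType)
    (k : nat -> nat) (rho : forall n, G -> 'M[R[i]]_(k n)) : Prop :=
  exists2 pi : forall n, G -> 'M[R[i]]_(k n),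
    forall n, unitary_representation (pi n) &
    forall x : G,
      (fun n => schatten_norm p (pi n x - rho n x)) @ \oo --> (0 : R).

Definition p_stable (R : realType) (p : \bar R) (G : groupType) : Prop :=
  forall (k : nat -> nat) (rho : forall n, G -> 'M[R[i]]_(k n)),
    asymptotic_representation p rho -> perturbable p rho.

(* Main.v *)
(** Let G be infinite (finite groups are virtually cyclic). Then there are a
    surjection psi : G -> Z and t with psi t = 1, and G is virtually cyclic iff
    N = ker psi is finite.

    If N is finite, an asymptotic representation is made exact on larger and
    larger finite subgroups H of N, each normalized by the next generator t by the
    normalizer condition: averaging over H turns rho(t) into an exact intertwiner,
    its polar part is unitary, and a correction by the m-th root of a matrix near 1
    makes its m-th power agree with the representation of t^m in H. The last
    generator, of infinite order modulo N, needs no root.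

    If N is infinite, nilpotency gives a homomorphism phi : N -> Z and a in N with
    phi a <> 0 and [a, t] in [N, N]. Sending N to diagonal matrices through
    exp (2 i pi phi / M) and t to the cyclic shift of size M gives a projective
    representation whose multipliers are within O(1/M) of 1; the p-norm of the
    defect is O(M^(1/p - 1)), which tends to 0 exactly because p > 1. Writing [a, t]
    as a product of commutators in N yields words u, v with the same letters, both
    trivial in G, such that v is sent to 1 and u to the scalar exp (2 i pi phi a / M).
    Were this representation close to a genuine one, the determinant of the segment
    from the image of v to that of u, followed along the path joining the two
    representations, would be a homotopy of loops in the nonzero complex numbers
    from a constant loop to one of winding number phi a <> 0. *)
Require Import Defs.
From mathcomp Require Import all_boot all_order all_algebra.
From mathcomp Require Import perm sesquilinear spectral complex.
From mathcomp Require Import all_classical all_reals all_analysis.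
From mathcomp Require Import ring lra zify.

Set Implicit Arguments.
Unset Strict Implicit.
Unset Printing Implicit Defensive.

Import Order.TTheory GRing.Theory Num.Theory numFieldNormedType.Exports.

Local Open Scope classical_set_scope.
Local Open Scope ring_scope.
Local Open Scope complex_scope.
Local Open Scope sesquilinear_scope.

(** * Subgroups, integer powers and nilpotency *)

(** In the stability half smallness is needed in two norms: eigenvalues are controlled by the
    operator norm, while the conclusion concerns the p-norm. Each correction therefore differs from
    1 by the defect times a bounded matrix, and p-norm smallness survives multiplication by bounded
    matrices. Corrections must also keep intertwining relations, so they are functions of matrices
    that commute with the representation. In the obstruction half, closeness to a genuine
    representation is used only through the operator norm, which the p-norm dominates. Conjugation
    by t may move N, so the diagonal entries cannot be built from j * phi b; they use sums of phi
    over successive t-conjugates of b, integer combinations of binomial coefficients of j, and M is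
    chosen so that the cyclic shift closes up. The element a is a power of the last iterated
    commutator with t of infinite order modulo [N, N]. The homotopy is replaced by a finite grid
    whose mesh may depend on the matrix size, which is fixed at that point. *)

Section IntegerPowers.
Variables (T : Type) (mul : T -> T -> T) (one : T).
Hypotheses (mulA : associative mul) (mul1 : left_id one mul).
Variables (u v : T).
Hypotheses (uv : mul u v = one) (vu : mul v u = one).

(** Kept abstract to serve two cases: group elements ([gz]) and unitary matrices ([mpow]), where
    square matrices under multiplication are not a group. *)
Definition zpw (z : int) : T :=
  match z with
  | Posz n => iter n (mul u) one
  | Negz n => iter n.+1 (mul v) one
  end.

Lemma zpwS z : zpw (1 + z) = mul u (zpw z).
Proof.
case: z => n; first by [].
case: n => [|n]; first by rewrite /= mulA uv mul1.
have -> : 1 + Negz n.+1 = Negz n by rewrite !NegzE; lia.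
by rewrite /= !mulA uv mul1.
Qed.

Lemma zpwP z : zpw (-1 + z) = mul v (zpw z).
Proof.
have -> : zpw z = mul u (zpw (-1 + z)) by rewrite -zpwS; congr zpw; lia.
by rewrite mulA vu mul1.
Qed.

Lemma zpwD a b : zpw (a + b) = mul (zpw a) (zpw b).
Proof.
elim: a => [|n IH|n IH]; first by rewrite add0r mul1.
- have -> : n.+1%:Z + b = 1 + (n%:Z + b) by lia.
  by rewrite zpwS IH mulA -zpwS; congr (mul (zpw _) _); lia.
- have -> : - n.+1%:Z + b = -1 + (- n%:Z + b) by lia.
  by rewrite zpwP IH mulA -zpwP; congr (mul (zpw _) _); lia.
Qed.

End IntegerPowers.

Section Subgroups.
Local Open Scope group_scope.
Variable G : groupType.
Implicit Types (H K S : set G) (x y z t : G).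

Definition gz t : int -> G := zpw *%g 1 t t^-1.

Lemma gzD t a b : gz t (a + b)%R = gz t a * gz t b.
Proof. by apply: zpwD; [exact: mulgA|exact: mul1g|exact: mulgV|exact: mulVg]. Qed.

Lemma gz0 t : gz t 0%R = 1. Proof. by []. Qed.

Lemma gzN t a : gz t (- a)%R = (gz t a)^-1.
Proof. by apply/esym/mulg1_eq; rewrite -gzD subrr. Qed.

Lemma gz1 t : gz t 1%R = t. Proof. by rewrite /gz /= mulg1. Qed.

Lemma gzX t (n : nat) : gz t n = t ^+ n.
Proof. by rewrite /gz /= iter_mulg_1. Qed.

Lemma gzM t a b : gz (gz t a) b = gz t (a * b)%R.
Proof.
elim: b => [|n IH|n IH]; first by rewrite mulr0.
- have -> : (a * n.+1%:Z = a + a * n%:Z)%R by lia.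
  by rewrite -[n.+1%:Z]/(1 + n%:Z)%R !gzD IH gz1.
- have -> : (a * - n.+1%:Z = - a + a * - n%:Z)%R by lia.
  have -> : (- n.+1%:Z = -1 + - n%:Z)%R by lia.
  by rewrite !gzD IH (gzN _ 1%R) gz1 gzN.
Qed.

Lemma sg1 H : is_subgroup H -> H 1. Proof. by case. Qed.
Lemma sgM H x y : is_subgroup H -> H x -> H y -> H (x * y).
Proof. by case=> _ h _; apply: h. Qed.
Lemma sgV H x : is_subgroup H -> H x -> H x^-1.
Proof. by case=> _ _; apply. Qed.
Lemma sgMl H x y : is_subgroup H -> H x -> H (x * y) -> H y.
Proof. by move=> hH hx /(sgM hH (sgV hH hx)); rewrite mulKg. Qed.
Lemma sgMr H x y : is_subgroup H -> H y -> H (x * y) -> H x.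
Proof. by move=> hH hx /(sgM hH) /(_ (sgV hH hx)); rewrite mulgK. Qed.
Lemma sgJ H x y : is_subgroup H -> H x -> H y -> H (x ^ y).
Proof. by move=> hH hx hy; apply: sgM; rewrite //; [apply: sgV|apply: sgM]. Qed.
Lemma sgR H x y : is_subgroup H -> H x -> H y -> H [~ x, y].
Proof. by move=> hH hx hy; apply: sgM => //; [apply: sgV|apply: sgJ]. Qed.
Lemma sg_gz H t (z : int) : is_subgroup H -> H t -> H (gz t z).
Proof.
move=> hH ht; elim: z => [|n IH|n IH]; first exact: sg1.
- by rewrite -[n.+1%:Z]/(1 + n%:Z)%R gzD gz1; apply: sgM.
- have -> : (- n.+1%:Z = -1 + - n%:Z)%R by lia.
  by rewrite gzD (gzN _ 1%R) gz1; apply: sgM => //; apply: sgV.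
Qed.
Lemma sgX H t n : is_subgroup H -> H t -> H (t ^+ n).
Proof. by move=> hH ht; rewrite -gzX; apply: sg_gz. Qed.

Lemma sgT : is_subgroup [set: G]. Proof. by split. Qed.

Lemma gen_sg S : is_subgroup (generated S).
Proof.
split=> [M [hM _]|x y hx hy M hM|x hx M hM]; first exact: sg1.
- by apply: sgM; [case: hM|apply: hx|apply: hy].
- by apply: sgV; [case: hM|apply: hx].
Qed.

Lemma sub_gen S : S `<=` generated S.
Proof. by move=> x hx M [_]; apply. Qed.

Lemma gen_min S H : is_subgroup H -> S `<=` H -> generated S `<=` H.
Proof. by move=> hH SH x; apply; split. Qed.

Lemma gen_mono S K : S `<=` K -> generated S `<=` generated K.
Proof.
by move=> SK; apply: gen_min (gen_sg _) _; apply: subset_trans SK (@sub_gen _).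
Qed.

Lemma genJ S y : (forall x, S x -> generated S (x ^ y)) ->
  forall x, generated S x -> generated S (x ^ y).
Proof.
move=> h x; apply: (@gen_min S [set x | generated S (x ^ y)]) => //.
have hg := gen_sg S; split => /= [|a b ha hb|a ha].
- by rewrite conj1g; exact: sg1 hg.
- by rewrite conjMg; exact: sgM hg ha hb.
- by rewrite conjVg; exact: sgV hg ha.
Qed.

(** Relative to a subgroup, because the series is needed both for the whole group and for the kernel
    N. Indices start at 0, so [lcs H 1] is the commutator subgroup of [H]. *)
Fixpoint lcs H (n : nat) : set G :=
  if n is m.+1 then generated [set [~ x, y] | x in lcs H m & y in H] else H.

Lemma lcsT n : lcs setT n = lower_central G n.
Proof. by elim: n => //= n ->. Qed.

Lemma lcs_sg H n : is_subgroup H -> is_subgroup (lcs H n).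
Proof. by case: n => //= n _; apply: gen_sg. Qed.

Lemma lcsR H n x y : lcs H n x -> H y -> lcs H n.+1 [~ x, y].
Proof. by move=> hx hy; apply: sub_gen; exists x => //; exists y. Qed.

Lemma lcsJ H n t : (forall x, H x -> H (x ^ t)) ->
  forall x, lcs H n x -> lcs H n (x ^ t).
Proof.
move=> ht; elim: n => //= n IH; apply: genJ => _ [x hx [y hy <-]].
by rewrite conjRg; apply: lcsR; [apply: IH|apply: ht].
Qed.

Lemma lcsJH H n x y : is_subgroup H -> lcs H n x -> H y -> lcs H n (x ^ y).
Proof. by move=> hH hx hy; apply: lcsJ => // z hz; apply: sgJ. Qed.

Lemma lcsS H n : is_subgroup H -> lcs H n.+1 `<=` lcs H n.
Proof.
move=> hH; apply: gen_min (lcs_sg _ hH) _ => _ [x hx [y hy <-]].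
by apply: sgM (lcs_sg _ hH) _ _; [apply: sgV (lcs_sg _ hH) _|apply: lcsJH].
Qed.

Lemma lcs_subH H n : is_subgroup H -> lcs H n `<=` H.
Proof. by move=> hH; elim: n => // n IH x /(lcsS hH)/IH. Qed.

Lemma lcs_mono H K n : H `<=` K -> lcs H n `<=` lcs K n.
Proof.
move=> HK; elim: n => //= n IH; apply: gen_mono => _ [x hx [y hy <-]].
by exists x; [apply: IH|exists y => //; apply: HK].
Qed.

Arguments lcs : simpl never.

Lemma commgM x y z : [~ x, y * z] = [~ x, z] * [~ x, y] ^ z.
Proof. by rewrite /commg /conjg !invgM !mulgA !mulgK. Qed.

Lemma commMg x y z : [~ x * y, z] = [~ x, z] ^ y * [~ y, z].
Proof. by rewrite /commg /conjg !invgM !mulgA !mulgK. Qed.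

Lemma conjg_commg x y : x ^ y = x * [~ x, y].
Proof. by rewrite /commg mulVKg. Qed.

Section Bilinear.
Variables (H K : set G) (i : nat).
Hypotheses (hH : is_subgroup H) (hK : is_subgroup K).
Hypotheses (K2 : lcs H i.+2 `<=` K) (K1 : K `<=` lcs H i.+1).

Lemma midJ c z : K c -> H z -> K (c ^ z).
Proof.
move=> hc hz; rewrite conjg_commg; apply: sgM => //.
by apply/K2; apply: lcsR hz; apply: K1.
Qed.

(** In each variable the commutator is multiplicative up to conjugation, and [H] normalizes any [K]
    squeezed between two consecutive terms of the series. This lets the condition that a commutator
    lies in [K] be checked on generators. *)
Lemma mid_sgr s : is_subgroup [set y | H y /\ K [~ s, y]].
Proof.
split=> /= [|y z [hy ky] [hz kz]|y [hy ky]].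
- by rewrite commg1; split; apply: sg1.
- by split; [apply: sgM|rewrite commgM; apply: sgM => //; apply: midJ].
- split; first exact: sgV.
  have := commgM s y y^-1; rewrite mulgV commg1 => /esym/eqP.
  rewrite mulg_eq1 => /eqP ->.
  by apply: sgV => //; apply: midJ => //; apply: sgV.
Qed.

Lemma mid_sgl : is_subgroup [set x | lcs H i x /\ forall y, H y -> K [~ x, y]].
Proof.
have hi := lcs_sg i hH.
split=> /= [|x y [hx kx] [hy ky]|x [hx kx]].
- by split; [apply: sg1|move=> y _; rewrite comm1g; apply: sg1].
- split; first exact: sgM.
  move=> z hz; rewrite commMg; apply: sgM; [by []| |exact: ky].
  by apply: midJ; [apply: kx|apply: (lcs_subH hH) hy].
- split; first exact: sgV.
  move=> y hy; have -> : [~ x^-1, y] = ([~ x, y] ^ x^-1)^-1.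
    by rewrite /commg /conjg !invgM !invgK !mulgA mulgK.
  apply: sgV => //; apply: midJ; first exact: kx.
  by apply: sgV => //; apply: (lcs_subH hH) hx.
Qed.

End Bilinear.

(** Expanding [s, yz] and [s, zy[y, z]], which are equal, gives the same factors [s, y] and [s, z]
    in both orders; these commute modulo the deeper term, so [s, [y, z]] is all that remains. *)
Lemma lcs_comm2 H i s y z : is_subgroup H -> lcs H i s -> H y -> H z ->
  lcs H i.+2 [~ s, [~ y, z]].
Proof.
move=> hH hs hy hz; set w := [~ y, z].
have hL := lcs_sg i.+2 hH; have hw : H w by apply: sgR.
set c := [~ s, y]; set d := [~ s, z].
have hc : lcs H i.+1 c by apply: lcsR.
have hd : lcs H i.+1 d by apply: lcsR.
have hcH := lcs_subH hH hc; have hdH := lcs_subH hH hd.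
have e : [~ s, y * z] = [~ s, w] * [~ s, z * y] ^ w.
  by rewrite -commgM; congr [~ s, _]; rewrite commgC.
have {e} -> : [~ s, w] = d * c ^ z * ([~ s, z * y] ^ w)^-1.
  by rewrite -commgM e mulgK.
rewrite commgM -/c -/d.
rewrite [_ ^ w]conjg_commg [c ^ z]conjg_commg [d ^ y]conjg_commg.
set l1 := [~ c, z]; set l2 := [~ d, y]; set l3 := [~ _, w].
have h1 : lcs H i.+2 l1 by apply: lcsR.
have h2 : lcs H i.+2 l2 by apply: lcsR.
have h3 : lcs H i.+2 l3.
  apply: lcsR hw; apply: sgM (lcs_sg _ hH) _ _ => //.
  by apply: sgM (lcs_sg _ hH) _ _ => //; apply: (lcsS hH) h2.
(* The deep factors are gathered into one conjugate, leaving only the commutator that swaps [c] and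
   [d]. *)
have -> : d * (c * l1) * (c * (d * l2) * l3)^-1 =
   (l1 * l3^-1 * l2^-1) ^ (d * c)^-1 * [~ d^-1, c^-1].
  move: c d l1 l2 l3 {hc hd hcH hdH h1 h2 h3} => c d l1 l2 l3.
  rewrite /commg /conjg !invgM !invgK !mulgA.
  by rewrite !mulgVK.
apply: (sgM hL); last first.
  by apply: (@lcsR H i.+1); [exact: sgV (lcs_sg _ hH) hd|exact: sgV].
apply: lcsJH => //; last by apply: sgV => //; apply: sgM.
by apply: (sgM hL); [apply: (sgM hL) => //|]; apply: (sgV hL).
Qed.

(** Both directions are required: for infinite [H], conjugation by [t] may map [H] into itself
    without being onto. *)
Definition nrm H t := forall x, H x -> H (x ^ t) /\ H (x ^ t^-1).

Lemma nrm_gz H t (z : int) x : nrm H t -> H x -> H (x ^ gz t z).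
Proof.
move=> hn; elim: z x => [|n IH|n IH] x hx; first by rewrite conjg1.
- by rewrite -[n.+1%:Z]/(1 + n%:Z)%R gzD gz1 conjgM; apply: IH; case: (hn x hx).
- have -> : (- n.+1%:Z = -1 + - n%:Z)%R by lia.
  by rewrite gzD (gzN _ 1%R) gz1 conjgM; apply: IH; case: (hn x hx).
Qed.

Definition extg H t := [set x | exists2 h, H h & exists z : int, x = h * gz t z].

Lemma mulg_gz_conj t h (k : int) l (z : int) :
  h * gz t k * (l * gz t z) = h * l ^ gz t (- k)%R * gz t (k + z)%R.
Proof. by rewrite gzD gzN /conjg invgK !mulgA mulgVK. Qed.

Lemma extg_sg H t : is_subgroup H -> nrm H t -> is_subgroup (extg H t).
Proof.
move=> hH hn; split.
- by exists 1; [apply: sg1|exists 0%R; rewrite mulg1].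
- move=> _ _ [h hh [k ->]] [l hl [z ->]].
  exists (h * l ^ gz t (- k)%R); last by exists (k + z)%R; apply: mulg_gz_conj.
  by apply: sgM => //; apply: nrm_gz.
- move=> _ [h hh [k ->]]; exists (h^-1 ^ gz t k).
    by apply: nrm_gz => //; apply: sgV.
  by exists (- k)%R; rewrite gzN invgM /conjg !mulgA mulgK.
Qed.

Lemma sub_extg H t : H `<=` extg H t.
Proof. by move=> x hx; exists x => //; exists 0%R; rewrite mulg1. Qed.

Lemma extg_id H t : is_subgroup H -> extg H t t.
Proof. by move=> hH; exists 1; [apply: sg1|exists 1%R; rewrite mul1g gz1]. Qed.

Lemma extg_min H K t : is_subgroup K -> H `<=` K -> K t -> extg H t `<=` K.
Proof.
by move=> hK HK ht _ [h hh [z ->]]; apply: sgM => //; [apply: HK|apply: sg_gz].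
Qed.

Lemma extg_finite H t (k : nat) : is_subgroup H -> finite_set H ->
  (0 < k)%N -> H (t ^+ k) -> finite_set (extg H t).
Proof.
move=> hH fH k0 hk.
apply: sub_finite_set (finite_image2 (fun h (a : nat) => h * t ^+ a) fH (finite_II k)).
move=> _ [h hh [z ->]] /=.
exists (h * gz t ((z %/ k)%Z * k)%R).
  apply: sgM => //; rewrite mulrC -gzM gzX; exact: sg_gz.
have r0 : (0 <= (z %% k)%Z)%R by apply: modz_ge0; lia.
have r1 : ((z %% k)%Z < k)%R by apply: ltz_pmod; lia.
exists `|(z %% k)%Z|%N => /=; first by lia.
by rewrite -gzX gez0_abs // -mulgA -gzD -divz_eq.
Qed.

(** A map on [H] and a map on powers of [t] glue as soon as they respect conjugation and agree on
    the powers of [t] lying in [H]. The target is merely an associative operation, so that both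
    integers under addition and matrices under multiplication are covered. *)
Lemma homs_extend (T : Type) (mul : T -> T -> T) (phi : G -> T)
    (v : int -> T) H t : associative mul -> is_subgroup H -> nrm H t ->
  (forall x y, H x -> H y -> phi (x * y) = mul (phi x) (phi y)) ->
  (forall a b, v (a + b)%R = mul (v a) (v b)) ->
  (forall k x, H x -> mul (v k) (phi x) = mul (phi (x ^ gz t (- k)%R)) (v k)) ->
  (forall j, H (gz t j) -> phi (gz t j) = v j) ->
  exists2 psi : G -> T,
    (forall x y, extg H t x -> extg H t y -> psi (x * y) = mul (psi x) (psi y)) &
    (forall h k, H h -> psi (h * gz t k) = mul (phi h) (v k)).
Proof.
move=> mulA hH hn hphi hv hc hj.
pose ex x : int := xget 0%R [set z : int | H (x * gz t (- z)%R)].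
pose psi x := mul (phi (x * gz t (- ex x)%R)) (v (ex x)).
have psiE h k : H h -> psi (h * gz t k) = mul (phi h) (v k).
  move=> hh; rewrite /psi; set x := h * _.
  have : H (x * gz t (- ex x)%R).
    rewrite /ex; case: xgetP => [z -> //|/(_ k)] /=.
    by rewrite /x -mulgA -gzD subrr mulg1.
  move: (ex x) => z; rewrite /x -mulgA -gzD => hx.
  have hz := sgMl hH hh hx.
  by rewrite hphi // hj // -mulA -hv subrK.
exists psi => // _ _ [h hh [k ->]] [l hl [z ->]].
have hl' := nrm_gz (- k)%R hn hl.
rewrite mulg_gz_conj // !psiE //; last exact: sgM.
by rewrite hphi // hv !mulA -[in RHS](mulA (phi h)) hc // !mulA.
Qed.

(** Generators are adjoined one at a time. Commutators of [A] fall in [Y], so each new generator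
    normalizes what has been built, and it adds finitely many cosets because one of its powers lies
    in [Y]. *)
Lemma gen_torsion_finite A (Y : set G) (E : seq G) : is_subgroup A ->
  is_subgroup Y -> finite_set Y -> (forall a b, A a -> A b -> Y [~ a, b]) ->
  Y `<=` A -> {in E, forall e, A e} ->
  {in E, forall e, exists2 k, (0 < k)%N & Y (e ^+ k)} ->
  finite_set (generated ([set` E] `|` Y)).
Proof.
move=> hA hY fY hc YA; elim: E => [|e E IH] EA Et.
  apply: sub_finite_set fY; apply: gen_min => // x [] //.
set X := generated ([set` E] `|` Y) in IH.
have hX : is_subgroup X := gen_sg _.
have XA : X `<=` A.
  by apply: gen_min => // x [/= hx|/YA //]; apply: EA; rewrite inE hx orbT.
have YX : Y `<=` X by move=> y hy; apply: sub_gen; right.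
have eA : A e by apply: EA; rewrite mem_head.
have hn : nrm X e.
  move=> x hx; rewrite !conjg_commg; have xA := XA _ hx.
  by split; apply: (sgM hX hx); apply: YX; apply: hc => //; exact: sgV hA eA.
have [k k0 hk] := Et e (mem_head _ _).
apply: sub_finite_set (@extg_finite X e k hX _ k0 (YX _ hk)); last first.
  by apply: IH => f hf; [apply: EA|apply: Et]; rewrite inE hf orbT.
apply: gen_min (extg_sg hX hn) _ => x [/=|/YX]; last exact: sub_extg.
rewrite inE => /orP[/eqP ->|hx]; first exact: extg_id.
by apply: sub_extg; apply: sub_gen; left.
Qed.

Lemma commgX_lcs H i s f n : is_subgroup H -> lcs H i s -> H f ->
  exists2 l, lcs H i.+2 l & [~ s, f ^+ n] = [~ s, f] ^+ n * l.
Proof.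
move=> hH hs hf; have hL := lcs_sg i.+2 hH; have hL1 := lcs_sg i.+1 hH.
elim: n => [|n [l hl IH]]; first by exists 1; rewrite ?commg1 ?mulg1 //; apply: sg1.
set c := [~ s, f] in IH *.
have hc : lcs H i.+1 c by apply: lcsR.
exists (l * [~ c ^+ n * l, f]).
  apply: (sgM hL) => //; apply: lcsR => //.
  by apply: (sgM hL1); [exact: sgX hL1 hc|exact: (lcsS hH) hl].
by rewrite expgSr commgM IH -/c conjg_commg expgS !mulgA.
Qed.

(** Every layer of the lower central series is generated by finitely many torsion elements modulo
    the next: iterated commutators of the generators. Finiteness then climbs from the trivial term
    to [H]. *)
Lemma nilpotent_torsion_finite H n (E : seq G) : is_subgroup H ->
  lcs H n `<=` [set 1] -> {in E, forall e, H e} ->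
  H `<=` generated ([set` E] `|` lcs H 1) ->
  {in E, forall e, exists2 k, (0 < k)%N & lcs H 1 (e ^+ k)} ->
  finite_set H.
Proof.
move=> hH hn EH Eg Et.
have C i : exists F : seq G, [/\ {in F, forall e, lcs H i e},
    lcs H i `<=` generated ([set` F] `|` lcs H i.+1) &
    {in F, forall e, exists2 k, (0 < k)%N & lcs H i.+1 (e ^+ k)}].
  elim: i => [|i [F [F1 F2 F3]]]; first by exists E.
  exists [seq [~ s, f] | s <- F, f <- E].
  set K := generated _.
  have hK : is_subgroup K := gen_sg _.
  have K2 : lcs H i.+2 `<=` K by move=> x hx; apply: sub_gen; right.
  have hF : {in [seq [~ s, f] | s <- F, f <- E], forall e, lcs H i.+1 e}.
    move=> _ /allpairsP[[s f] /= [hs hf ->]].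
    by apply: lcsR; [apply: F1|apply: EH].
  have K1 : K `<=` lcs H i.+1.
    apply: gen_min (lcs_sg _ hH) _ => x [/hF //|]; exact: lcsS.
  split=> //.
  - apply: gen_min => // _ [x hx [y hy <-]].
    suff : (generated ([set` F] `|` lcs H i.+1)) `<=`
        [set x | lcs H i x /\ forall y, H y -> K [~ x, y]].
      by move=> /(_ x (F2 _ hx))[_]; apply.
    apply: gen_min (mid_sgl hH hK K2 K1) _ => s [/= hs|hs]; last first.
      by split=> [|z hz]; [exact: (lcsS hH) hs|apply: K2; apply: lcsR hs hz].
    split=> [|z hz]; first exact: F1.
    suff : generated ([set` E] `|` lcs H 1) `<=` [set y | H y /\ K [~ s, y]].
      by move=> /(_ z (Eg _ hz))[].
    apply: gen_min (mid_sgr hH hK K2 K1 s) _ => f [/= hf|hf].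
      split; first exact: EH.
      by apply: sub_gen; left; apply/allpairsP; exists (s, f).
    have : lcs H 1 `<=` [set y | H y /\ K [~ s, y]].
      apply: gen_min (mid_sgr hH hK K2 K1 s) _ => _ [a ha [b hb <-]].
      by split; [exact: sgR|apply: K2; apply: lcs_comm2 => //; apply: F1].
    exact.
  - move=> _ /allpairsP[[s f] /= [hs hf ->]].
    (* The torsion exponent of [f] also kills [s, f]: modulo the next term, [s, f]^k is [s, f^k],
       which is trivial there because f^k is a product of commutators. *)
    have [k k0 hk] := Et f hf; exists k => //.
    have [l hl e] := commgX_lcs k hH (F1 s hs) (EH f hf).
    apply: (sgMr (lcs_sg _ hH) hl); rewrite -e.
    have : lcs H 1 `<=` [set y | H y /\ lcs H i.+2 [~ s, y]].
      have hL := lcs_sg i.+2 hH.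
      have hM := mid_sgr hH hL (fun _ h => h) (@lcsS H i.+1 hH) s.
      apply: gen_min hM _ => _ [a ha [b hb <-]].
      by split; [exact: sgR|apply: lcs_comm2 => //; apply: F1].
    by move=> /(_ _ hk)[].
suff D i : finite_set (lcs H (n - i)) by have := D n; rewrite subnn.
elim: i => [|i IH].
  by rewrite subn0; apply: sub_finite_set hn _; apply: finite_set1.
have [lt|ge] := ltnP i n; last first.
  by have -> : (n - i.+1 = n - i)%N by lia.
have [F [F1 F2 F3]] := C (n - i.+1)%N.
have e : (n - i = (n - i.+1).+1)%N by lia.
rewrite e in IH; apply: sub_finite_set F2 _.
apply: (@gen_torsion_finite (lcs H (n - i.+1))) => //; first exact: lcs_sg.
- exact: (lcs_sg (n - i.+1).+1 hH).
- by move=> a b ha hb; apply: lcsR ha _; apply: lcs_subH hb.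
- exact: lcsS.
Qed.

Lemma additive_gz (phi : G -> int) H x (z : int) : is_subgroup H ->
  (forall x y, H x -> H y -> phi (x * y) = (phi x + phi y)%R) ->
  H x -> phi (gz x z) = (z * phi x)%R.
Proof.
move=> hH hp hx.
have p1 : phi 1 = 0%R by have := hp 1 1 (sg1 hH) (sg1 hH); rewrite mulg1; lia.
elim: z => [|n IH|n IH]; first by rewrite mul0r.
- rewrite -[n.+1%:Z]/(1 + n%:Z)%R gzD gz1 hp ?IH //; [by lia|exact: sg_gz].
- have hg (z : int) := sg_gz z hH hx.
  have := hp _ _ (hg (- n.+1%:Z)%R) (hg 1%R).
  rewrite -gzD gz1 (_ : - n.+1%:Z + 1 = - n%:Z)%R; last by lia.
  by rewrite IH; lia.
Qed.

(* The homomorphism is extended to one generator at a time; extending it to a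
   generator with a power already in the domain costs a multiplication by that
   exponent. *)
Lemma additive_separates H (E : seq G) e0 : is_subgroup H ->
  {in E, forall e, H e} -> H e0 -> (forall k, (0 < k)%N -> ~ lcs H 1 (e0 ^+ k)) ->
  H `<=` generated ([set` E] `|` lcs H 1) ->
  exists2 phi : G -> int,
    (forall x y, H x -> H y -> phi (x * y) = (phi x + phi y)%R) & phi e0 <> 0%R.
Proof.
move=> hH EH h0 nt Hg; have hK := lcs_sg 1 hH; have KH := lcs_subH (n := 1) hH.
suff [A [phi [hA AH EA KA [Ae0 hp pK p0]]]] : exists A : set G, exists phi : G -> int,
    [/\ is_subgroup A, A `<=` H, [set` E] `<=` A, lcs H 1 `<=` A &
    [/\ A e0, forall x y, A x -> A y -> phi (x * y) = (phi x + phi y)%R,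
      forall x, lcs H 1 x -> phi x = 0%R & phi e0 <> 0%R]].
  have HA : H `<=` A by apply: subset_trans Hg (gen_min hA _) => x [/EA|/KA].
  by exists phi => // x y /HA hx /HA hy; apply: hp.
have nK A e : lcs H 1 `<=` A -> is_subgroup A -> A `<=` H -> H e -> nrm A e.
  move=> KA hA AH he x hx; rewrite !conjg_commg.
  have hx' := AH _ hx; split; apply: (sgM hA hx); apply: KA.
    exact: (@lcsR H 0).
  by apply: (@lcsR H 0) => //; exact: sgV.
elim: E EH {Hg} => [|e E IH] EH.
  have hn := nK _ _ (fun x => id) hK KH h0.
  have [||||phi p1 p2] := @homs_extend int +%R (fun=> 0%R) id _ _ (@addrA _) hK hn.
  - by move=> *; rewrite addr0.
  - by [].
  - by move=> *; rewrite add0r addr0.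
  (* No non-zero power of [e0] lies in the commutator subgroup, so sending [e0] to 1 meets no
     constraint. *)
  - move=> j hj; case: (j =P 0%R) => [->//|j0].
    case: (nt `|j|%N); first by lia.
    rewrite -gzX abszE; case: (ger0P j) => _ //.
    by rewrite gzN; exact: sgV hK hj.
  exists (extg (lcs H 1) e0), phi; split=> //.
  - exact: extg_sg.
  - exact: extg_min.
  - exact: sub_extg.
  - split=> //; first exact: extg_id.
    + by move=> x hx; rewrite -[x]mulg1 -(gz0 e0) p2.
    + by rewrite -[e0]mul1g -(gz1 e0) p2 //; apply: sg1.
have [|A [phi [hA AH EA KA [Ae0 p1 p2 p3]]]] := IH.
  by move=> f hf; apply: EH; rewrite inE hf orbT.
have he : H e by apply: EH; rewrite mem_head.
have hn := nK _ _ KA hA AH he.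
(* If e^m is already in [A], take c = phi(e^m): both m * phi(e^j) and j * c are then phi(e^(mj)). If
   no non-zero power is, m = 1 and the value c = 0 is a free choice. *)
have [m [m0 [c hc]]] : exists m : int, m <> 0%R /\ exists c : int,
    forall j, A (gz e j) -> (m * phi (gz e j) = j * c)%R.
  have [[m [m0 hm]]|no] := pselect (exists m : int, m <> 0%R /\ A (gz e m)).
    exists m; split=> //; exists (phi (gz e m)) => j hj.
    rewrite -(additive_gz _ hA p1 hj) -(additive_gz _ hA p1 hm).
    by rewrite !gzM mulrC.
  exists 1%R; split=> //; exists 0%R => j hj.
  case: (j =P 0%R) => [->|j0]; last by case: no; exists j.
  by rewrite gz0 p2 //; apply: sg1.
have [||||psi q1 q2] := @homs_extend int +%R (fun x => m * phi x)%R
    (fun j => j * c)%R _ _ (@addrA _) hA hn.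
- by move=> x y hx hy; rewrite p1 // mulrDr.
- by move=> a b; rewrite mulrDl.
- move=> k x hx; rewrite addrC conjg_commg p1 //; last first.
    by apply: KA; apply: (@lcsR H 0); [exact: AH|exact: sg_gz].
  rewrite (p2 [~ _, _]) ?addr0 //.
  by apply: (@lcsR H 0); [exact: AH|exact: sg_gz].
- exact: hc.
have q3 x : A x -> psi x = (m * phi x)%R.
  by move=> hx; rewrite -{1}[x]mulg1 -(gz0 e) q2 // mul0r addr0.
exists (extg A e), psi; split=> //.
- exact: extg_sg.
- exact: extg_min.
- move=> x /=; rewrite inE => /orP[/eqP ->|hx]; first exact: extg_id.
  exact/sub_extg/EA.
- by move=> x /KA; apply: sub_extg.
- split=> //; first exact: sub_extg.
  + by move=> x hx; rewrite q3 ?p2 ?mulr0 //; apply: KA.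
  + by rewrite q3 //; lia.
Qed.

End Subgroups.

(** * Normalizer condition, maps onto the integers and their kernels *)

Section NilpotentGroups.
Local Open Scope group_scope.
Variable G : groupType.
Implicit Types (H K S : set G) (x y t : G).

Lemma finite_set_inj_in (T : eqType) (f : G -> T) H :
  (forall x y, H x -> H y -> f x = f y -> x = y) ->
  finite_set (f @` H) -> finite_set H.
Proof.
move=> fI fH; apply: sub_finite_set (finite_image (fun c => xget 1 [set x | H x /\ f x = c]) fH).
move=> x hx; exists (f x); first by exists x.
by apply: xget_unique => // y [hy /(fI _ _ hy hx)].
Qed.

Lemma finite_subgroup_torsion H t : is_subgroup H -> finite_set H -> H t ->
  exists2 k, (0 < k)%N & t ^+ k = 1.
Proof.
move=> hH fH ht; apply: contrapT => nt; apply: infinite_nat.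
have e : [set: nat] = [set n | H (t ^+ n)].
  by apply/seteqP; split=> // n _; exact: sgX hH ht.
have fI m n : t ^+ m = t ^+ n -> m = n.
  wlog le : m n / (m <= n)%N => [hw|].
    by case/orP: (leq_total m n) => le e'; [|apply/esym]; apply: hw.
  move=> e'; apply/eqP; rewrite eqn_leq le /= leqNgt; apply/negP => lt.
  by apply: nt; exists (n - m)%N; rewrite ?subn_gt0 // expgnFr // e' mulgV.
apply: sub_finite_set (finite_image (fun x => xget 0%N [set n | t ^+ n = x]) fH).
move=> n _; exists (t ^+ n); first exact: sgX hH ht.
by apply: xget_unique => // m /= /fI.
Qed.

Section Nilpotent.
Variable n : nat.
Hypothesis Gn : lower_central G n = [set 1].

Let Ln x : lcs setT n x -> x = 1.
Proof. by rewrite lcsT Gn. Qed.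

(** Take the first term of the lower central series whose intersection with [K] lies in [H], and [t]
    in [K] one term earlier but outside [H]. Commutators of [H] with [t] drop by one term, hence
    land in [H]. *)
Lemma normalizer_grows H K : is_subgroup H -> is_subgroup K -> H `<=` K ->
  ~ K `<=` H -> exists t, [/\ K t, ~ H t & nrm H t].
Proof.
move=> hH hK HK nKH.
have ex : exists i, `[< forall x, lcs setT i x -> K x -> H x >].
  by exists n; apply/asboolP => x /Ln -> _; exact: sg1 hH.
case: (ex_minnP ex) => -[|i] /asboolP hi mini.
  by case: nKH => x hx; apply: hi.
have [t [ti Kt nHt]] : exists t, [/\ lcs setT i t, K t & ~ H t].
  apply: contrapT => no; have /mini : `[< forall x, lcs setT i x -> K x -> H x >].
    apply/asboolP => x xi Kx; apply: contrapT => nHx; apply: no.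
    by exists x.
  by rewrite ltnn.
exists t; split=> // x hx.
have h y : K y -> lcs setT i y -> H (x ^ y).
  move=> Ky yi; rewrite conjg_commg; apply: (sgM hH hx); apply: hi.
    rewrite -invgR; apply: (sgV (lcs_sg _ (sgT G))); exact: lcsR.
  by apply: sgR => //; apply: HK.
split; apply: h => //; first exact: sgV.
exact: sgV (lcs_sg _ (sgT G)) ti.
Qed.

(** Induction on the number of listed elements of [K] not yet reached: each step adjoins a
    normalizing element from outside, which itself leaves the count. *)
Lemma finite_subgroup_ind K (P : set G -> Prop) : is_subgroup K ->
  finite_set K -> P [set 1] ->
  (forall H t k, is_subgroup H -> H `<=` K -> nrm H t -> ~ H t -> K t ->
     (0 < k)%N -> t ^+ k = 1 -> P H -> P (extg H t)) -> P K.
Proof.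
move=> hK fK P1 PS; have /finite_seqP[s Ks] := fK.
suff h m H : is_subgroup H -> H `<=` K -> P H ->
    (count (fun x => ~~ `[< H x >]) s <= m)%N -> P K.
  apply: (h _ _ _ _ P1 (leqnn _)) => [|x ->]; last exact: sg1 hK.
  by split=> [//|_ _ -> ->|_ ->]; rewrite /= ?mulg1 ?invg1.
elim: m H => [|m IH] H hH HK PH cH.
- suff -> : K = H by [].
  apply/seteqP; split=> //; rewrite Ks => x /= xs.
  move: cH; rewrite leqn0 -leqn0 leqNgt -has_count => /hasPn/(_ _ xs).
  by rewrite negbK => /asboolP.
- have [KH|nKH] := pselect (K `<=` H).
    by have -> : K = H by apply/seteqP.
  have [t [Kt nHt hn]] := normalizer_grows hH hK HK nKH.
  have [k k0 hk] := finite_subgroup_torsion hK fK Kt.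
  apply: (IH (extg H t)); first exact: extg_sg.
  + exact: extg_min.
  + exact: (PS H t k).
  + rewrite -ltnS; apply: leq_trans cH.
    have ts : t \in s by move: Kt; rewrite Ks.
    rewrite -!sum1_count [X in (_ < X)%N](bigID (fun x => `[< extg H t x >])) /=.
    rewrite -[X in (X < _)%N]add0n -addSn; apply: leq_add.
      rewrite lt0n; apply/eqP => e0.
      have : has (fun x => ~~ `[< H x >] && `[< extg H t x >]) s.
        by apply/hasP; exists t => //; apply/andP; split; apply/asboolP => //; exact: extg_id.
      by rewrite has_count -sum1_count e0.
    apply: eq_leq; apply: eq_bigl => x.
    case: asboolP => //= hx; first by rewrite andbF.
    by rewrite andbT; apply/esym/asboolP => hx'; apply/hx/sub_extg.
Qed.

(** The values of [f] are the multiples of the least positive one, by division with remainder;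
    dividing by it gives a map that takes the value 1. *)
Lemma unit_of_additive (f : G -> int) (g : G) :
  (forall x y, f (x * y) = (f x + f y)%R) -> f g <> 0%R ->
  exists psi : G -> int, exists2 t,
    (forall x y, psi (x * y) = (psi x + psi y)%R) & psi t = 1%R.
Proof.
move=> fM fg; have fV x z : f (gz x z) = (z * f x)%R.
  by apply: (additive_gz _ (sgT G)) => // *; apply: fM.
have ex : exists d, `[< exists x, f x = d.+1 >].
  exists `|f g|.-1; apply/asboolP; case: (ltrP (f g) 0%R) => h.
    by exists (gz g (-1)%R); rewrite fV; lia.
  by exists g; lia.
case: (ex_minnP ex) => d /asboolP[t ht] mind.
have dv x : (d.+1 %| f x)%Z.
  apply/dvdz_mod0P; apply/eqP/negPn/negP => /eqP r0.
  have r1 : (0 <= (f x %% d.+1)%Z)%R by apply: modz_ge0.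
  have r2 : ((f x %% d.+1)%Z < d.+1)%R by apply: ltz_pmod.
  have [m hm] : exists m : nat, (f x %% d.+1)%Z = m.+1.
    by exists (absz (f x %% d.+1)%Z).-1; lia.
  have h : `[< exists x, f x = m.+1 >].
    apply/asboolP; exists (x * gz t (- (f x %/ d.+1)%Z)%R).
    by rewrite fM fV ht {1}(divz_eq (f x) d.+1); lia.
  by have := mind m h; lia.
exists (fun x => (f x %/ d.+1)%Z), t; last by rewrite ht divzz.
by move=> x y; rewrite fM divzDl.
Qed.

(** If all generators were torsion modulo the commutator subgroup, the group would be finite; a
    generator of infinite order there is separated by an additive map. *)
Lemma infinite_nilpotent_onto : finitely_generated G -> ~ finite_set [set: G] ->
  exists psi : G -> int, exists2 t,
    (forall x y, psi (x * y) = (psi x + psi y)%R) & psi t = 1%R.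
Proof.
move=> [S /finite_seqP[E ->] gE] nfin.
have gT : [set: G] `<=` generated ([set` E] `|` lcs setT 1).
  by rewrite -gE; apply: gen_mono => x; left.
have [tor|ntor] := pselect {in E, forall e, exists2 k, (0 < k)%N & lcs setT 1 (e ^+ k)}.
  case: nfin; apply: (@nilpotent_torsion_finite _ setT n E) => //.
have [e [eE ne]] : exists e, e \in E /\ forall k, (0 < k)%N -> ~ lcs setT 1 (e ^+ k).
  apply: contrapT => no; apply: ntor => e eE; apply: contrapT => h; apply: no.
  by exists e; split=> // k k0 hk; apply: h; exists k.
have [f fM f0] := additive_separates (sgT G) (fun _ _ => I) I ne gT.
by apply: unit_of_additive f0 => x y; apply: fM.
Qed.

Section Kernel.
Variable psi : G -> int.
Hypothesis psiM : forall x y, psi (x * y) = (psi x + psi y)%R.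

Definition kerg : set G := [set x | psi x = 0%R].

Lemma psi_gz x z : psi (gz x z) = (z * psi x)%R.
Proof. by apply: (additive_gz _ (sgT G)) => // *; apply: psiM. Qed.

Lemma psi1 : psi 1 = 0%R.
Proof. by have := psiM 1 1; rewrite mulg1; lia. Qed.

Lemma psiV x : psi x^-1 = (- psi x)%R.
Proof. by have := psiM x x^-1; rewrite mulgV psi1; lia. Qed.

Lemma psiJ x y : psi (x ^ y) = psi x.
Proof. by rewrite /conjg !psiM psiV; lia. Qed.

Lemma psiR x y : psi [~ x, y] = 0%R.
Proof. by rewrite /commg psiM psiJ psiV; lia. Qed.

Lemma kerg_sg : is_subgroup kerg.
Proof.
split=> [|x y|x]; rewrite /kerg /= ?psi1 // ?psiM ?psiV; first by move=> -> ->.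
by move=> ->; rewrite oppr0.
Qed.

Lemma kergJ x y : kerg x -> kerg (x ^ y).
Proof. by rewrite /kerg /= psiJ. Qed.

Variable t : G.
Hypothesis psit : psi t = 1%R.

Lemma kerg_dec x : kerg (x * gz t (- psi x)%R).
Proof. by rewrite /kerg /= psiM psi_gz psit; lia. Qed.

Lemma finite_kerg_vc : finite_set kerg -> virtually_cyclic G.
Proof.
move=> fK; exists (generated [set t]); first by exists t.
apply: sub_finite_set (finite_image (left_coset (generated [set t])) fK).
move=> _ [x _ <-]; exists (x * gz t (- psi x)%R); first exact: kerg_dec.
have hg := gen_sg [set t]; have ht z : generated [set t] (gz t z).
  by apply: (sg_gz z hg); apply: sub_gen.
apply/seteqP; split=> _ [h hh <-].
  by exists (gz t (- psi x)%R * h); rewrite ?mulgA //; exact: sgM hg (ht _) hh.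
exists (gz t (psi x) * h); first exact: sgM hg (ht _) hh.
by rewrite mulgA -[x * _ * _]mulgA -gzD addNr mulg1.
Qed.

(** A cyclic subgroup of finite index cannot lie in the kernel, since the powers of [t] would then
    lie in distinct cosets. Hence it meets the kernel trivially, and the kernel injects into the
    finite set of cosets. *)
Lemma vc_finite_kerg : virtually_cyclic G -> finite_set kerg.
Proof.
move=> [_ [a ->] fi].
have ha x : generated [set a] x -> exists z, x = gz a z.
  have hg : is_subgroup [set x | exists z, x = gz a z].
    split=> /= [|_ _ [z ->] [w ->]|_ [z ->]]; first by exists 0%R.
      by exists (z + w)%R; rewrite gzD.
    by exists (- z)%R; rewrite gzN.
  by apply: (gen_min hg) => _ ->; exists 1%R; rewrite gz1.
have [a0|a0] := eqVneq (psi a) 0%R.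
  case: infinite_nat.
  pose f (n : nat) := left_coset (generated [set a]) (t ^+ n).
  have fI m m' : f m = f m' -> m = m'.
    move=> e; have : f m (t ^+ m) by exists 1; [exact: sg1 (gen_sg _)|rewrite mulg1].
    rewrite e => -[_ /ha[z ->]] /(congr1 psi).
    by rewrite psiM -!gzX !psi_gz a0 psit; lia.
  apply: sub_finite_set (finite_image (fun C => xget 0%N [set m | f m = C]) fi).
  move=> m _; exists (f m); first by exists (t ^+ m).
  by apply: xget_unique => // m' /= /fI.
apply: (@finite_set_inj_in _ (left_coset (generated [set a]))); last first.
  by apply: sub_finite_set fi => _ [x _ <-]; exists x.
move=> x y hx hy e.
have : left_coset (generated [set a]) x x by exists 1; [exact: sg1 (gen_sg _)|rewrite mulg1].
rewrite e => -[_ /ha[z ->]] e'; have := congr1 psi e'.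
rewrite psiM psi_gz hx hy => hz.
have z0 : z = 0%R by move: hz a0 => /eqP; rewrite add0r mulf_eq0 => /orP[/eqP|->].
by rewrite -e' z0 mulg1.
Qed.

Definition adt x := [~ x, t].

Lemma adt_kerg x : kerg (adt x). Proof. exact: psiR. Qed.

Lemma iter_adt_lcs x m : lcs setT m (iter m adt x).
Proof. by elim: m => // m IH; apply: lcsR. Qed.

Lemma iter_adt1 x m : (n <= m)%N -> iter m adt x = 1.
Proof.
move=> le; rewrite -(subnK le) iterD (Ln (iter_adt_lcs x n)).
by elim: (m - n)%N => //= k ->; rewrite /adt comm1g.
Qed.

Let N1 := lcs kerg 1.

Lemma N1_sg : is_subgroup N1. Proof. exact: lcs_sg kerg_sg. Qed.

Lemma N1J x y : N1 x -> N1 (x ^ y).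
Proof. by apply: lcsJ => z; apply: kergJ. Qed.

(** Subgroups of finitely generated groups need not inherit the property by a general argument; here
    the translates of the generators into the kernel and their finitely many non-trivial iterated
    commutators with [t] span a set stable under conjugation by [t] and its inverse, modulo
    [N, N]. *)
Lemma kerg_generators : finitely_generated G ->
  exists2 E : seq G, {in E, forall e, kerg e} & kerg `<=` generated ([set` E] `|` N1).
Proof.
move=> [S /finite_seqP[E ->] gE].
pose X := [seq x * gz t (- psi x)%R | x <- E].
pose E' := [seq iter m adt x | m <- iota 0 n.+1, x <- X].
have EK : {in E', forall e, kerg e}.
  move=> _ /allpairsP[[m x] /= [_ /mapP[y _ ->] ->]].
  by case: m => [|m]; [exact: kerg_dec|exact: adt_kerg].
exists E' => //; set K := generated _.
have hK : is_subgroup K := gen_sg _.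
have NK : N1 `<=` K by move=> x hx; apply: sub_gen; right.
have XK x m : x \in X -> K (iter m adt x).
  move=> hx; have [le|lt] := leqP m n; last first.
    by rewrite iter_adt1 ?(ltnW lt) //; exact: sg1 hK.
  by apply: sub_gen; left; apply/allpairsP; exists (m, x); rewrite mem_iota.
have Kt x : K x -> K (x ^ t).
  apply: genJ => y [/allpairsP[[m z] /= [_ hz ->]]|hy]; last by apply: NK; exact: N1J.
  by rewrite conjg_commg; apply: sgM hK _ _; [exact: XK|exact: (XK _ m.+1)].
have KV x : K x -> K (x ^ t^-1).
  apply: genJ => y [/allpairsP[[m z] /= [_ hz ->]]|hy]; last by apply: NK; exact: N1J.
  (* Descending induction from the iterates that are trivial: z_i equals z_i^(t^-1) *
     z_(i+1)^(t^-1), so the second factor yields the first. *)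
  suff h k i : (n <= k + i)%N -> K (iter i adt z ^ t^-1).
    by apply: (h n m); lia.
  elim: k i => [|k IH] i le.
    by rewrite iter_adt1 ?conj1g //; exact: sg1 hK.
  have h := IH i.+1 ltac:(lia).
  have e : iter i adt z = iter i adt z ^ t^-1 * iter i.+1 adt z ^ t^-1.
    by rewrite -conjMg /= /adt -conjg_commg -conjgM mulgV conjg1.
  by apply: (sgMr hK h); rewrite -e; exact: XK.
have hn : nrm K t by move=> x hx; split; [exact: Kt|exact: KV].
have KN : K `<=` kerg.
  apply: gen_min kerg_sg _ => x [/EK //|]; exact: (lcs_subH kerg_sg).
have : [set: G] `<=` extg K t.
  rewrite -gE; apply: gen_min (extg_sg hK hn) _ => x hx.
  exists (x * gz t (- psi x)%R).
    by apply: (XK _ 0%N); apply/mapP; exists x.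
  by exists (psi x); rewrite -mulgA -gzD addNr mulg1.
move=> h x hx; have [y hy [z e]] := h x I.
have : psi x = z by rewrite e psiM psi_gz psit (KN _ hy); lia.
by rewrite hx => z0; rewrite e -z0 mulg1.
Qed.

(** On the abelianization of N, the commutator with [t] is a nilpotent endomorphism. Starting from a
    generator of infinite order, the last iterate [b] of infinite order has [b, t] torsion of some
    exponent k, and a = b^k makes [a, t] trivial there. *)
Lemma kerg_pairing : finitely_generated G -> ~ finite_set kerg ->
  exists phi : G -> int, exists a : G,
    [/\ forall x y, kerg x -> kerg y -> phi (x * y) = (phi x + phi y)%R,
        kerg a, phi a <> 0%R & N1 [~ a, t]].
Proof.
move=> fg nfin; have [E EK gE] := kerg_generators fg.
have hK := kerg_sg; have hN := N1_sg.
have NK : N1 `<=` kerg by exact: (lcs_subH kerg_sg).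
have [tor|ntor] := pselect {in E, forall e, exists2 k, (0 < k)%N & N1 (e ^+ k)}.
  case: nfin; apply: (@nilpotent_torsion_finite _ kerg n E) => //.
  by move=> x /(@lcs_mono _ kerg setT n (fun _ _ => I))/Ln.
have [e [eE ne]] : exists e, e \in E /\ forall k, (0 < k)%N -> ~ N1 (e ^+ k).
  apply: contrapT => no; apply: ntor => e eE; apply: contrapT => h; apply: no.
  by exists e; split=> // k k0 hk; apply: h; exists k.
have he : kerg e by apply: EK.
have ex : exists m, `[< exists2 k, (0 < k)%N & N1 (iter m adt e ^+ k) >].
  by exists n; apply/asboolP; exists 1%N; rewrite // iter_adt1 // expg1n; exact: sg1 hN.
case: (ex_minnP ex) => -[|m] /asboolP[k k0 hk] minm; first by case: (ne k).
set b := iter m adt e in hk *.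
have hb : kerg b by rewrite /b; case: (m) => // m'; exact: adt_kerg.
have nb j : (0 < j)%N -> ~ N1 (b ^+ j).
  move=> j0 hj; have /minm : `[< exists2 k, (0 < k)%N & N1 (iter m adt e ^+ k) >].
    by apply/asboolP; exists j.
  by rewrite ltnn.
have [phi pM p0] := additive_separates hK EK hb nb gE.
exists phi, (b ^+ k); split=> //; first exact: sgX hK hb.
  by rewrite -gzX (additive_gz _ hK pM hb); lia.
(* Commutation with [t] is a homomorphism modulo [N, N], so the exponent moves outside. *)
have: forall j, exists2 l, N1 l & [~ b ^+ j, t] = [~ b, t] ^+ j * l.
  elim=> [|j [l hl IH]]; first by exists 1; rewrite ?comm1g ?mulg1 //; exact: sg1 hN.
  have hc : kerg [~ b, t] by exact: psiR.
  have hm : N1 [~ [~ b, t], b ^+ j] by apply: (@lcsR _ kerg 0) => //; exact: sgX hK hb.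
  exists ([~ [~ b, t], b ^+ j] ^ ([~ b, t] ^+ j) * l).
    by apply: sgM hN _ hl; exact: N1J.
  rewrite expgS commMg IH conjg_commg.
  move: {hm} ([~ [~ b, t], b ^+ j]) => d; move: {IH hc} ([~ b, t]) => c.
  by rewrite -mulgA (mulgA d) (conjgC d) expgS -(mulgA c) -(mulgA (c ^+ j)).
move=> /(_ k)[l hl ->]; exact: sgM hN hk hl.
Qed.
End Kernel.
End Nilpotent.
End NilpotentGroups.

(** * Operator and Schatten bounds *)

Section ComplexNorm.
Variable R : realType.
Local Notation C := R[i].
Implicit Types z w : C.

Definition cabs z : R := complex.Re `|z|.

Lemma normE z : `|z| = (cabs z)%:C. Proof. by []. Qed.

Lemma cabs_ge0 z : 0 <= cabs z.
Proof. by rewrite -ler0c -normE. Qed.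

Lemma cabsM z w : cabs (z * w) = cabs z * cabs w.
Proof. by apply: complexI; rewrite -normE normrM !normE -rmorphM. Qed.

Lemma cabsD z w : cabs (z + w) <= cabs z + cabs w.
Proof. by rewrite -lecR rmorphD -!normE; apply: ler_normD. Qed.

Lemma cabs0 : cabs 0 = 0. Proof. by apply: complexI; rewrite -normE normr0. Qed.

Lemma cabs1 : cabs 1 = 1. Proof. by apply: complexI; rewrite -normE normr1. Qed.

Lemma cabsN z : cabs (- z) = cabs z.
Proof. by apply: complexI; rewrite -!normE normrN. Qed.

Lemma cabs_conj z : cabs (Num.conj z) = cabs z.
Proof. by apply: complexI; rewrite -!normE norm_conjC. Qed.

Lemma cabs_real (x : R) : cabs x%:C = `|x|.
Proof. by apply: complexI; rewrite -normE normc_def /= expr0n addr0 sqrtr_sqr. Qed.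

Lemma cabs_eq0 z : (cabs z == 0) = (z == 0).
Proof.
rewrite -[in RHS]normr_eq0 normE; apply/eqP/eqP => [->//|h]; exact: complexI.
Qed.

Lemma cabsX z n : cabs (z ^+ n) = cabs z ^+ n.
Proof. by elim: n => [|n IH]; rewrite ?cabs1 // !exprS cabsM IH. Qed.

Lemma cabsV z : cabs z^-1 = (cabs z)^-1.
Proof. by apply: complexI; rewrite -normE normfV normE fmorphV. Qed.

Lemma cabs_sum (I : Type) (r : seq I) (P : pred I) (F : I -> C) :
  cabs (\sum_(i <- r | P i) F i) <= \sum_(i <- r | P i) cabs (F i).
Proof.
elim/big_ind2: _ => [|x1 x2 y1 y2 h1 h2|//]; first by rewrite cabs0.
by apply: le_trans (cabsD _ _) _; apply: lerD.
Qed.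

Lemma conj_mul z : Num.conj z * z = (cabs z ^+ 2)%:C.
Proof. by rewrite mulrC -normCK normE -rmorphXn. Qed.

Lemma Re_le_cabs z : complex.Re z <= cabs z.
Proof.
by apply: le_trans (ler_norm _) _; rewrite -lecR -normE; apply: normc_ge_Re.
Qed.

End ComplexNorm.

Section EuclideanNorm.
Variable R : realType.
Local Notation C := R[i].

Lemma cauchy_schwarz_sum (n : nat) (a b : 'I_n -> R) :
  \sum_i a i * b i <=
    Num.sqrt (\sum_i a i ^+ 2) * Num.sqrt (\sum_i b i ^+ 2).
Proof.
set A := \sum_i a i ^+ 2; set B := \sum_i b i ^+ 2.
have vanish (c : 'I_n -> R) : \sum_i c i ^+ 2 = 0 -> forall i, c i = 0.
  move=> /psumr_eq0P h i; apply/eqP; rewrite -sqrf_eq0; apply/eqP.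
  by apply: h => // j _; apply: sqr_ge0.
have pos (c : 'I_n -> R) : 0 <= \sum_i c i ^+ 2.
  by apply: sumr_ge0 => i _; apply: sqr_ge0.
have [A0|A0] := eqVneq A 0.
  by rewrite big1 ?A0 ?sqrtr0 ?mul0r // => i _; rewrite (vanish a) // mul0r.
have [B0|B0] := eqVneq B 0.
  by rewrite big1 ?B0 ?sqrtr0 ?mulr0 // => i _; rewrite (vanish b) // mulr0.
have pA : 0 < Num.sqrt A by rewrite sqrtr_gt0 lt_def A0 pos.
have pB : 0 < Num.sqrt B by rewrite sqrtr_gt0 lt_def B0 pos.
have sA := sqr_sqrtr (pos a); have sB := sqr_sqrtr (pos b).
rewrite -/A -/B in sA sB.
move: (Num.sqrt A) (Num.sqrt B) pA pB sA sB => x y px py sA sB.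
(* With these weights the termwise arithmetic-geometric inequality sums exactly to the product of
   the norms. *)
have -> : x * y = \sum_i (y / x * a i ^+ 2 + x / y * b i ^+ 2) / 2.
  rewrite -mulr_suml big_split -!mulr_sumr /= -/A -/B -sA -sB.
  by field; rewrite !gt_eqF.
apply: ler_sum => i _; rewrite -subr_ge0.
have -> : (y / x * a i ^+ 2 + x / y * b i ^+ 2) / 2 - a i * b i =
    (y * a i - x * b i) ^+ 2 / (2 * x * y).
  by field; rewrite !gt_eqF.
by rewrite divr_ge0 ?sqr_ge0 // !mulr_ge0 // ltW.
Qed.

Lemma enormE n (x : 'cV[C]_n) :
  euclidean_norm x = Num.sqrt (\sum_i cabs (x i 0) ^+ 2).
Proof. by []. Qed.

Lemma enorm_ge0 n (x : 'cV[C]_n) : 0 <= euclidean_norm x.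
Proof. exact: sqrtr_ge0. Qed.

Lemma enorm_sqr n (x : 'cV[C]_n) : euclidean_norm x ^+ 2 = \sum_i cabs (x i 0) ^+ 2.
Proof. by rewrite sqr_sqrtr // sumr_ge0 // => i _; apply: sqr_ge0. Qed.

Lemma enorm_sqrC n (x : 'cV[C]_n) : (euclidean_norm x ^+ 2)%:C = (x^t* *m x) 0 0.
Proof.
rewrite enorm_sqr rmorph_sum mxE; apply: eq_bigr => i _.
by rewrite !mxE conj_mul.
Qed.

Lemma enorm_eq0 n (x : 'cV[C]_n) : euclidean_norm x = 0 -> x = 0.
Proof.
move=> h; have := enorm_sqr x; rewrite h expr0n /= => /esym/psumr_eq0P h0.
apply/matrixP=> i j; rewrite ord1 mxE; apply/eqP.
rewrite -cabs_eq0 -sqrf_eq0; apply/eqP; apply: h0 => // k _; exact: sqr_ge0.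
Qed.

Lemma enorm0 n : euclidean_norm (0 : 'cV[C]_n) = 0.
Proof. by rewrite enormE big1 ?sqrtr0 // => i _; rewrite mxE cabs0 expr0n. Qed.

Lemma enorm_dot n (x y : 'cV[C]_n) :
  cabs ((x^t* *m y) 0 0) <= euclidean_norm x * euclidean_norm y.
Proof.
apply: le_trans (cauchy_schwarz_sum _ _); rewrite mxE; apply: le_trans (cabs_sum _ _ _) _.
by apply: ler_sum => i _; rewrite !mxE cabsM cabs_conj.
Qed.

Lemma enormZ n a (x : 'cV[C]_n) : euclidean_norm (a *: x) = cabs a * euclidean_norm x.
Proof.
rewrite !enormE -[cabs a]ger0_norm ?cabs_ge0 // -sqrtr_sqr -sqrtrM ?sqr_ge0 //.
rewrite mulr_sumr; congr Num.sqrt; apply: eq_bigr => i _.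
by rewrite mxE cabsM exprMn.
Qed.

Lemma enormD n (x y : 'cV[C]_n) :
  euclidean_norm (x + y) <= euclidean_norm x + euclidean_norm y.
Proof.
rewrite -(@ler_pXn2r _ 2) ?nnegrE ?addr_ge0 ?enorm_ge0 // sqrrD.
rewrite !enorm_sqr.
have := cauchy_schwarz_sum (fun i => cabs (x i 0)) (fun i => cabs (y i 0)).
rewrite -!enormE => h.
apply: (@le_trans _ _ (\sum_i (cabs (x i 0) + cabs (y i 0)) ^+ 2)).
  apply: ler_sum => i _; rewrite mxE ler_pXn2r ?nnegrE ?addr_ge0 ?cabs_ge0 //.
  exact: cabsD.
under eq_bigr do rewrite sqrrD.
by rewrite !big_split /= lerD2r lerD2l mulr2n lerD.
Qed.

Lemma enorm_coord n (x : 'cV[C]_n) i : cabs (x i 0) <= euclidean_norm x.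
Proof.
rewrite -(@ler_pXn2r _ 2) ?nnegrE ?cabs_ge0 ?enorm_ge0 // enorm_sqr.
by rewrite (bigD1 i) //= lerDl sumr_ge0 // => j _; apply: sqr_ge0.
Qed.

End EuclideanNorm.

Section OperatorBounds.
Variable R : realType.
Local Notation C := R[i].
Local Notation enorm := (@euclidean_norm R _).

Lemma adjM m n p (A : 'M[C]_(m, n)) (B : 'M[C]_(n, p)) :
  (A *m B)^t* = B^t* *m A^t*.
Proof. by rewrite trmx_mul map_mxM. Qed.

Lemma adj1 n : (1%:M : 'M[C]_n)^t* = 1%:M.
Proof. by rewrite trmx1 map_mx1. Qed.

(** An inequality rather than a supremum, and for rectangular matrices, so that vectors can serve as
    test matrices. *)
Definition opb m n (M : 'M[C]_(m, n)) (c : R) :=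
  forall x : 'cV[C]_n, enorm (M *m x) <= c * enorm x.

Lemma opbW m n (M : 'M[C]_(m, n)) c d : c <= d -> opb M c -> opb M d.
Proof.
by move=> cd h x; apply: le_trans (h x) _; rewrite ler_wpM2r ?enorm_ge0.
Qed.

Lemma opbD m n (A B : 'M[C]_(m, n)) a b : opb A a -> opb B b -> opb (A + B) (a + b).
Proof.
move=> hA hB x; rewrite mulmxDl; apply: le_trans (enormD _ _) _.
by rewrite mulrDl lerD.
Qed.

Lemma opbM m n p (A : 'M[C]_(m, n)) (B : 'M[C]_(n, p)) a b : 0 <= a ->
  opb A a -> opb B b -> opb (A *m B) (a * b).
Proof.
move=> a0 hA hB x; rewrite -mulmxA; apply: le_trans (hA _) _.
by rewrite -mulrA ler_wpM2l.
Qed.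

Lemma opbZ m n (A : 'M[C]_(m, n)) a k : opb A a -> opb (k *: A) (cabs k * a).
Proof.
by move=> h x; rewrite -scalemxAl enormZ -mulrA ler_wpM2l ?cabs_ge0.
Qed.

Lemma opbN m n (A : 'M[C]_(m, n)) a : opb A a -> opb (- A) a.
Proof. by move=> /(opbZ (-1)); rewrite scaleN1r cabsN cabs1 mul1r. Qed.

Lemma opbB m n (A B : 'M[C]_(m, n)) a b : opb A a -> opb B b -> opb (A - B) (a + b).
Proof. by move=> hA /opbN; apply: opbD. Qed.

Lemma opb0 m n : opb (0 : 'M[C]_(m, n)) 0.
Proof. by move=> x; rewrite mul0mx enorm0 mul0r. Qed.

Lemma opb1 n : opb (1%:M : 'M[C]_n) 1.
Proof. by move=> x; rewrite mul1mx mul1r. Qed.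

(** The square of |M* x| is the pairing of M M* x with x, at most c |M* x| |x|; one factor |M* x|
    cancels. *)
Lemma opb_adj m n (M : 'M[C]_(m, n)) c : 0 <= c -> opb M c -> opb (M^t*) c.
Proof.
move=> c0 h x; have [->|nz] := eqVneq (enorm (M^t* *m x)) 0.
  by rewrite mulr_ge0 ?enorm_ge0.
have p : 0 < enorm (M^t* *m x) by rewrite lt_def nz enorm_ge0.
rewrite -(ler_pM2l p) -expr2 mulrA.
have -> : enorm (M^t* *m x) ^+ 2 = cabs (((M *m (M^t* *m x))^t* *m x) 0 0).
  by rewrite adjM -mulmxA -enorm_sqrC cabs_real ger0_norm // sqr_ge0.
apply: le_trans (enorm_dot _ _) _; rewrite ler_wpM2r ?enorm_ge0 //.
by rewrite mulrC.
Qed.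

Lemma opb_isometry m n (M : 'M[C]_(m, n)) : M^t* *m M = 1%:M -> opb M 1.
Proof.
move=> h x; rewrite mul1r -(@ler_pXn2r _ 2) ?nnegrE ?enorm_ge0 //.
by rewrite -lecR !enorm_sqrC adjM mulmxA -[_ *m _ *m M]mulmxA h mulmx1.
Qed.

Lemma unitary_adj n (M : 'M[C]_n) : M \is unitarymx -> M^t* *m M = 1%:M.
Proof. by move=> /unitarymxP/mulmx1C. Qed.

Lemma opb_unitary n (M : 'M[C]_n) : M \is unitarymx -> opb M 1.
Proof. by move=> /unitary_adj; apply: opb_isometry. Qed.

Lemma opb_col m n (M : 'M[C]_(m, n)) c j : 0 <= c -> opb M c ->
  \sum_i cabs (M i j) ^+ 2 <= c ^+ 2.
Proof.
move=> c0 h; have := h (delta_mx j 0).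
have -> : enorm (delta_mx j 0) = 1.
  rewrite enormE (bigD1 j) //= mxE !eqxx cabs1 expr1n big1 ?addr0 ?sqrtr1 //.
  by move=> i ij; rewrite mxE (negbTE ij) /= cabs0 expr0n.
rewrite mulr1 -colE -(@ler_pXn2r _ 2) ?nnegrE ?enorm_ge0 // enorm_sqr.
by under eq_bigr do rewrite mxE.
Qed.

Lemma opb_row m n (M : 'M[C]_(m, n)) c i : 0 <= c -> opb M c ->
  \sum_j cabs (M i j) ^+ 2 <= c ^+ 2.
Proof.
move=> c0 /(opb_adj c0)/(opb_col i c0).
by under eq_bigr do rewrite !mxE cabs_conj.
Qed.

Lemma opb_entry m n (M : 'M[C]_(m, n)) c i j : 0 <= c -> opb M c -> cabs (M i j) <= c.
Proof.
move=> c0 h; rewrite -(@ler_pXn2r _ 2) ?nnegrE ?cabs_ge0 //.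
apply: le_trans (opb_col j c0 h); rewrite (bigD1 i) //= lerDl sumr_ge0 // => k _.
exact: sqr_ge0.
Qed.

End OperatorBounds.

(** * Schatten norms in variational form *)

Section SchattenBounds.
Variable R : realType.
Local Notation C := R[i].
Local Notation enorm := (@euclidean_norm R _).
Implicit Types (r c : R) (p : \bar R).

(** The tangent line bound for the convex power function is Young's inequality for x and y^(r-1)
    with conjugate exponents r and r/(r-1). *)
Lemma powR_tangent r (x y : R) : 1 < r -> 0 <= x -> 0 <= y ->
  y `^ r + r * (y `^ (r - 1)) * (x - y) <= x `^ r.
Proof.
move=> r1 x0 y0; have r0 : 0 < r by apply: lt_trans r1.
have q0 : 0 < r / (r - 1) by rewrite divr_gt0 // subr_gt0.
have := @conjugate_powR R x (y `^ (r - 1)) r (r / (r - 1)) x0 (powR_ge0 _ _) r0 q0.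
rewrite -powRrM (_ : (r - 1) * (r / (r - 1)) = r); last first.
  by field; rewrite subr_eq0 gt_eqF.
have -> : r^-1 + (r / (r - 1))^-1 = 1.
  by field; rewrite subr_eq0 !gt_eqF.
move=> /(_ erefl); rewrite -(ler_pM2l r0) => h.
have hy : y * y `^ (r - 1) = y `^ r by apply: mulr_powRB1.
have e : r * (x `^ r / r + y `^ r / (r / (r - 1))) = x `^ r + (r - 1) * y `^ r.
  by field; rewrite subr_eq0 !gt_eqF.
rewrite e in h.
have -> : y `^ r + r * y `^ (r - 1) * (x - y) =
    y `^ r + r * (x * y `^ (r - 1)) - r * (y * y `^ (r - 1)) by ring.
by rewrite hy; lra.
Qed.

(** Average the tangent bounds taken at the weighted sum. Weights of total less than 1 leave an
    error (r - 1)(1 - sum c) y^r of the favourable sign. *)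
Lemma powR_jensen n r (c s : 'I_n -> R) : 1 < r ->
  (forall k, 0 <= c k) -> \sum_k c k <= 1 -> (forall k, 0 <= s k) ->
  (\sum_k c k * s k) `^ r <= \sum_k c k * s k `^ r.
Proof.
move=> r1 c0 c1 s0; set y := \sum_k _.
have y0 : 0 <= y by apply: sumr_ge0 => k _; apply: mulr_ge0.
apply: (@le_trans _ _ (\sum_k c k * (y `^ r + r * (y `^ (r - 1)) * (s k - y)))); last first.
  by apply: ler_sum => k _; apply: ler_wpM2l => //; apply: powR_tangent.
have -> : \sum_k c k * (y `^ r + r * y `^ (r - 1) * (s k - y)) =
   (\sum_k c k) * (y `^ r) + r * y `^ (r - 1) * (y - (\sum_k c k) * y).
  have e : \sum_k c k * s k = y by [].
  move: (y `^ r) (r * y `^ (r - 1)) => B A; move: y {y0} e => y e.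
  rewrite -{2}e mulrBr !mulr_suml !mulr_sumr -sumrB -big_split /=.
  by apply: eq_bigr => k _; ring.
have hy : y * y `^ (r - 1) = y `^ r by apply: mulr_powRB1 => //; lra.
have yr : 0 <= y `^ r by apply: powR_ge0.
have -> : r * y `^ (r - 1) * (y - (\sum_k c k) * y) =
   r * (1 - \sum_k c k) * (y * y `^ (r - 1)) by ring.
rewrite hy; have : 0 <= (r - 1) * (1 - \sum_k c k) * y `^ r.
  by rewrite !mulr_ge0 // subr_ge0 // ltW.
lra.
Qed.

Lemma singular_values k (M : 'M[C]_k) :
  exists W P : 'M[C]_k, exists s : 'I_k -> R,
  [/\ P \is unitarymx, opb W 1, forall j, 0 <= s j,
      M = W *m diag_mx (\row_j (s j)%:C) *m P &
      W^t* *m M *m P^t* = diag_mx (\row_j (s j)%:C)] /\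
  forall r, 0 < r -> schatten_norm r%:E M = (\sum_j s j `^ r) `^ r^-1.
Proof.
set A := M^t* *m M; have An : A \is normalmx.
  by apply/normalmxP; rewrite /A adjM trmxCK.
have := orthomx_spectralP An.
set P := spectralmx A; set d := spectral_diag A => eA.
have uP : P \is unitarymx := spectral_unitarymx A.
have PP : P *m P^t* = 1%:M by apply/unitarymxP.
have PP' : P^t* *m P = 1%:M by apply: unitary_adj.
pose N := M *m P^t*.
have NN : N^t* *m N = diag_mx d.
  rewrite /N adjM trmxCK mulmxA -[P *m _ *m M]mulmxA -/A eA invmx_unitary //.
  by rewrite !mulmxA PP mul1mx -mulmxA PP mulmx1.
have dE j : d 0 j = (\sum_i cabs (N i j) ^+ 2)%:C.
  have /matrixP/(_ j j) := NN; rewrite !mxE eqxx mulr1n => <-.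
  by rewrite rmorph_sum; apply: eq_bigr => i _; rewrite !mxE conj_mul.
pose t j := \sum_i cabs (N i j) ^+ 2.
have t0 j : 0 <= t j by apply: sumr_ge0 => i _; apply: sqr_ge0.
pose s j := Num.sqrt (t j).
have s0 j : 0 <= s j by apply: sqrtr_ge0.
have ss j : s j ^+ 2 = t j by apply: sqr_sqrtr.
(* The inverse of 0 is 0, so the columns for zero singular values vanish: [W] is a partial isometry,
   hence still a contraction. *)
pose W := N *m diag_mx (\row_j ((s j)^-1)%:C).
have N0 i j : s j = 0 -> N i j = 0.
  move=> z; apply/eqP; rewrite -cabs_eq0 -sqrf_eq0; apply/eqP.
  have /psumr_eq0P h : t j = 0 by rewrite -ss z expr0n.
  by apply: h => // l _; exact: sqr_ge0.
have NW : N = W *m diag_mx (\row_j (s j)%:C).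
  rewrite /W -mulmxA mulmx_diag mul_mx_diag.
  apply/matrixP=> i j; rewrite [RHS]mxE [X in _ * X]mxE [X in _ * (X * _)]mxE.
  rewrite [X in _ * (_ * X)]mxE -rmorphM.
  have [z|nz] := eqVneq (s j) 0; first by rewrite N0 // mul0r.
  by rewrite mulVf // mulr1.
have WW : W^t* *m W = diag_mx (\row_j ((s j != 0)%:R : C)).
  rewrite /W adjM -mulmxA (mulmxA (N^t*)) NN tr_diag_mx map_diag_mx !mulmx_diag.
  congr diag_mx.
  apply/matrixP=> i j; rewrite !mxE dE -/(t j) -ss.
  rewrite [X in X * _](_ : _ = ((s j)^-1)%:C); last exact: conjc_real.
  rewrite -!rmorphM; have [->|nz] := eqVneq (s j) 0; first by rewrite expr0n !mul0r mulr0.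
  by rewrite (_ : (s j)^-1 * (s j ^+ 2 / s j) = 1) //; field.
exists W, P, s; split; first (split; [exact: uP| |exact: s0| |]).
- move=> x; rewrite mul1r -(@ler_pXn2r _ 2) ?nnegrE ?enorm_ge0 // -lecR.
  rewrite enorm_sqrC adjM mulmxA -[_ *m _ *m W]mulmxA WW enorm_sqrC.
  rewrite mul_mx_diag !mxE; apply: ler_sum => j _; rewrite !mxE.
  case: (s j != 0); rewrite ?mulr1 // mulr0 mul0r conj_mul ler0c; exact: sqr_ge0.
- by rewrite -NW /N -mulmxA PP' mulmx1.
- rewrite -mulmxA -/N {1}NW mulmxA WW mulmx_diag; congr diag_mx.
  apply/matrixP=> i j; rewrite !mxE.
  by have [->|nz] := eqVneq (s j) 0; rewrite ?mulr0 ?mul1r.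
- move=> r r0; rewrite /schatten_norm /psdmx_pow -/A -/P -/d; congr (_ `^ _).
  rewrite mxtrace_mulC mulmxA mulmxV ?spectral_unit // mul1mx mxtrace_diag.
  rewrite (_ : complex.Re _ = \sum_i complex.Re ((complex.Re (d 0 i) `^ (r / 2))%:C)); last first.
    rewrite -raddf_sum; congr complex.Re; apply: eq_bigr => i _; by rewrite !mxE.
  apply: eq_bigr => j _; rewrite dE /= -/(t j) -ss.
  rewrite -powR_mulrn // -powRrM; congr (_ `^ _); by field.
Qed.

(* The Schatten norm of M is at most c, in variational form: the supremum of the
   left-hand side over contractions U, V is attained on a singular value
   decomposition. This form makes sums, products with bounded matrices and
   adjoints immediate, for rectangular M. *)
Definition bnd p k l (M : 'M[C]_(k, l)) c : Prop :=
  match p with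
  | r%:E => forall m (U : 'M[C]_(m, k)) (V : 'M[C]_(l, m)), opb U 1 -> opb V 1 ->
      \sum_(j < m) cabs ((U *m M *m V) j j) `^ r <= c `^ r
  | +oo%E => opb M c
  | -oo%E => False
  end.

(** Each diagonal entry is at most the sum of the s_i with weights (|U_ji|^2 + |V_ij|^2) / 2. Rows
    and columns of contractions have norm at most 1, so the weights are doubly substochastic:
    Jensen's inequality uses the sums over i, the exchanged sum those over j. *)
Lemma bnd_sum_opb r k m (U : 'M[C]_(m, k)) (V : 'M[C]_(k, m)) (s : 'I_k -> R) :
  1 < r -> opb U 1 -> opb V 1 -> (forall j, 0 <= s j) ->
  \sum_(j < m) cabs ((U *m diag_mx (\row_j (s j)%:C) *m V) j j) `^ r <= \sum_j s j `^ r.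
Proof.
move=> r1 hU hV s0.
pose c j i := (cabs (U j i) ^+ 2 + cabs (V i j) ^+ 2) / 2.
have c0 j i : 0 <= c j i by rewrite divr_ge0 // addr_ge0 // sqr_ge0.
have cr j : \sum_i c j i <= 1.
  rewrite -mulr_suml big_split /= ler_pdivrMr // mul1r.
  have := opb_row j ler01 hU; have := opb_col j ler01 hV; rewrite expr1n; lra.
have cc i : \sum_j c j i <= 1.
  rewrite -mulr_suml big_split /= ler_pdivrMr // mul1r.
  have := opb_col i ler01 hU; have := opb_row i ler01 hV; rewrite expr1n; lra.
apply: (@le_trans _ _ (\sum_(j < m) \sum_i c j i * s i `^ r)).
  apply: ler_sum => j _; apply: le_trans (powR_jensen r1 (c0 j) (cr j) s0).
  apply: ge0_ler_powR; rewrite ?nnegrE ?cabs_ge0 ?(ltW (lt_trans ltr01 r1)) //.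
    by apply: sumr_ge0 => i _; apply: mulr_ge0.
  rewrite mul_mx_diag mxE; apply: le_trans (cabs_sum _ _ _) _.
  apply: ler_sum => i _; rewrite !mxE !cabsM cabs_real ger0_norm // /c.
  have := sqr_ge0 (cabs (U j i) - cabs (V i j)) => h.
  have : 0 <= s i * (cabs (U j i) - cabs (V i j)) ^+ 2 by apply: mulr_ge0.
  rewrite sqrrB; lra.
rewrite exchange_big /=; apply: ler_sum => i _; rewrite -mulr_suml.
by rewrite -[leRHS]mul1r ler_wpM2r ?powR_ge0.
Qed.

Lemma operator_norm_has_ub k (M : 'M[C]_k) :
  has_ubound [set euclidean_norm (M *m x) |
    x in [set x : 'cV[C]_k | euclidean_norm x <= 1]].
Proof.
  exists (\sum_i \sum_j cabs (M i j)) => _ [x /= x1 <-].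
  have -> : M *m x = \sum_i (\sum_j M i j * x j 0) *: delta_mx i 0.
    apply/matrixP=> i j; rewrite ord1 [RHS]summxE [RHS](bigD1 i) //= [X in _ = _ + X]big1 ?addr0.
      by rewrite !mxE !eqxx mulr1.
    by move=> l li; rewrite !mxE eq_sym (negbTE li) mulr0.
  have en i : euclidean_norm (delta_mx i 0 : 'cV[C]_k) = 1.
    rewrite enormE (bigD1 i) //= mxE !eqxx cabs1 expr1n big1 ?addr0 ?sqrtr1 //.
    by move=> l li; rewrite mxE (negbTE li) /= cabs0 expr0n.
  have: forall F : 'I_k -> 'cV[C]_k, euclidean_norm (\sum_i F i) <= \sum_i euclidean_norm (F i).
    move=> F; elim/big_ind2: _ => [|a b a' b' h h'|//]; first by rewrite enorm0.
    by apply: le_trans (enormD _ _) _; apply: lerD.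
  move=> h; apply: le_trans (h _) _; apply: ler_sum => i _.
  rewrite enormZ en mulr1; apply: le_trans (cabs_sum _ _ _) _.
  apply: ler_sum => j _; rewrite cabsM ler_piMr ?cabs_ge0 //.
  exact: le_trans (enorm_coord _ _) x1.
Qed.

Lemma opb_operator_norm k (M : 'M[C]_k) : opb M (operator_norm M).
Proof.
have Sub := operator_norm_has_ub M.
move=> x; have [x0|x0] := eqVneq (euclidean_norm x) 0.
  by rewrite (enorm_eq0 x0) mulmx0 enorm0 mulr0.
have px : 0 < euclidean_norm x by rewrite lt_def x0 enorm_ge0.
have ce : cabs ((euclidean_norm x)^-1)%:C = (euclidean_norm x)^-1.
  by rewrite cabs_real ger0_norm // invr_ge0 enorm_ge0.
rewrite -ler_pdivrMr // mulrC -ce -enormZ scalemxAr.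
rewrite /operator_norm; apply: (ub_le_sup Sub); exists (((euclidean_norm x)^-1)%:C *: x) => //=.
by rewrite enormZ ce mulVf.
Qed.

Lemma operator_norm_le k (M : 'M[C]_k) c : 0 <= c -> opb M c -> operator_norm M <= c.
Proof.
move=> c0 h; apply: ge_sup.
  by exists (euclidean_norm (M *m 0)); exists 0 => //=; rewrite enorm0.
move=> _ [x /= x1 <-]; apply: le_trans (h x) _.
by rewrite ler_piMr.
Qed.

Lemma schatten_ge0 p k (M : 'M[C]_k) : (1 < p)%E -> 0 <= schatten_norm p M.
Proof.
case: p => [r _|_|//]; first exact: powR_ge0.
apply: (ub_le_sup (operator_norm_has_ub M)); exists 0 => /=.
  by rewrite enorm0.
by rewrite mulmx0 enorm0.
Qed.

Lemma schatten_powR r k (M : 'M[C]_k) (s : 'I_k -> R) : 0 < r ->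
  schatten_norm r%:E M = (\sum_j s j `^ r) `^ r^-1 ->
  schatten_norm r%:E M `^ r = \sum_j s j `^ r.
Proof.
move=> r0 ->; rewrite -powRrM mulVf ?gt_eqF // powRr1 //.
by apply: sumr_ge0 => j _; apply: powR_ge0.
Qed.

Lemma bnd_schatten p k (M : 'M[C]_k) : (1 < p)%E -> bnd p M (schatten_norm p M).
Proof.
case: p => [r|_|//]; last exact: opb_operator_norm.
rewrite lte_fin => r1 m U V hU hV; have r0 : 0 < r by apply: lt_trans r1.
have [W [P [s [[uP hW s0 eM _] /(_ r r0) hs]]]] := singular_values M.
rewrite (schatten_powR r0 hs) eM.
have -> : U *m (W *m diag_mx (\row_j (s j)%:C) *m P) *m V =
    (U *m W) *m diag_mx (\row_j (s j)%:C) *m (P *m V) by rewrite !mulmxA.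
apply: (bnd_sum_opb r1 _ _ s0); rewrite -[1]mulr1.
  exact: (opbM ler01 hU hW).
exact: (opbM ler01 (opb_unitary uP) hV).
Qed.

Lemma powR_le_inv r (x y : R) : 0 < r -> 0 <= x -> 0 <= y -> x `^ r <= y `^ r -> x <= y.
Proof.
move=> r0 x0 y0 h; rewrite leNgt; apply/negP => lt.
by have := gt0_ltr_powR r0 y0 x0 lt; rewrite ltNge h.
Qed.

Lemma schatten_bnd p k (M : 'M[C]_k) c : (1 < p)%E -> 0 <= c -> bnd p M c ->
  schatten_norm p M <= c.
Proof.
case: p => [r|_|//]; last exact: operator_norm_le.
rewrite lte_fin => r1 c0 h; have r0 : 0 < r by apply: lt_trans r1.
have [W [P [s [[uP hW s0 _ eM] /(_ r r0) hs]]]] := singular_values M.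
apply: (powR_le_inv r0) => //; first exact: (@schatten_ge0 r%:E).
rewrite (schatten_powR r0 hs); apply: le_trans (h k (W^t*) (P^t*) _ _).
- rewrite eM; apply: ler_sum => j _; rewrite !mxE eqxx mulr1n cabs_real.
  by rewrite ger0_norm.
- exact: opb_adj ler01 hW.
- exact: opb_adj ler01 (opb_unitary uP).
Qed.

Lemma bndW p k l (M : 'M[C]_(k, l)) c d : (1 < p)%E -> 0 <= c -> c <= d ->
  bnd p M c -> bnd p M d.
Proof.
case: p => [r|_|//] => [|c0 cd h]; last exact: opbW h.
rewrite lte_fin => r1 c0 cd h m U V hU hV; apply: le_trans (h m U V hU hV) _.
by apply: ge0_ler_powR; rewrite ?nnegrE //; lra.
Qed.

Lemma bnd0 p k l : (1 < p)%E -> bnd p (0 : 'M[C]_(k, l)) 0.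
Proof.
case: p => [r|_|//]; last exact: opb0.
rewrite lte_fin => r1 m U V _ _; rewrite big1 ?powR_ge0 // => j _.
rewrite mulmx0 mul0mx mxE cabs0 powR0 //; lra.
Qed.

Lemma bndZ p k l (M : 'M[C]_(k, l)) c (z : C) : (1 < p)%E -> 0 <= c ->
  bnd p M c -> bnd p (z *: M) (cabs z * c).
Proof.
case: p => [r|_|//] => [|c0 h]; last exact: opbZ h.
rewrite lte_fin => r1 c0 h m U V hU hV; rewrite powRM ?cabs_ge0 //.
rewrite -scalemxAr -scalemxAl.
under eq_bigr do rewrite mxE cabsM powRM ?cabs_ge0 //.
by rewrite -mulr_sumr ler_wpM2l ?powR_ge0 //; apply: h.
Qed.

(** The factor 4 is the price of replacing Minkowski's inequality by (x + y)^r <= 2^r (x^r + y^r),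
    followed by a^r + b^r <= 2 (a + b)^r. Constants are harmless, since only convergence to 0 is at
    stake. *)
Lemma bndD p k l (A B : 'M[C]_(k, l)) a b : (1 < p)%E -> 0 <= a -> 0 <= b ->
  bnd p A a -> bnd p B b -> bnd p (A + B) (4 * (a + b)).
Proof.
case: p => [r|_|//] => [|a0 b0 hA hB]; last first.
  by apply: opbW (opbD hA hB); lra.
rewrite lte_fin => r1 a0 b0 hA hB m U V hU hV.
have r0 : 0 <= r by lra.
have mono x y : 0 <= x -> x <= y -> x `^ r <= y `^ r.
  by move=> x0 xy; apply: ge0_ler_powR; rewrite ?nnegrE //; apply: le_trans xy.
apply: (@le_trans _ _ (\sum_(j < m) 2 `^ r *
    (cabs ((U *m A *m V) j j) `^ r + cabs ((U *m B *m V) j j) `^ r))).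
  apply: ler_sum => j _; rewrite mulmxDr mulmxDl mxE.
  move: ((U *m A *m V) j j) ((U *m B *m V) j j) => x y.
  have le2 (u v : C) : cabs u <= cabs v ->
      cabs (u + v) `^ r <= 2 `^ r * (cabs u `^ r + cabs v `^ r).
    move=> uv; apply: (@le_trans _ _ ((2 * cabs v) `^ r)).
      by apply: mono; rewrite ?cabs_ge0 //; apply: le_trans (cabsD _ _) _; lra.
    by rewrite powRM ?cabs_ge0 // ler_wpM2l ?powR_ge0 // lerDr powR_ge0.
  case/orP: (le_total (cabs x) (cabs y)) => h; first exact: le2.
  by rewrite addrC [_ `^ r + _]addrC; apply: le2.
rewrite -mulr_sumr big_split /=.
apply: (@le_trans _ _ (2 `^ r * (a `^ r + b `^ r))).
  by rewrite ler_wpM2l ?powR_ge0 // lerD //; [apply: hA|apply: hB].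
have -> : 4 * (a + b) = 2 * (2 * (a + b)) by ring.
rewrite [leRHS]powRM ?ler_wpM2l ?powR_ge0 ?mulr_ge0 ?addr_ge0 //.
apply: (@le_trans _ _ (2 * (a + b) `^ r)).
  by rewrite mulr_natl mulr2n; apply: lerD; apply: mono => //; lra.
rewrite powRM ?addr_ge0 // ler_wpM2r ?powR_ge0 //; apply: le1r_powR; lra.
Qed.

(** After division by [b], the factor [X] is a contraction and is absorbed into the test matrix. The
    case b = 0 is apart because it forbids the division. *)
Lemma bndMl p k l n (X : 'M[C]_(n, k)) (M : 'M[C]_(k, l)) b c : (1 < p)%E ->
  0 <= b -> 0 <= c -> opb X b -> bnd p M c -> bnd p (X *m M) (b * c).
Proof.
case: p => [r|_|//] => [|b0 c0 hX hM]; last exact: opbM hX hM.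
rewrite lte_fin => r1 b0 c0 hX hM; have r0 : 0 < r by lra.
have [bz|bnz] := eqVneq b 0.
  have -> : X = 0.
    apply/matrixP=> i j; rewrite mxE; apply/eqP; rewrite -cabs_eq0 eq_le cabs_ge0 andbT.
    by rewrite -bz; apply: opb_entry.
  by rewrite mul0mx bz mul0r; apply: (@bnd0 r%:E); rewrite lte_fin.
have cb : cabs (b^-1)%:C = b^-1 by rewrite cabs_real ger0_norm // invr_ge0.
have -> : X *m M = (b%:C) *: (((b^-1)%:C *: X) *m M).
  by rewrite -scalemxAl scalerA -rmorphM mulfV // scale1r.
rewrite -[X in X * c](_ : cabs b%:C = b); last by rewrite cabs_real ger0_norm.
apply: (@bndZ r%:E); rewrite ?lte_fin // => m U V hU hV; rewrite mulmxA; apply: hM hV.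
rewrite -[1]mulr1; apply: (opbM ler01 hU).
by have := opbZ (b^-1)%:C hX; rewrite cb mulVf.
Qed.

Lemma bndMr p k l n (X : 'M[C]_(l, n)) (M : 'M[C]_(k, l)) b c : (1 < p)%E ->
  0 <= b -> 0 <= c -> opb X b -> bnd p M c -> bnd p (M *m X) (b * c).
Proof.
case: p => [r|_|//] => [|b0 c0 hX hM]; last by rewrite mulrC; apply: opbM hM hX.
rewrite lte_fin => r1 b0 c0 hX hM; have r0 : 0 < r by lra.
have [bz|bnz] := eqVneq b 0.
  have -> : X = 0.
    apply/matrixP=> i j; rewrite mxE; apply/eqP; rewrite -cabs_eq0 eq_le cabs_ge0 andbT.
    by rewrite -bz; apply: opb_entry.
  by rewrite mulmx0 bz mul0r; apply: (@bnd0 r%:E); rewrite lte_fin.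
have cb : cabs (b^-1)%:C = b^-1 by rewrite cabs_real ger0_norm // invr_ge0.
have -> : M *m X = (b%:C) *: (M *m ((b^-1)%:C *: X)).
  by rewrite -scalemxAr scalerA -rmorphM mulfV // scale1r.
rewrite -[X in X * c](_ : cabs b%:C = b); last by rewrite cabs_real ger0_norm.
apply: (@bndZ r%:E); rewrite ?lte_fin // => m U V hU hV; rewrite mulmxA -mulmxA; apply: hM hU _.
rewrite -[1]mulr1; apply: opbM ler01 _ hV.
by have := opbZ (b^-1)%:C hX; rewrite cb mulVf.
Qed.

Lemma bnd_adj p k l (M : 'M[C]_(k, l)) c : (1 < p)%E -> 0 <= c ->
  bnd p M c -> bnd p (M^t*) c.
Proof.
case: p => [r|_|//] => [|c0 h]; last exact: opb_adj.
rewrite lte_fin => r1 c0 h m U V hU hV.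
have := h m (V^t*) (U^t*) (opb_adj ler01 hV) (opb_adj ler01 hU).
apply: le_trans; apply: ler_sum => j _.
have -> : U *m M^t* *m V = (V^t* *m M *m U^t*)^t*.
  by rewrite !adjM !trmxCK mulmxA.
by rewrite [X in cabs X]mxE [X in Num.conj X]mxE cabs_conj.
Qed.

(** The test matrices are a single row and a single column: the normalized adjoint of M x and the
    normalized x, whose pairing through M is |M x| / |x|. *)
Lemma bnd_opb p k l (M : 'M[C]_(k, l)) c : (1 < p)%E -> 0 <= c ->
  bnd p M c -> opb M c.
Proof.
case: p => [r|_|//] => [|c0 h //].
rewrite lte_fin => r1 c0 h x; have r0 : 0 < r by lra.
have [z|nz] := eqVneq (enorm (M *m x)) 0; first by rewrite z mulr_ge0 ?enorm_ge0.
have [z|nzx] := eqVneq (enorm x) 0.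
  by rewrite (enorm_eq0 z) mulmx0 !enorm0 mulr0.
have p1 : 0 < enorm (M *m x) by rewrite lt_def nz enorm_ge0.
have p2 : 0 < enorm x by rewrite lt_def nzx enorm_ge0.
have unit n (y : 'cV[C]_n) : 0 < enorm y -> opb (((enorm y)^-1)%:C *: y) 1.
  move=> py; apply: opb_isometry; rewrite [LHS]mx11_scalar; congr (_%:M).
  rewrite -enorm_sqrC enormZ cabs_real ger0_norm ?invr_ge0 ?ltW //.
  by rewrite mulVf ?gt_eqF // expr1n.
have := h 1%N _ _ (opb_adj ler01 (unit _ _ p1)) (unit _ _ p2).
rewrite big_ord1 => /(powR_le_inv r0 (cabs_ge0 _) c0).
have -> : ((enorm (M *m x))^-1%:C *: (M *m x))^t* =
    (enorm (M *m x))^-1%:C *: (M *m x)^t*.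
  by rewrite linearZ map_mxZ; congr (_ *: _); apply: conjc_real.
rewrite -!scalemxAr -!scalemxAl -mulmxA mxE [X in _ * X]mxE !cabsM.
rewrite -enorm_sqrC !cabs_real !ger0_norm ?sqr_ge0 ?invr_ge0 ?enorm_ge0 //.
rewrite -(ler_pM2r p2); congr (_ <= _); field.
by rewrite nz nzx.
Qed.

End SchattenBounds.

(** * Functional calculus, polar correction and unitary roots *)

Section FunctionalCalculus.
Variable R : realType.
Local Notation C := R[i].
Variables (k : nat) (P : 'M[C]_k).
Hypothesis uP : P \is unitarymx.

(** Functional calculus in the eigenbasis [P]; the function lives on eigenvalue indices, so the
    calculus needs no reference to the matrix being diagonalized. *)
Definition fcalc (f : 'I_k -> C) := P^t* *m diag_mx (\row_j f j) *m P.

Lemma fcalcE (d : 'rV[C]_k) : P^t* *m diag_mx d *m P = fcalc (fun j => d 0 j).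
Proof.
have e : d = \row_j d 0 j by apply/rowP => j; rewrite mxE.
by rewrite /fcalc -e.
Qed.

Lemma eq_fcalc f g : f =1 g -> fcalc f = fcalc g.
Proof. by move=> /funext ->. Qed.

Lemma fcalcM f g : fcalc f *m fcalc g = fcalc (fun j => f j * g j).
Proof.
rewrite {1 2}/fcalc !mulmxA (mulmxtVK _ uP) -(mulmxA (P^t*)) mulmx_diag fcalcE.
by apply: eq_fcalc => j; rewrite !mxE.
Qed.

Lemma fcalc1 : fcalc (fun=> 1) = 1%:M.
Proof.
rewrite /fcalc (_ : diag_mx _ = 1%:M) ?mulmx1 ?unitary_adj //.
by apply/matrixP=> i j; rewrite !mxE.
Qed.

Lemma fcalcB f g : fcalc f - fcalc g = fcalc (fun j => f j - g j).
Proof.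
rewrite {1 2}/fcalc -mulmxBl -mulmxBr -raddfB fcalcE.
by apply: eq_fcalc => j; rewrite !mxE.
Qed.

Lemma fcalc_adj f : (fcalc f)^t* = fcalc (fun j => Num.conj (f j)).
Proof.
rewrite {1}/fcalc !adjM trmxCK mulmxA tr_diag_mx map_diag_mx fcalcE.
by apply: eq_fcalc => j; rewrite !mxE.
Qed.

Lemma fcalc_iter f m :
  iter m (mulmx (fcalc f)) 1%:M = fcalc (fun j => f j ^+ m).
Proof.
elim: m => [|m IH]; first by rewrite -fcalc1.
by rewrite /= IH fcalcM; apply: eq_fcalc => j; rewrite exprS.
Qed.

Lemma opb_fcalc f c : 0 <= c -> (forall j, cabs (f j) <= c) -> opb (fcalc f) c.
Proof.
move=> c0 fc; rewrite -[c]mulr1 -[c]mul1r; apply: opbM; first by rewrite mul1r.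
  apply: opbM ler01 _ _; last first.
    move=> x; rewrite -(@ler_pXn2r _ 2) ?nnegrE ?mulr_ge0 ?enorm_ge0 //.
    rewrite exprMn !enorm_sqr mulr_sumr; apply: ler_sum => j _.
    rewrite mul_diag_mx !mxE cabsM exprMn ler_wpM2r ?sqr_ge0 //.
    by rewrite ler_pXn2r ?nnegrE ?cabs_ge0.
  exact: opb_adj ler01 (opb_unitary uP).
exact: opb_unitary.
Qed.

(** In the eigenbasis, commuting with f kills every entry (i, j) with f i <> f j; wherever an entry
    survives, g i = g j. *)
Lemma fcalc_comm f g (Z : 'M[C]_k) : (forall i j, f i = f j -> g i = g j) ->
  Z *m fcalc f = fcalc f *m Z -> Z *m fcalc g = fcalc g *m Z.
Proof.
move=> fg h; pose Y := P *m Z *m P^t*.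
have PP : P *m P^t* = 1%:M by apply/unitarymxP.
have PP' : P^t* *m P = 1%:M by apply: unitary_adj.
have conj e : P *m (Z *m fcalc e) *m P^t* = Y *m diag_mx (\row_j e j).
  by rewrite /fcalc /Y !mulmxA (mulmxtVK _ uP).
have conj' e : P *m (fcalc e *m Z) *m P^t* = diag_mx (\row_j e j) *m Y.
  by rewrite /fcalc /Y !mulmxA PP mul1mx.
have e : Y *m diag_mx (\row_j f j) = diag_mx (\row_j f j) *m Y.
  by rewrite -conj h conj'.
have e' : Y *m diag_mx (\row_j g j) = diag_mx (\row_j g j) *m Y.
  apply/matrixP=> i j; have /matrixP/(_ i j) := e.
  have er u : (Y *m diag_mx (\row_l u l)) i j = Y i j * u j.
    by rewrite mul_mx_diag mxE [X in _ * X]mxE.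
  have el u : (diag_mx (\row_l u l) *m Y) i j = u i * Y i j.
    by rewrite mul_diag_mx mxE [X in X * _]mxE.
  rewrite !er !el => h1; have [y0|y0] := eqVneq (Y i j) 0.
    by rewrite y0 mulr0 mul0r.
  by rewrite mulrC; congr (_ * _); apply/esym/fg; apply: (mulIf y0); rewrite -h1 mulrC.
have inj A B : P *m A *m P^t* = P *m B *m P^t* -> A = B.
  move=> /(congr1 (fun M => P^t* *m M *m P)); rewrite !mulmxA PP' !mul1mx.
  by rewrite -!mulmxA PP' !mulmx1.
by apply: inj; rewrite conj conj' e'.
Qed.

End FunctionalCalculus.

(** * Unitary polar parts and roots near the identity *)

Section PolarAndRoots.
Variable R : realType.
Local Notation C := R[i].
Variable k : nat.
Implicit Types (X U Z : 'M[C]_k).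

Lemma fcalc_spectral X : X \is normalmx ->
  X = fcalc (spectralmx X) (fun j => spectral_diag X 0 j).
Proof.
move=> h; apply: etrans (orthomx_spectralP h) _.
rewrite (invmx_unitary (spectral_unitarymx X)).
exact: fcalcE.
Qed.

Lemma fcalc_diag (P : 'M[C]_k) f j : P \is unitarymx ->
  f j = (P *m fcalc P f *m P^t*) j j.
Proof.
move=> uP; have PP : P *m P^t* = 1%:M by apply/unitarymxP.
by rewrite /fcalc !mulmxA PP mul1mx -mulmxA PP mulmx1 !mxE eqxx.
Qed.

Lemma fcalc_opb (P : 'M[C]_k) f c : P \is unitarymx -> 0 <= c ->
  opb (fcalc P f) c -> forall j, cabs (f j) <= c.
Proof.
move=> uP c0 h j; rewrite (fcalc_diag f j uP); apply: (opb_entry _ _ c0).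
rewrite -[c]mulr1; apply: (opbM c0); last exact: opb_adj ler01 (opb_unitary uP).
by rewrite -[c]mul1r; apply: opbM ler01 (opb_unitary uP) h.
Qed.

Lemma unitary_of_adj X : X^t* *m X = 1%:M -> X \is unitarymx.
Proof. by move=> /mulmx1C h; apply/unitarymxP. Qed.

(** [B] is the inverse square root of X* X. The factored form of [B] carries p-norm smallness of the
    defect over to the correction, and the commutation clause carries intertwining over. *)
Lemma polar_correction X : opb (1%:M - X^t* *m X) (1 / 2) ->
  exists B Q : 'M[C]_k, [/\ X *m B \is unitarymx,
    B = 1%:M + (1%:M - X^t* *m X) *m Q, opb Q 1 &
    forall Z, Z *m (X^t* *m X) = (X^t* *m X) *m Z -> Z *m B = B *m Z].
Proof.
move=> h; set A := X^t* *m X in h *.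
have An : A \is normalmx by apply/normalmxP; rewrite /A adjM trmxCK.
have := fcalc_spectral An.
set P := spectralmx A; set d := (fun j => spectral_diag A 0 j) => eA.
have uP : P \is unitarymx := spectral_unitarymx A.
pose t j := \sum_i cabs ((X *m P^t*) i j) ^+ 2.
have dE j : d j = (t j)%:C.
  rewrite (fcalc_diag d j uP) -eA /A.
  have -> : P *m (X^t* *m X) *m P^t* = (X *m P^t*)^t* *m (X *m P^t*).
    by rewrite adjM trmxCK !mulmxA.
  rewrite mxE rmorph_sum; apply: eq_bigr => i _.
  by rewrite [X in X * _]mxE [X in Num.conj X]mxE conj_mul.
have d1 j : 1 / 2 <= t j.
  have c0 : 0 <= 1 / 2 :> R by lra.
  have := h; rewrite eA -(fcalc1 uP) fcalcB => h'.
  have := fcalc_opb uP c0 h' j; rewrite dE -rmorphB cabs_real => /ler_normlP[]; lra.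
pose s j := Num.sqrt (t j).
have s0 j : 0 < s j by rewrite sqrtr_gt0; have := d1 j; lra.
have ss j : s j ^+ 2 = t j by apply: sqr_sqrtr; have := d1 j; lra.
pose B := fcalc P (fun j => ((s j)^-1)%:C).
(* From 1/s - 1 = (1 - s^2) / (s (1 + s)); the denominator s + s^2 exceeds 1 because s^2 >= 1/2. *)
pose Q := fcalc P (fun j => ((s j * (1 + s j))^-1)%:C).
exists B, Q; split.
- apply: unitary_of_adj; rewrite adjM -mulmxA (mulmxA (X^t*)) -/A eA.
  rewrite /B fcalc_adj !(fcalcM uP) -(fcalc1 uP); apply: eq_fcalc => j.
  rewrite [X in X * _](_ : _ = ((s j)^-1)%:C); last exact: conjc_real.
  rewrite dE -ss -!rmorphM -[RHS](rmorph1 (real_complex R)); congr (_%:C).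
  by field; rewrite gt_eqF.
- rewrite -[LHS](subrK 1%:M) addrC; congr (_ + _).
  rewrite eA -(fcalc1 uP) /B /Q !fcalcB (fcalcM uP); apply: eq_fcalc => j.
  rewrite dE -ss -(rmorph1 (real_complex R)) -!rmorphB -rmorphM; congr (_%:C).
  by have := s0 j => ?; field; rewrite !gt_eqF // addr_gt0.
- apply: (opb_fcalc uP ler01) => j; rewrite cabs_real ger0_norm; last first.
    by rewrite invr_ge0 mulr_ge0 ?addr_ge0 // ltW.
  have := s0 j; have := d1 j; rewrite -ss => h1 h2.
  by rewrite invf_le1 ?mulr_gt0 ?addr_gt0 //; nra.
- move=> Z; rewrite eA; apply: fcalc_comm => // i j.
  by rewrite !dE => /complexI e; rewrite /s e.
Qed.

(** Evaluated at 1, the polynomial X^m - z gives 1 - z as the product of the 1 - w over its roots w.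
    Were every |1 - w| above 1/(2m), the product would exceed the assumed bound, so some root is
    close to 1. *)
Lemma root_near1 (m : nat) (z : C) : (0 < m)%N -> cabs z = 1 ->
  cabs (z - 1) <= (2 * m%:R)^-1 ^+ m ->
  exists w q : C, [/\ w ^+ m = z, cabs w = 1, w - 1 = (z - 1) * q & cabs q <= 2].
Proof.
move=> m0 z1 hz; set eta := (2 * m%:R)^-1 in hz.
have eta0 : 0 < eta :> R by rewrite invr_gt0 mulr_gt0 // ltr0n.
have mon : 'X^m - z%:P \is monic by apply: monicXnsubC.
have [s es] := closed_field_poly_normal ('X^m - z%:P : {poly C}).
rewrite (monicP mon) scale1r in es.
have ss : size s = m.
  have := size_XnsubC z m0; rewrite es size_prod_XsubC => -[] //.
have [w ws hw] : exists2 w, w \in s & cabs (1 - w) <= eta.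
  apply: contrapT => no; have : eta ^+ m < cabs (z - 1).
    have -> : cabs (z - 1) = \prod_(w <- s) cabs (1 - w).
      have := congr1 (fun p : {poly C} => p.[1]) es.
      rewrite hornerD hornerN hornerC hornerXn expr1n horner_prod => e.
      rewrite -cabsN opprB e; elim: (s) => [|v r IH]; first by rewrite !big_nil cabs1.
      by rewrite !big_cons cabsM IH hornerXsubC.
    have big w : w \in s -> eta < cabs (1 - w).
      by move=> ws; rewrite ltNge; apply/negP => h; apply: no; exists w.
    rewrite -ss; move: m0; rewrite -ss; elim: s big {es ss no} => // v r IH big _.
    rewrite big_cons exprS; case: r IH big => [|u r] IH big.
      by rewrite big_nil expr0 !mulr1 big // mem_head.
    apply: ltr_pM; rewrite ?ltW ?exprn_gt0 //; first by apply: big; rewrite mem_head.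
    by apply: IH => // w wr; apply: big; rewrite inE wr orbT.
  by rewrite ltNge hz.
have wm : w ^+ m = z.
  have := congr1 (fun p : {poly C} => p.[w]) es.
  rewrite hornerD hornerN hornerC hornerXn horner_prod => e.
  apply/eqP; rewrite -subr_eq0 e prodf_seq_eq0; apply/hasP; exists w => //.
  by rewrite hornerXsubC subrr eqxx.
have w1 : cabs w = 1.
  apply/eqP; rewrite -(@eqrXn2 _ m) ?cabs_ge0 ?ler01 // -cabsX wm z1 expr1n //.
(* The quotient (z - 1) / (w - 1). Each w^i with i < m is within 1/2 of 1, so |S| >= m/2 and q = 1/S
   is bounded. *)
pose S : C := \sum_(i < m) w ^+ i.
have eS : z - 1 = (w - 1) * S by rewrite -wm subrX1.
have hS : m%:R / 2 <= cabs S.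
  have hi i : (i <= m)%N -> cabs (w ^+ i - 1) <= 1 / 2.
    move=> im; apply: (@le_trans _ _ (i%:R * eta)).
      elim: i {im} => [|i IH]; first by rewrite subrr cabs0 mul0r.
      have -> : w ^+ i.+1 - 1 = w * (w ^+ i - 1) + (w - 1) by rewrite exprS; ring.
      apply: le_trans (cabsD _ _) _; rewrite cabsM w1 mul1r -natr1 mulrDl mul1r.
      by apply: lerD => //; rewrite -cabsN opprB.
    have em : m%:R * eta = 1 / 2 by rewrite /eta; field; rewrite pnatr_eq0 -lt0n.
    by rewrite -em ler_wpM2r ?ler_nat // ltW.
  have cm : cabs (m%:R : C) = m%:R.
    by rewrite -(rmorph_nat (real_complex R)) cabs_real ger0_norm.
  have e : m%:R = S + \sum_(i < m) (1 - w ^+ i).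
    by rewrite -big_split /= (eq_bigr (fun=> 1)) ?sumr_const ?card_ord // => i _; ring.
  have h1 : cabs (\sum_(i < m) (1 - w ^+ i)) <= m%:R / 2.
    apply: le_trans (cabs_sum _ _ _) _.
    apply: (@le_trans _ _ (\sum_(i < m) (1 / 2 : R))); last first.
      by rewrite sumr_const card_ord div1r -[_ *+ m]mulr_natr mulrC.
    by apply: ler_sum => i _; rewrite -cabsN opprB; apply: hi; apply: ltnW.
  have := cabsD S (\sum_(i < m) (1 - w ^+ i)); rewrite -e cm; lra.
have m1 : 1 <= m%:R :> R by rewrite ler1n.
have S0 : S != 0 by rewrite -cabs_eq0; apply/eqP => h; rewrite h in hS; lra.
exists w, S^-1; split=> //; first by rewrite eS mulfK.
rewrite cabsV -[leRHS]invrK lef_pV2 ?posrE ?invr_gt0 //; lra.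
Qed.

Lemma unitary_root (m : nat) U : (0 < m)%N -> U \is unitarymx ->
  opb (U - 1%:M) ((2 * m%:R)^-1 ^+ m) ->
  exists B Q : 'M[C]_k, [/\ B \is unitarymx, iter m (mulmx B) 1%:M = U,
    B - 1%:M = (U - 1%:M) *m Q, opb Q 2 &
    forall Z, Z *m U = U *m Z -> Z *m B = B *m Z].
Proof.
move=> m0 uU hU.
have Un : U \is normalmx.
  by apply/normalmxP; rewrite unitary_adj //; apply/unitarymxP.
have := fcalc_spectral Un.
set P := spectralmx U; set d := (fun j => spectral_diag U 0 j) => eU.
have uP : P \is unitarymx := spectral_unitarymx U.
have d1 j : cabs (d j) = 1.
  have : fcalc P (fun j => Num.conj (d j) * d j) = fcalc P (fun=> 1).
    by rewrite -(fcalcM uP) -fcalc_adj -eU (fcalc1 uP) unitary_adj.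
  move=> h; have := fcalc_diag (fun j => Num.conj (d j) * d j) j uP.
  rewrite h -(fcalc_diag (fun=> 1) j uP).
  rewrite conj_mul -[RHS](rmorph1 (real_complex R)) => /complexI.
  move=> /eqP; rewrite sqrf_eq1 => /orP[/eqP //|/eqP h1].
  by have := cabs_ge0 (d j); rewrite h1; lra.
have dz j : cabs (d j - 1) <= (2 * m%:R)^-1 ^+ m.
  have c0 : 0 <= (2 * m%:R)^-1 ^+ m :> R by rewrite exprn_ge0 // invr_ge0 mulr_ge0.
  by move: j; apply: (fcalc_opb uP c0); rewrite -fcalcB -eU (fcalc1 uP).
(* The root is chosen as a function of the eigenvalue and not of its index: equal eigenvalues get
   equal roots, so the commutant is preserved. *)
have ex (z : C) : exists w : C, exists q : C,
    (cabs z = 1 /\ cabs (z - 1) <= (2 * m%:R)^-1 ^+ m) ->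
    [/\ w ^+ m = z, cabs w = 1, w - 1 = (z - 1) * q & cabs q <= 2].
  have [[h1 h2]|no] := pselect (cabs z = 1 /\ cabs (z - 1) <= (2 * m%:R)^-1 ^+ m).
    by have [w [q h]] := root_near1 m0 h1 h2; exists w, q.
  by exists 0, 0.
have [w hw] := choice ex; have [q hq] := choice hw.
pose B := fcalc P (fun j => w (d j)); pose Q := fcalc P (fun j => q (d j)).
have hj j := hq (d j) (conj (d1 j) (dz j)).
exists B, Q; split.
- apply: unitary_of_adj; rewrite /B fcalc_adj (fcalcM uP) -(fcalc1 uP).
  apply: eq_fcalc => j; have [_ h _ _] := hj j.
  by rewrite conj_mul h expr1n.
- rewrite /B (fcalc_iter uP) [RHS]eU; apply: eq_fcalc => j.
  by have [] := hj j.
- rewrite eU -(fcalc1 uP) /B /Q !fcalcB (fcalcM uP); apply: eq_fcalc => j.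
  by have [] := hj j.
- by apply: (opb_fcalc uP (ler0n R 2)) => j; have [] := hj j.
- by move=> Z; rewrite eU; apply: (fcalc_comm uP) => i j ->.
Qed.

End PolarAndRoots.

(** * Stability of virtually cyclic groups *)

Section NullSequences.
Variables (R : realType) (p : \bar R).
Hypothesis p1 : (1 < p)%E.
Local Notation C := R[i].

Definition null (k l : nat -> nat) (M : forall n, 'M[C]_(k n, l n)) :=
  forall e : R, 0 < e -> exists n0, forall n, (n0 <= n)%N -> bnd p (M n) e.

Lemma null_schatten (k : nat -> nat) (M : forall n, 'M[C]_(k n)) :
  null M <-> (fun n => schatten_norm p (M n)) @ \oo --> (0 : R).
Proof.
split=> [h|/cvgrPdist_le h e e0].
  apply/cvgrPdist_le => e e0; have [n0 hn] := h e e0.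
  exists n0 => // n /= /hn hM; rewrite sub0r normrN ger0_norm ?schatten_ge0 //.
  by apply: schatten_bnd (ltW e0) hM.
have [n0 _ hn] := h e e0; exists n0 => n /hn.
rewrite /= sub0r normrN ger0_norm ?schatten_ge0 // => le.
exact: bndW p1 (schatten_ge0 _ p1) le (bnd_schatten _ p1).
Qed.

Lemma null_eventually (k l : nat -> nat) (M M' : forall n, 'M[C]_(k n, l n)) n0 :
  (forall n, (n0 <= n)%N -> M n = M' n) -> null M -> null M'.
Proof.
move=> MM h e e0; have [n1 hn] := h e e0; exists (maxn n0 n1) => n.
by rewrite geq_max => /andP[h0 h1]; rewrite -MM //; apply: hn.
Qed.

Lemma eq_null (k l : nat -> nat) (M M' : forall n, 'M[C]_(k n, l n)) :
  (forall n, M n = M' n) -> null M -> null M'.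
Proof. by move=> h; apply: (@null_eventually _ _ _ _ 0%N) => n _. Qed.

Lemma nullD (k l : nat -> nat) (M M' : forall n, 'M[C]_(k n, l n)) :
  null M -> null M' -> null (fun n => M n + M' n).
Proof.
move=> h h' e e0; have e8 : 0 < e / 8 by rewrite divr_gt0.
have [n0 h0] := h _ e8; have [n1 h1] := h' _ e8; exists (maxn n0 n1) => n.
rewrite geq_max => /andP[/h0 hM /h1 hM'].
have -> : e = 4 * (e / 8 + e / 8) by field.
exact: bndD p1 (ltW e8) (ltW e8) hM hM'.
Qed.

Definition obounded (k l : nat -> nat) (M : forall n, 'M[C]_(k n, l n)) :=
  exists2 b, 0 < b & exists n0, forall n, (n0 <= n)%N -> opb (M n) b.

Lemma nullMl (k l m : nat -> nat) (X : forall n, 'M[C]_(m n, k n))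
    (M : forall n, 'M[C]_(k n, l n)) :
  obounded X -> null M -> null (fun n => X n *m M n).
Proof.
move=> [b b0 [n0 h0]] h e e0; have eb : 0 < e / b by rewrite divr_gt0.
have [n1 h1] := h _ eb; exists (maxn n0 n1) => n.
rewrite geq_max => /andP[/h0 hX /h1 hM].
have -> : e = b * (e / b) by field; rewrite gt_eqF.
exact: bndMl p1 (ltW b0) (ltW eb) hX hM.
Qed.

Lemma nullMr (k l m : nat -> nat) (X : forall n, 'M[C]_(l n, m n))
    (M : forall n, 'M[C]_(k n, l n)) :
  obounded X -> null M -> null (fun n => M n *m X n).
Proof.
move=> [b b0 [n0 h0]] h e e0; have eb : 0 < e / b by rewrite divr_gt0.
have [n1 h1] := h _ eb; exists (maxn n0 n1) => n.
rewrite geq_max => /andP[/h0 hX /h1 hM].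
have -> : e = b * (e / b) by field; rewrite gt_eqF.
exact: bndMr p1 (ltW b0) (ltW eb) hX hM.
Qed.

Lemma nullZ (k l : nat -> nat) (M : forall n, 'M[C]_(k n, l n)) (c : C) :
  null M -> null (fun n => c *: M n).
Proof.
move=> h; apply: (@eq_null _ _ (fun n => c%:M *m M n)) => [n|].
  by rewrite mul_scalar_mx.
apply: nullMl h; exists (cabs c + 1); first by have := cabs_ge0 c; lra.
exists 0%N => n _; apply: (@opbW _ _ _ _ (cabs c * 1)); first by lra.
by rewrite -scalemx1; apply: opbZ (@opb1 _ _).
Qed.

Lemma nullN (k l : nat -> nat) (M : forall n, 'M[C]_(k n, l n)) :
  null M -> null (fun n => - M n).
Proof. by move=> /(nullZ (-1)); apply: eq_null => n; rewrite scaleN1r. Qed.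

Definition close (k l : nat -> nat) (A B : forall n, 'M[C]_(k n, l n)) :=
  null (fun n => A n - B n).

Lemma close_sym (k l : nat -> nat) (A B : forall n, 'M[C]_(k n, l n)) :
  close A B -> close B A.
Proof. by move=> /nullN; apply: eq_null => n; rewrite opprB. Qed.

Lemma close_trans (k l : nat -> nat) (A B D : forall n, 'M[C]_(k n, l n)) :
  close A B -> close B D -> close A D.
Proof. by move=> h /(nullD h); apply: eq_null => n; rewrite addrA subrK. Qed.

Lemma null0 (k l : nat -> nat) : null (fun n => 0 : 'M[C]_(k n, l n)).
Proof. by move=> e e0; exists 0%N => n _; exact: bndW p1 (lexx 0) (ltW e0) (bnd0 _ _ p1). Qed.

Lemma close_refl (k l : nat -> nat) (A : forall n, 'M[C]_(k n, l n)) : close A A.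
Proof. by apply: eq_null (@null0 k l) => n; rewrite subrr. Qed.

Lemma null_adj (k l : nat -> nat) (M : forall n, 'M[C]_(k n, l n)) :
  null M -> null (fun n => (M n)^t*).
Proof.
by move=> h e e0; have [n0 hn] := h e e0; exists n0 => n /hn; apply: bnd_adj p1 (ltW e0).
Qed.

Lemma null_sum (I : eqType) (s : seq I) (k l : nat -> nat)
    (M : I -> forall n, 'M[C]_(k n, l n)) :
  {in s, forall i, null (M i)} -> null (fun n => \sum_(i <- s) M i n).
Proof.
elim: s => [|i s IH] h; first by apply: eq_null (@null0 k l) => n; rewrite big_nil.
have hi : null (M i) by apply: h; rewrite mem_head.
have hs : null (fun n => \sum_(j <- s) M j n).
  by apply: IH => j js; apply: h; rewrite inE js orbT.
by apply: eq_null (nullD hi hs) => n; rewrite big_cons.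
Qed.

Lemma null_opb (k l : nat -> nat) (M : forall n, 'M[C]_(k n, l n)) e :
  null M -> 0 < e -> exists n0, forall n, (n0 <= n)%N -> opb (M n) e.
Proof.
move=> h e0; have [n0 hn] := h e e0; exists n0 => n /hn; exact: bnd_opb p1 (ltW e0).
Qed.

Lemma obounded_unitary (k : nat -> nat) (U : forall n, 'M[C]_(k n)) :
  (forall n, U n \is unitarymx) -> obounded U.
Proof. by move=> h; exists 1 => //; exists 0%N => n _; exact: opb_unitary (h n). Qed.

Lemma obounded_adj (k l : nat -> nat) (M : forall n, 'M[C]_(k n, l n)) :
  obounded M -> obounded (fun n => (M n)^t*).
Proof.
move=> [b b0 [n0 h]]; exists b => //; exists n0 => n /h; exact: opb_adj (ltW b0).
Qed.

Lemma close_obounded (k l : nat -> nat) (A B : forall n, 'M[C]_(k n, l n)) :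
  obounded A -> close B A -> obounded B.
Proof.
move=> [b b0 [n0 h0]] /null_opb - /(_ _ ltr01)[n1 h1].
exists (1 + b); first by lra.
exists (maxn n0 n1) => n; rewrite geq_max => /andP[/h0 hA /h1 hB].
by rewrite -[B n](subrK (A n)); apply: opbD hB hA.
Qed.

Lemma close_mul (k l m : nat -> nat) (A A' : forall n, 'M[C]_(k n, l n))
    (B B' : forall n, 'M[C]_(l n, m n)) :
  obounded A -> obounded B' ->
  close A A' -> close B B' ->
  close (fun n => A n *m B n) (fun n => A' n *m B' n).
Proof.
move=> hA hB h h'; apply: eq_null (nullD (nullMl hA h') (nullMr hB h)) => n.
by rewrite mulmxBr mulmxBl addrA subrK.
Qed.

Lemma close_adj (k l : nat -> nat) (A B : forall n, 'M[C]_(k n, l n)) :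
  close A B -> close (fun n => (A n)^t*) (fun n => (B n)^t*).
Proof. by move=> /null_adj; apply: eq_null => n; rewrite linearB map_mxB. Qed.

Lemma eq_close (k l : nat -> nat) (A A' B B' : forall n, 'M[C]_(k n, l n)) :
  (forall n, A n = A' n) -> (forall n, B n = B' n) -> close A B -> close A' B'.
Proof. by move=> hA hB; apply: eq_null => n; rewrite hA hB. Qed.

Lemma close_eventually (k l : nat -> nat) (A A' B : forall n, 'M[C]_(k n, l n)) n0 :
  (forall n, (n0 <= n)%N -> A n = A' n) -> close A B -> close A' B.
Proof. by move=> h; apply: (@null_eventually _ _ _ _ n0) => n hn; rewrite h. Qed.

End NullSequences.

(** * Representations of a subgroup and powers of unitaries *)

Section UnitaryPowers.
Variables (R : realType) (G : groupType).
Local Notation C := R[i].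

Lemma unitarymx1 k : (1%:M : 'M[C]_k) \is unitarymx.
Proof. by apply/unitarymxP; rewrite adj1 mulmx1. Qed.

Definition hom_on (H : set G) (k : nat) (pi : G -> 'M[C]_k) :=
  (forall x, H x -> pi x \is unitarymx) /\
  (forall x y, H x -> H y -> pi (x * y)%g = pi x *m pi y).

Lemma hom_on1 H k (pi : G -> 'M[C]_k) : is_subgroup H -> hom_on H pi -> pi 1%g = 1%:M.
Proof.
move=> hH [pu pm]; have h1 := sg1 hH; have /unitarymxP u := pu _ h1.
have := pm _ _ h1 h1; rewrite mulg1 => /(congr1 (fun M => M *m (pi 1%g)^t*)).
by rewrite -mulmxA u mulmx1.
Qed.

Lemma hom_onV H k (pi : G -> 'M[C]_k) x : is_subgroup H -> hom_on H pi -> H x ->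
  pi x^-1%g = (pi x)^t*.
Proof.
move=> hH hp hx; have [pu pm] := hp; have /unitarymxP u := pu _ hx.
have := pm _ _ (sgV hH hx) hx; rewrite mulVg (hom_on1 hH hp).
by move=> /(congr1 (fun M => M *m (pi x)^t*)); rewrite mul1mx -mulmxA u mulmx1 => ->.
Qed.

(** Negative powers use the adjoint, hence are inverses only for unitary [V]. *)
Definition mpow k (V : 'M[C]_k) : int -> 'M[C]_k := zpw mulmx 1%:M V (V^t*).

Lemma mpowD k (V : 'M[C]_k) a b : V \is unitarymx ->
  mpow V (a + b) = mpow V a *m mpow V b.
Proof.
move=> uV; apply: zpwD; [exact: mulmxA|exact: mul1mx|exact/unitarymxP|exact: unitary_adj].
Qed.

Lemma mpow1 k (V : 'M[C]_k) : mpow V 1 = V.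
Proof. by rewrite /mpow /= mulmx1. Qed.

Lemma mpowN1 k (V : 'M[C]_k) : mpow V (-1) = V^t*.
Proof. by rewrite /mpow /= mulmx1. Qed.

Lemma mpow_unitary k (V : 'M[C]_k) z : V \is unitarymx -> mpow V z \is unitarymx.
Proof.
move=> uV; have u1 : (1%:M : 'M[C]_k) \is unitarymx.
  by apply/unitarymxP; rewrite adj1 mulmx1.
have uV' : V^t* \is unitarymx by rewrite trmxC_unitary; exact: uV.
elim: z => [|n IH|n IH]; first exact: u1.
- have -> : n.+1%:Z = 1 + n%:Z by lia.
  rewrite (mpowD _ _ uV) mpow1; exact: mul_unitarymx uV IH.
- have -> : - n.+1%:Z = -1 + - n%:Z by lia.
  rewrite (mpowD _ _ uV) mpowN1; exact: mul_unitarymx uV' IH.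
Qed.

Lemma mpow_intertwine H t k (pi : G -> 'M[C]_k) (V : 'M[C]_k) z :
  is_subgroup H -> nrm H t -> V \is unitarymx ->
  (forall x, H x -> V *m pi x = pi (x ^ t^-1)%g *m V) ->
  forall x, H x -> mpow V z *m pi x = pi (x ^ gz t (- z))%g *m mpow V z.
Proof.
move=> hH hn uV hV; have /unitarymxP u1 := uV; have u2 := unitary_adj uV.
have hV' x : H x -> V^t* *m pi x = pi (x ^ t)%g *m V^t*.
  move=> hx; have hxt : H (x ^ t)%g by case: (hn x hx).
  have := hV _ hxt; rewrite -conjgM mulgV conjg1 => /(congr1 (fun M => V^t* *m M *m V^t*)).
  by rewrite -!mulmxA u1 mulmx1 mulmxA u2 mul1mx => ->.
elim: z => [|n IH|n IH] x hx.
- by rewrite oppr0 conjg1 /mpow /= mul1mx mulmx1.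
- have -> : n.+1%:Z = 1 + n%:Z by lia.
  rewrite (mpowD _ _ uV) mpow1 -mulmxA IH // mulmxA hV; last exact: nrm_gz.
  by rewrite -mulmxA -conjgM -{2}(gz1 t) -gzN -gzD; congr (pi (_ ^ gz t _)%g *m _); lia.
- have -> : - n.+1%:Z = -1 + - n%:Z by lia.
  rewrite (mpowD _ _ uV) mpowN1 -mulmxA IH // mulmxA hV'; last exact: nrm_gz.
  by rewrite -mulmxA -conjgM -{2}(gz1 t) -gzD; congr (pi (_ ^ gz t _)%g *m _); lia.
Qed.

Lemma mpowM k (V : 'M[C]_k) a b : V \is unitarymx ->
  mpow (mpow V a) b = mpow V (a * b).
Proof.
move=> uV; have uA := mpow_unitary a uV.
have mpowN z : mpow V (- z) = (mpow V z)^t*.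
  have := mpowD (- z) z uV; rewrite addNr => /(congr1 (fun M => M *m (mpow V z)^t*)).
  have /unitarymxP u := mpow_unitary z uV.
  by rewrite -mulmxA u mulmx1 => <-; rewrite /mpow /= mul1mx.
elim: b => [|n IH|n IH]; first by rewrite mulr0.
- have -> : a * n.+1%:Z = a + a * n%:Z by lia.
  have -> : n.+1%:Z = 1 + n%:Z by lia.
  by rewrite (mpowD _ _ uA) (mpowD _ _ uV) mpow1 IH.
- have -> : a * - n.+1%:Z = - a + a * - n%:Z by lia.
  have -> : - n.+1%:Z = -1 + - n%:Z by lia.
  by rewrite (mpowD _ _ uA) (mpowD _ _ uV) mpowN1 IH mpowN.
Qed.

Lemma hom_on_gz H k (pi : G -> 'M[C]_k) x z : is_subgroup H -> hom_on H pi -> H x ->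
  pi (gz x z) = mpow (pi x) z.
Proof.
move=> hH hp hx; have [pu pm] := hp; have ux := pu _ hx.
have hg z' := sg_gz z' hH hx.
elim: z => [|n IH|n IH]; first exact: hom_on1 hH hp.
- have -> : n.+1%:Z = 1 + n%:Z by lia.
  by rewrite gzD pm // gz1 (mpowD _ _ ux) mpow1 IH.
- have -> : - n.+1%:Z = -1 + - n%:Z by lia.
  rewrite gzD pm // (mpowD _ _ ux) mpowN1 -IH; congr (_ *m _).
  by rewrite gzN gz1; exact: hom_onV hH hp hx.
Qed.

(* Averaging over H makes rho(t) an exact intertwiner of pi with its t-conjugate. *)
Lemma average_intertwines H t k (pi : G -> 'M[C]_k) (U : 'M[C]_k) (s : seq G) :
  is_subgroup H -> nrm H t -> hom_on H pi -> uniq s -> H = [set` s] ->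
  let X := \sum_(x <- s) pi (x ^ t^-1)%g *m U *m (pi x)^t* in
  forall y, H y -> X *m pi y = pi (y ^ t^-1)%g *m X.
Proof.
move=> hH hn hp us Hs X y hy; have [pu pm] := hp.
have sH x : x \in s -> H x by rewrite Hs.
have hyV := sgV hH hy.
have e : perm_eq s (map (fun x => y * x)%g s).
  apply: uniq_perm => //; first by rewrite map_inj_uniq //; apply: mulgI.
  have HsE x : (x \in s) = `[< H x >] by rewrite Hs asboolb.
  move=> x; apply/idP/mapP => [xs|[z zs ->]].
    by exists (y^-1 * x)%g; rewrite ?mulVKg // HsE; apply/asboolP/(sgM hH hyV)/sH.
  by rewrite HsE; apply/asboolP/(sgM hH hy)/sH.
rewrite {1}/X (perm_big _ e) /= big_map mulmx_suml mulmx_sumr.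
rewrite !big_seq; apply: eq_bigr => x xs.
have hx := sH _ xs; have hxt : H (x ^ t^-1)%g by case: (hn x hx).
have hyt : H (y ^ t^-1)%g by case: (hn y hy).
rewrite conjMg (pm _ _ hyt hxt) (pm _ _ hy hx) adjM -!mulmxA.
by rewrite (unitary_adj (pu _ hy)) mulmx1.
Qed.

End UnitaryPowers.

Section StabilityOfFiniteByCyclic.
Variables (R : realType) (p : \bar R) (G : groupType).
Hypothesis p1 : (1 < p)%E.
Local Notation C := R[i].

Section Asymptotic.
Variables (k : nat -> nat) (rho : forall n, G -> 'M[C]_(k n)).
Hypothesis rhoP : asymptotic_representation p rho.

Lemma asym_mul x y :
  close p (fun n => rho n (x * y)%g) (fun n => rho n x *m rho n y).
Proof. by case: rhoP => _ h; apply/(null_schatten p1); apply: h. Qed.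

Lemma asym_unitary n x : rho n x \is unitarymx. Proof. by case: rhoP. Qed.

Lemma asym_obounded x : obounded (fun n => rho n x).
Proof. by apply: obounded_unitary => n; apply: asym_unitary. Qed.

Lemma asym_cancel (A B : forall n, 'M[C]_(k n)) x :
  close p (fun n => A n *m rho n x) (fun n => B n *m rho n x) -> close p A B.
Proof.
move=> h; have := nullMr p1 (obounded_adj (asym_obounded x)) h.
apply: eq_null => n; have /unitarymxP u := asym_unitary n x.
by rewrite mulmxBl -!mulmxA u !mulmx1.
Qed.

Lemma asym_one : close p (fun n => rho n 1%g) (fun n => 1%:M).
Proof.
apply: (@asym_cancel _ _ 1%g).
apply: eq_close (close_sym p1 (asym_mul 1%g 1%g)) => // n.
by rewrite mulg1 mul1mx.
Qed.

Lemma asym_inv x : close p (fun n => rho n x^-1%g) (fun n => (rho n x)^t*).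
Proof.
apply: (@asym_cancel _ _ x).
apply: (close_trans p1 (B := fun n => 1%:M)).
  apply: (close_trans p1 (B := fun n => rho n 1%g)); last exact: asym_one.
  by apply: eq_close (close_sym p1 (asym_mul x^-1%g x)) => // n; rewrite mulVg.
apply: eq_close (close_refl p1 _) => // n.
by rewrite (unitary_adj (asym_unitary n x)).
Qed.

End Asymptotic.

(** [rho] is asymptotically multiplicative on all of [G] while [pi] is constrained on [H] only: the
    next extension step needs [rho] at an element outside [H]. *)
Definition stable_on (H : set G) :=
  forall (k : nat -> nat) (rho : forall n, G -> 'M[C]_(k n)),
  asymptotic_representation p rho ->
  exists2 pi : forall n, G -> 'M[C]_(k n), (forall n, hom_on H (pi n)) &
    forall x, H x -> close p (fun n => pi n x) (fun n => rho n x).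

Lemma asym_mpow (k : nat -> nat) (rho : forall n, G -> 'M[C]_(k n))
    (V : forall n, 'M[C]_(k n)) t z :
  asymptotic_representation p rho -> (forall n, V n \is unitarymx) ->
  close p V (fun n => rho n t) ->
  close p (fun n => mpow (V n) z) (fun n => rho n (gz t z)).
Proof.
move=> rhoP uV hV.
have hVs : close p (fun n => (V n)^t*) (fun n => rho n t^-1%g).
  apply: (close_trans p1 (close_adj p1 hV)).
  exact: (close_sym p1 (asym_inv rhoP t)).
have bV := obounded_unitary uV.
elim: z => [|n IH|n IH].
- exact: (close_sym p1 (asym_one rhoP)).
- have -> : n.+1%:Z = 1 + n%:Z by lia.
  apply: (close_trans p1 (B := fun m => rho m t *m rho m (gz t n))); last first.
    by rewrite gzD gz1; exact: (close_sym p1 (asym_mul rhoP _ _)).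
  apply: eq_close (close_mul p1 bV (asym_obounded rhoP _) hV IH) => //.
- have -> : - n.+1%:Z = -1 + - n%:Z by lia.
  apply: (close_trans p1 (B := fun m => rho m t^-1%g *m rho m (gz t (- n%:Z)))); last first.
    by rewrite gzD (gzN t 1) gz1; exact: (close_sym p1 (asym_mul rhoP _ _)).
  apply: eq_close (close_mul p1 (obounded_adj bV) (asym_obounded rhoP _) hVs IH) => // m.
  by rewrite (mpowD _ _ (uV m)) mpowN1.
Qed.

End StabilityOfFiniteByCyclic.

(** * Extending an exact representation by one normalizing element *)

Section StabilityStep.
Variables (R : realType) (p : \bar R) (G : groupType).
Hypothesis p1 : (1 < p)%E.
Local Notation C := R[i].
Variables (H : set G) (t : G).
Hypotheses (hH : is_subgroup H) (fH : finite_set H) (hn : nrm H t).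

Section Intertwiner.
Variables (k : nat -> nat) (rho pi : forall n, G -> 'M[C]_(k n)).
Hypotheses (rhoP : asymptotic_representation p rho).
Hypotheses (piP : forall n, hom_on H (pi n)).
Hypotheses (pirho : forall x, H x -> close p (fun n => pi n x) (fun n => rho n x)).

Lemma pi_obounded x : H x -> obounded (fun n => pi n x).
Proof. by move=> hx; apply: obounded_unitary => n; case: (piP n) => h _; apply: h. Qed.

Lemma average_summand x : H x ->
  close p (fun n => pi n (x ^ t^-1)%g *m rho n t *m (pi n x)^t*) (fun n => rho n t).
Proof.
move=> hx; have hxt : H (x ^ t^-1)%g by case: (hn hx).
have bx := pi_obounded hx; have bt := asym_obounded rhoP t.
have e1 : close p (fun n => pi n (x ^ t^-1)%g *m rho n t) (fun n => rho n t *m pi n x).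
  apply: (close_trans p1 (B := fun n => rho n (x ^ t^-1)%g *m rho n t)).
    exact: (close_mul p1 (pi_obounded hxt) bt (pirho hxt) (close_refl p1 _)).
  apply: (close_trans p1 (B := fun n => rho n (t * x)%g)).
    apply: eq_close (close_sym p1 (asym_mul p1 rhoP _ _)) => // n.
    by congr (rho n _); rewrite -conjgCV.
  apply: (close_trans p1 (asym_mul p1 rhoP _ _)).
  exact: (close_mul p1 bt bx (close_refl p1 _) (close_sym p1 (pirho hx))).
have b2 : obounded (fun n => (pi n x)^t*) by exact: obounded_adj bx.
have b3 : obounded (fun n => pi n (x ^ t^-1)%g *m rho n t).
  by apply: obounded_unitary => n; apply: mul_unitarymx (asym_unitary rhoP _ _); case: (piP n) => h _; apply: h.
apply: eq_close (close_mul p1 b3 b2 e1 (close_refl p1 _)) => // n.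
have /unitarymxP u : pi n x \is unitarymx by case: (piP n) => h _; apply: h.
by rewrite -mulmxA u mulmx1.
Qed.

(** The average [X] is an exact intertwiner close to the unitary rho(t), so X* X is eventually close
    to 1; since X* X commutes with [pi] on [H], passing to the polar part spoils nothing. *)
Lemma exact_intertwiner : exists2 V : forall n, 'M[C]_(k n),
  (forall n, V n \is unitarymx) &
  close p V (fun n => rho n t) /\
  exists n0, forall n, (n0 <= n)%N -> forall x, H x ->
    V n *m pi n x = pi n (x ^ t^-1)%g *m V n.
Proof.
have /finite_seqP[s0 Hs0] := fH.
pose s := undup s0; have us : uniq s := undup_uniq _.
have Hs : H = [set` s].
  by rewrite Hs0; apply/seteqP; split=> x /=; rewrite mem_undup.
have s1 : (0 < size s)%N.
  by have := sg1 hH; rewrite Hs /=; case: (s).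
pose X n : 'M[C]_(k n) := ((size s)%:R^-1 : C) *:
  \sum_(x <- s) pi n (x ^ t^-1)%g *m rho n t *m (pi n x)^t*.
have X_int n x : H x -> X n *m pi n x = pi n (x ^ t^-1)%g *m X n.
  move=> hx; rewrite /X -scalemxAl -scalemxAr; congr (_ *: _).
  exact: (average_intertwines (rho n t) hH hn (piP n) us Hs).
have XU : close p X (fun n => rho n t).
  have h : null p (fun n => \sum_(x <- s) (pi n (x ^ t^-1)%g *m rho n t *m (pi n x)^t* - rho n t)).
    by apply: null_sum => // x xs; apply: average_summand; rewrite Hs.
  apply: eq_null (nullZ p1 ((size s)%:R^-1) h) => n.
  rewrite big_split /= scalerDr; congr (_ + _).
  rewrite big_const_seq count_predT iter_addr addr0 -[X in _ *: X]scaler_nat scalerA mulVf ?scale1r //.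
  by rewrite pnatr_eq0 -lt0n.
have bU := asym_obounded rhoP t.
have bX : obounded X by exact: (close_obounded p1 bU XU).
have XX : null p (fun n => 1%:M - (X n)^t* *m X n).
  have := close_mul p1 (obounded_adj bU) bX (close_adj p1 (close_sym p1 XU)) (close_sym p1 XU).
  by apply: eq_null => n; rewrite (unitary_adj (asym_unitary rhoP _ _)).
have half0 : (0 : R) < 1 / 2 by lra.
have [n0 h0] := null_opb p1 XX half0.
have ex n : exists BQ : 'M[C]_(k n) * 'M[C]_(k n), (n0 <= n)%N ->
    [/\ X n *m BQ.1 \is unitarymx, BQ.1 = 1%:M + (1%:M - (X n)^t* *m X n) *m BQ.2,
      opb BQ.2 1 &
      forall Z, Z *m ((X n)^t* *m X n) = ((X n)^t* *m X n) *m Z -> Z *m BQ.1 = BQ.1 *m Z].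
  have [le|_] := leqP n0 n; last by exists (1%:M, 1%:M).
  by have [B [Q h]] := polar_correction (h0 n le); exists (B, Q).
pose BQ n := projT1 (cid (ex n)).
have hBQ n : (n0 <= n)%N -> _ := projT2 (cid (ex n)).
(* For small indices [X] may be singular; any unitary will do there, since only the tail matters. *)
pose V n := if (n0 <= n)%N then X n *m (BQ n).1 else 1%:M.
have VE n : (n0 <= n)%N -> V n = X n *m (BQ n).1 by rewrite /V => ->.
exists V.
  move=> n; rewrite /V; case: leqP => le; last exact: unitarymx1.
  by have [] := hBQ n le.
split.
- apply: (close_trans p1 _ XU).
  have bQ : obounded (fun n => (BQ n).2).
    by exists 1 => //; exists n0 => n le; have [] := hBQ n le.
  have h := nullMl p1 bX (nullMr p1 bQ XX).
  apply: null_eventually h => n le; rewrite (VE n le).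
  have [_ e _ _] := hBQ n le.
  by rewrite [in RHS]e mulmxDr mulmx1 [RHS]addrC addKr.
- exists n0 => n le x hx; rewrite (VE n le).
  have [_ _ _ hc] := hBQ n le.
  have hxt : H (x ^ t^-1)%g by case: (hn hx).
  (* The adjoint of the intertwining relation at the inverse of x. *)
  have adjX : (X n)^t* *m pi n (x ^ t^-1)%g = pi n x *m (X n)^t*.
    have hxV := sgV hH hx.
    have := X_int n _ hxV; rewrite (hom_onV hH (piP n) hx) conjVg.
    rewrite (hom_onV hH (piP n) hxt) => /(congr1 (fun M => M^t*)).
    by rewrite !adjM !trmxCK => ->.
  have /hc e : pi n x *m ((X n)^t* *m X n) = ((X n)^t* *m X n) *m pi n x.
    by rewrite -[RHS]mulmxA (X_int n x hx) !mulmxA adjX.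
  have e' : pi n x *m (BQ n).1 = (BQ n).1 *m pi n x := e.
  by rewrite -mulmxA -e' mulmxA (X_int n x hx) -mulmxA.
Qed.

End Intertwiner.

(** Relations valid only from [n0] on suffice: below [n0] the trivial representation is used, and
    closeness ignores finitely many indices. *)
Lemma homs_assemble (k : nat -> nat) (rho pi : forall n, G -> 'M[C]_(k n))
    (V : forall n, 'M[C]_(k n)) n0 :
  asymptotic_representation p rho -> (forall n, hom_on H (pi n)) ->
  (forall x, H x -> close p (fun n => pi n x) (fun n => rho n x)) ->
  (forall n, V n \is unitarymx) -> close p V (fun n => rho n t) ->
  (forall n, (n0 <= n)%N -> forall x, H x -> V n *m pi n x = pi n (x ^ t^-1)%g *m V n) ->
  (forall n, (n0 <= n)%N -> forall j, H (gz t j) -> pi n (gz t j) = mpow (V n) j) ->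
  exists2 pi' : forall n, G -> 'M[C]_(k n), (forall n, hom_on (extg H t) (pi' n)) &
    forall x, extg H t x -> close p (fun n => pi' n x) (fun n => rho n x).
Proof.
move=> rhoP piP pirho uV hV hint hpow.
have ex n : exists f : G -> 'M[C]_(k n), hom_on (extg H t) f /\
    ((n0 <= n)%N -> forall h z, H h -> f (h * gz t z)%g = pi n h *m mpow (V n) z).
  have [le|_] := leqP n0 n; last first.
    by exists (fun=> 1%:M); split=> //; split=> [x _|x y _ _]; rewrite ?mulmx1 //; exact: unitarymx1.
  have [pu pm] := piP n.
  have hc z x : H x -> mpow (V n) z *m pi n x = pi n (x ^ gz t (- z))%g *m mpow (V n) z.
    by move=> hx; exact: (mpow_intertwine z hH hn (uV n) (hint n le) hx).
  have [f f1 f2] := homs_extend (@mulmxA _ _ _ _ _) hH hn pm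
    (fun a b => mpowD a b (uV n)) hc (hpow n le).
  exists f; split; last by move=> _; exact: f2.
  split; last exact: f1.
  move=> _ [h hh [z ->]]; rewrite f2 //.
  exact: (mul_unitarymx (pu _ hh) (mpow_unitary z (uV n))).
pose f n := projT1 (cid (ex n)).
have hf n : hom_on (extg H t) (f n) by have [] := projT2 (cid (ex n)).
have fE n (le : (n0 <= n)%N) h z : H h -> f n (h * gz t z)%g = pi n h *m mpow (V n) z.
  by move=> hh; have [_ /(_ le)] := projT2 (cid (ex n)); apply.
exists f; first exact: hf.
move=> _ [h hh [z ->]].
have c1 := asym_mpow p1 z rhoP uV hV.
have b1 : obounded (fun n => pi n h) by exact: (pi_obounded piP hh).
have c2 := close_mul p1 b1 (asym_obounded rhoP _) (pirho h hh) c1.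
apply: (close_trans p1 _ (close_sym p1 (asym_mul p1 rhoP h (gz t z)))).
by apply: (close_eventually (n0 := n0) _ c2) => n le; rewrite (fE n le h z hh).
Qed.

Lemma stable_on_infinite_ext : (forall j, H (gz t j) -> j = 0) ->
  stable_on p H -> stable_on p (extg H t).
Proof.
move=> h0 sH k rho rhoP; have [pi piP pirho] := sH k rho rhoP.
have [V uV [hV [n0 hint]]] := exact_intertwiner rhoP piP pirho.
apply: (homs_assemble rhoP piP pirho uV hV hint) => n _ j /h0 ->.
exact: hom_on1 hH (piP n).
Qed.

(* V is multiplied by an m-th root of V^-m pi(t^m), which commutes with everything in sight. *)
Lemma stable_on_finite_ext (m : nat) : (0 < m)%N -> H (t ^+ m)%g ->
  (forall j, H (gz t j) -> (m %| j)%Z) ->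
  stable_on p H -> stable_on p (extg H t).
Proof.
move=> m0 hm hj sH k rho rhoP; have [pi piP pirho] := sH k rho rhoP.
have [V uV [hV [n0 hint]]] := exact_intertwiner rhoP piP pirho.
have hm' : H (gz t m) by rewrite gzX.
have uA n : mpow (V n) m \is unitarymx by exact: mpow_unitary.
have uAs n : (mpow (V n) m)^t* \is unitarymx by rewrite trmxC_unitary; exact: uA.
have up n : pi n (gz t m) \is unitarymx by case: (piP n) => h _; exact: h.
pose Z n : 'M[C]_(k n) := (mpow (V n) m)^t* *m pi n (gz t m).
have uZ n : Z n \is unitarymx by exact: (mul_unitarymx (uAs n) (up n)).
have Z1 : close p Z (fun n => 1%:M).
  have c1 := close_trans p1 (pirho _ hm') (close_sym p1 (asym_mpow p1 m rhoP uV hV)).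
  have b1 := obounded_adj (obounded_unitary uA).
  apply: eq_close (close_mul p1 b1 (obounded_unitary uA) (close_refl p1 _) c1) => // n.
  exact: unitary_adj.
(* The operator-norm radius within which [unitary_root] extracts an m-th root. *)
pose delta : R := (2 * m%:R)^-1 ^+ m.
have d0 : 0 < delta by rewrite exprn_gt0 // invr_gt0 mulr_gt0 // ltr0n.
have [n1 h1] := null_opb p1 Z1 d0.
have ex n : exists BQ : 'M[C]_(k n) * 'M[C]_(k n), BQ.1 \is unitarymx /\ ((n1 <= n)%N ->
    [/\ iter m (mulmx BQ.1) 1%:M = Z n, BQ.1 - 1%:M = (Z n - 1%:M) *m BQ.2, opb BQ.2 2 &
        forall Y, Y *m Z n = Z n *m Y -> Y *m BQ.1 = BQ.1 *m Y]).
  have [le|_] := leqP n1 n; last by exists (1%:M, 1%:M); split=> //; exact: unitarymx1.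
  by have [B [Q [h2 h3 h4 h5 h6]]] := unitary_root m0 (uZ n) (h1 n le); exists (B, Q).
pose B n := (projT1 (cid (ex n))).1; pose Q n := (projT1 (cid (ex n))).2.
have uB n : B n \is unitarymx by have [] := projT2 (cid (ex n)).
have hB n (le : (n1 <= n)%N) : [/\ iter m (mulmx (B n)) 1%:M = Z n,
    B n - 1%:M = (Z n - 1%:M) *m Q n, opb (Q n) 2 &
    forall Y, Y *m Z n = Z n *m Y -> Y *m B n = B n *m Y].
  by have [_ /(_ le)] := projT2 (cid (ex n)).
pose W n : 'M[C]_(k n) := V n *m B n.
have uW n : W n \is unitarymx by exact: (mul_unitarymx (uV n) (uB n)).
have B1 : close p B (fun n => 1%:M).
  have bQ : obounded Q by exists 2 => //; exists n1 => n le; have [] := hB n le.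
  have h := nullMr p1 bQ Z1.
  by apply: null_eventually h => n le; have [_ -> _ _] := hB n le.
have bV := obounded_unitary uV.
have b1 : obounded (fun n => 1%:M : 'M[C]_(k n)).
  by apply: obounded_unitary => n; exact: unitarymx1.
have hW : close p W (fun n => rho n t).
  apply: (close_trans p1 _ hV).
  by apply: eq_close (close_mul p1 bV b1 (close_refl p1 _) B1) => // n; rewrite mulmx1.
(* V^m and pi(t^m) conjugate [pi] on [H] in the same way, both by t^m, so their quotient centralizes
   it. *)
have Zpi n x : (n0 <= n)%N -> H x -> pi n x *m Z n = Z n *m pi n x.
  move=> le hx; have [pu pm] := piP n.
  have := mpow_intertwine m hH hn (uV n) (hint n le) hx.
  set A := mpow (V n) m => e.
  have hxt : H (x ^ gz t (- m%:Z))%g by exact: nrm_gz.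
  have e2 : pi n x *m A^t* = A^t* *m pi n (x ^ gz t (- m%:Z))%g.
    have /unitarymxP u := uA n; have us := unitary_adj (uA n).
    have := congr1 (fun M => A^t* *m M *m A^t*) e.
    by rewrite !mulmxA us mul1mx -!mulmxA u mulmx1.
  rewrite /Z -/A mulmxA e2 -!mulmxA -(pm _ _ hxt hm') -(pm _ _ hm' hx); congr (_ *m pi n _).
  by rewrite gzN conjgE invgK !mulgA mulgVK.
(* [V] commutes with its own powers, and with pi(t^m) because conjugation by t fixes t^m. *)
have ZV n : (n0 <= n)%N -> V n *m Z n = Z n *m V n.
  move=> le; have e1 := hint n le _ hm'.
  have e2 : V n *m mpow (V n) (- m%:Z) = mpow (V n) (- m%:Z) *m V n.
    by rewrite -{1 4}(mpow1 (V n)) -!(mpowD _ _ (uV n)) addrC.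
  have e3 : (mpow (V n) m)^t* = mpow (V n) (- m%:Z).
    have := mpowD (- m%:Z) m (uV n); rewrite addNr => /(congr1 (fun M => M *m (mpow (V n) m)^t*)).
    have /unitarymxP u := uA n; rewrite -mulmxA u mulmx1 => <-.
    by rewrite /mpow /= mul1mx.
  have e4 : (gz t m ^ t^-1)%g = gz t m.
    by rewrite -{2}(gz1 t) -gzN /conjg -gzN -!gzD; congr (gz t _); lia.
  by rewrite /Z e3 mulmxA e2 -mulmxA e1 e4 mulmxA.
apply: (@homs_assemble k rho pi W (maxn n0 n1) rhoP piP pirho uW hW).
- move=> n; rewrite geq_max => /andP[le0 le1] x hx; have [_ _ _ hc] := hB n le1.
  have eB := hc _ (Zpi n x le0 hx).
  by rewrite /W -mulmxA -eB mulmxA (hint n le0 x hx) -mulmxA.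
- move=> n; rewrite geq_max => /andP[le0 le1] j hjj; have [eZ _ _ hc] := hB n le1.
  have eV := hc _ (ZV n le0).
  have eW q : iter q (mulmx (W n)) 1%:M = iter q (mulmx (V n)) 1%:M *m iter q (mulmx (B n)) 1%:M.
    have eVq q' : B n *m iter q' (mulmx (V n)) 1%:M = iter q' (mulmx (V n)) 1%:M *m B n.
      elim: q' => [|q' IH]; first by rewrite /= mulmx1 mul1mx.
      by rewrite /= mulmxA -eV -mulmxA IH mulmxA.
    elim: q => [|q IH]; first by rewrite /= mulmx1.
    by rewrite /= IH /W -!mulmxA (mulmxA (B n)) eVq !mulmxA.
  have Wm : mpow (W n) m = pi n (gz t m).
    have -> : mpow (W n) m = mpow (V n) m *m Z n by rewrite -eZ; exact: eW.
    by have /unitarymxP u := uA n; rewrite /Z mulmxA u mul1mx.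
  have /dvdzP[q ->] := hj j hjj.
  by rewrite mulrC -gzM (hom_on_gz q hH (piP n) hm') -Wm (mpowM _ _ (uW n)).
Qed.

End StabilityStep.

Section VirtuallyCyclicStable.
Variables (R : realType) (p : \bar R) (G : groupType).
Hypothesis p1 : (1 < p)%E.
Local Notation C := R[i].

Lemma stable_on_trivial : stable_on p [set (1 : G)%g].
Proof.
move=> k rho rhoP; exists (fun n _ => 1%:M) => [n|x ->].
  by split=> [x _|x y _ _]; [exact: unitarymx1|rewrite mulmx1].
exact: (close_sym p1 (asym_one p1 rhoP)).
Qed.

Lemma stable_on_setT : stable_on p [set: G] -> p_stable p G.
Proof.
move=> h k rho rhoP; have [pi piP pirho] := h k rho rhoP.
exists pi => [n|x]; last by apply/(null_schatten p1); exact: pirho.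
by have [h1 h2] := piP n; split=> [x|x y]; [exact: h1|exact: h2].
Qed.

Lemma finite_nilpotent_stable_on n (K : set G) : lower_central G n = [set 1%g] ->
  is_subgroup K -> finite_set K -> stable_on p K.
Proof.
move=> Gn hK fK.
suff [] : finite_set K /\ stable_on p K by [].
apply: (finite_subgroup_ind Gn (P := fun H => finite_set H /\ stable_on p H) hK fK).
  by split; [exact: finite_set1|exact: stable_on_trivial].
move=> H t k hH HK hn nHt Kt k0 tk [fH sH].
have Hk : H (t ^+ k)%g by rewrite tk; exact: sg1.
split; first exact: extg_finite hH fH k0 Hk.
have ex : exists m, (0 < m)%N && `[< H (t ^+ m)%g >].
  by exists k; rewrite k0; apply/asboolP.
(* The least positive exponent with t^m in [H] divides all others, so the extension has to be
   checked at t^m only. *)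
case: (ex_minnP ex) => m /andP[m0 /asboolP hm] minm.
apply: (stable_on_finite_ext p1 hH fH hn m0 hm _ sH) => j hj.
apply/dvdz_mod0P; apply/eqP/negPn/negP => /eqP r0.
have r1 : 0 <= (j %% m)%Z by apply: modz_ge0; lia.
have r2 : (j %% m)%Z < m by apply: ltz_pmod; lia.
have : H (gz t (j %% m)%Z).
  have := hj; rewrite {1}(divz_eq j m) gzD; apply: (sgMl hH).
  by rewrite mulrC -gzM gzX; exact: (sg_gz _ hH hm).
have -> : (j %% m)%Z = absz (j %% m)%Z :> int by lia.
rewrite gzX => h; have /minm : (0 < absz (j %% m)%Z)%N && `[< H (t ^+ absz (j %% m)%Z)%g >].
  by apply/andP; split; [lia|apply/asboolP].
lia.
Qed.

Lemma virtually_cyclic_stable : finitely_generated G -> nilpotent_group G ->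
  virtually_cyclic G -> p_stable p G.
Proof.
move=> fg [n Gn] vc; apply: stable_on_setT.
have [fG|nfG] := pselect (finite_set [set: G]).
  exact: finite_nilpotent_stable_on Gn (sgT G) fG.
have [psi [t psiM psit]] := infinite_nilpotent_onto Gn fg nfG.
have fK := vc_finite_kerg psiM psit vc.
have hK := kerg_sg psiM.
have hn : nrm (kerg psi) t by move=> x hx; split; exact: (kergJ psiM _ hx).
have -> : [set: G] = extg (kerg psi) t.
  apply/seteqP; split=> // x _; exists (x * gz t (- psi x))%g.
    exact: (kerg_dec psiM psit).
  by exists (psi x); rewrite -mulgA -gzD addNr mulg1.
apply: (stable_on_infinite_ext p1 hK fK hn).
  by move=> j; rewrite /kerg /= (psi_gz psiM) psit mulr1.
exact: finite_nilpotent_stable_on Gn hK fK.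
Qed.

End VirtuallyCyclicStable.

(** * Winding numbers of determinants *)

Section Arguments.
Variable R : realType.
Local Notation C := R[i].
Implicit Types (z w : C) (a b : R).

Definition cis a : C := (cos a +i* sin a).

Lemma cisD a b : cis (a + b) = cis a * cis b.
Proof.
rewrite /cis cosD sinD; apply/eqP; rewrite eq_complex /=.
by apply/andP; split; apply/eqP; ring.
Qed.

Lemma cis0 : cis 0 = 1. Proof. by rewrite /cis cos0 sin0. Qed.

Lemma cisN a : cis (- a) = Num.conj (cis a).
Proof. by rewrite /cis cosN sinN. Qed.

Lemma cis_mul_nat a n : cis (n%:R * a) = cis a ^+ n.
Proof.
elim: n => [|n IH]; first by rewrite mul0r cis0.
by rewrite -natr1 mulrDl mul1r cisD IH exprSr.
Qed.

Lemma lip_of_derive (f df : R -> R) a : (forall x : R, is_derive x (1 : R) f (df x)) ->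
  (forall x, `|df x| <= 1) -> `|f a - f 0| <= `|a|.
Proof.
move=> fd df1; have fc : continuous f.
  by move=> x; apply: differentiable_continuous; apply/derivable1_diffP; case: (fd x).
case/orP: (le_total 0 a) => a0.
  have [c _ ->] := MVT_segment a0 (fun x _ => fd x) (continuous_subspaceT fc).
  by rewrite subr0 normrM ler_piMl.
have [c _ e] := MVT_segment a0 (fun x _ => fd x) (continuous_subspaceT fc).
by rewrite distrC e sub0r normrM normrN ler_piMl.
Qed.

Lemma cis_near1 a : cabs (cis a - 1) <= 2 * `|a|.
Proof.
have hs : `|sin a - sin 0| <= `|a|.
  by apply: (@lip_of_derive sin cos) => x; exact: cos_max.
have hc : `|cos a - cos 0| <= `|a|.
  apply: (@lip_of_derive cos (fun x => - sin x)) => x.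
  by rewrite normrN sin_max.
have -> : cis a - 1 = (cos a - cos 0)%:C + 'i%C * (sin a - sin 0)%:C.
  rewrite cos0 sin0 subr0; apply/eqP; rewrite eq_complex /=.
  by apply/andP; split; apply/eqP; ring.
apply: le_trans (cabsD _ _) _; rewrite cabsM !cabs_real.
have -> : cabs 'i%C = 1 :> R.
  by rewrite /cabs normc_def /= expr0n expr1n add0r sqrtr1.
lra.
Qed.

(** The argument only on the open right half-plane, which contains all ratios considered below. *)
Definition carg z : R := atan (complex.Im z / complex.Re z).

Lemma carg_polar (r a : R) : 0 < r -> `|a| < pi / 2 -> carg (r%:C * cis a) = a.
Proof.
move=> r0; rewrite ltr_norml => ha.
have ca : 0 < cos a by apply: cos_gt0_pihalf.
rewrite /carg /cis /= !mul0r subr0 addr0.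
have -> : r * sin a / (r * cos a) = tan a by rewrite /tan; field; rewrite !gt_eqF.
by apply: tanK; rewrite in_itv.
Qed.

Lemma polar_form z : 0 < complex.Re z -> z = (cabs z)%:C * cis (carg z).
Proof.
case: z => x y /= x0; rewrite /carg /=; set t := y / x.
have yE : y = t * x by rewrite /t divfK // gt_eqF.
have ct := cos_atan t; have tt := atanK t.
have c0 : 0 < cos (atan t) by apply: cos_gt0_pihalf; rewrite atan_gtNpi2 atan_ltpi2.
have st : sin (atan t) = t * cos (atan t) by rewrite -{2}tt /tan divfK // gt_eqF.
have n1 : cabs (x +i* y) = x / cos (atan t).
  rewrite /cabs normc_def /= yE ct invrK.
  have -> : x ^+ 2 + (t * x) ^+ 2 = x ^+ 2 * (1 + t ^+ 2) by ring.
  by rewrite sqrtrM ?sqr_ge0 // sqrtr_sqr ger0_norm // ltW.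
rewrite n1 /cis st; apply/eqP; rewrite eq_complex /=.
by apply/andP; split; apply/eqP; rewrite ?yE; field; rewrite gt_eqF.
Qed.

(** The radius 1/4 keeps arguments below pi/4, so that a product of two such numbers stays where
    [carg] is additive. *)
Definition near1 z := cabs (z - 1) <= 1 / 4.

Lemma near1_Re z : near1 z -> 3 / 4 <= complex.Re z.
Proof.
rewrite /near1 => h; have := Re_le_cabs (1 - z).
rewrite -cabsN opprB in h; rewrite raddfB /= in h *; lra.
Qed.

Lemma near1_carg z : near1 z -> `|carg z| < pi / 4.
Proof.
move=> h; have hr := near1_Re h; have r0 : 0 < complex.Re z by lra.
have hi : `|complex.Im z| <= 1 / 4.
  apply: le_trans h; rewrite -lecR -normE.
  have := normc_ge_Re ((z - 1) * 'i%C); rewrite ReiNIm normrN.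
  rewrite raddfB /= subr0 normrM.
  have -> : `|'i%C| = 1 :> C by rewrite normc_def /= expr0n expr1n add0r sqrtr1.
  by rewrite mulr1.
have : `|complex.Im z / complex.Re z| < 1.
  rewrite normrM normfV (ger0_norm (ltW r0)) ltr_pdivrMr //; lra.
rewrite ltr_norml => /andP[h1 h2].
rewrite ltr_norml /carg -atan1 -atanN; apply/andP; split; exact: lt_atan.
Qed.

Lemma cargM z w : 0 < complex.Re z -> 0 < complex.Re w ->
  `|carg z + carg w| < pi / 2 -> carg (z * w) = carg z + carg w.
Proof.
move=> z0 w0 h; have ez := polar_form z0; have ew := polar_form w0.
rewrite {1}ez {1}ew mulrACA -rmorphM -cisD carg_polar //.
have pos u : 0 < complex.Re u -> 0 < cabs u by move=> u0; apply: lt_le_trans (Re_le_cabs u).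
by rewrite mulr_gt0 ?pos.
Qed.

Lemma cargM_near1 z w : near1 z -> near1 w -> carg (z * w) = carg z + carg w.
Proof.
move=> hz hw; have := near1_carg hz; have := near1_carg hw => h1 h2.
apply: cargM; [by have := near1_Re hz; lra|by have := near1_Re hw; lra|].
apply: le_lt_trans (ler_normD _ _) _; lra.
Qed.

Lemma carg1 : carg 1 = 0. Proof. by rewrite /carg /= mul0r atan0. Qed.

Lemma carg_small (e : R) : 0 < e -> exists2 d : R, 0 < d &
  forall z, cabs (z - 1) <= d -> near1 z /\ `|carg z| < e.
Proof.
move=> e0; have := @continuous_atan R 0; rewrite /prop_for /continuous_at atan0.
move=> /cvgrPdist_lt /(_ e e0) [d /= d0 hd].
exists (Num.min (1 / 4) (d / 4)); first by rewrite lt_min; apply/andP; split; lra.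
move=> z; rewrite le_min => /andP[h1 h2]; split=> //.
rewrite /carg -normrN -sub0r; apply: hd => /=.
have hr := near1_Re h1; have r0 : 0 < complex.Re z by lra.
have hi : `|complex.Im z| <= d / 4.
  apply: le_trans h2; rewrite -lecR -normE.
  have := normc_ge_Re ((z - 1) * 'i%C); rewrite ReiNIm normrN.
  rewrite raddfB /= subr0 normrM.
  have -> : `|'i%C| = 1 :> C by rewrite normc_def /= expr0n expr1n add0r sqrtr1.
  by rewrite mulr1.
rewrite sub0r normrN normrM normfV (ger0_norm (ltW r0)) ltr_pdivrMr //.
by apply: le_lt_trans hi _; nra.
Qed.

(* Two sequences with the same end ratios and multiplicatively close at each
   step turn around the origin by the same total angle. *)
Lemma winding_eq N (x y : nat -> C) :
  (forall j, x j != 0) -> (forall j, y j != 0) ->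
  (forall j, near1 (x j.+1 / x j)) -> (forall j, near1 (y j.+1 / y j)) ->
  (forall j, near1 (y j / x j)) -> y 0%N / x 0%N = y N / x N ->
  \sum_(0 <= j < N) carg (y j.+1 / y j) = \sum_(0 <= j < N) carg (x j.+1 / x j).
Proof.
move=> x0 y0 hx hy hxy e.
(* The steps of the two sequences differ by an increment of the argument of y/x; the increments
   telescope and the end ratios agree. *)
have step j : carg (y j.+1 / y j) =
    carg (x j.+1 / x j) + (carg (y j.+1 / x j.+1) - carg (y j / x j)).
  have : carg (y j.+1 / y j * (y j / x j)) = carg (y j.+1 / x j.+1 * (x j.+1 / x j)).
    by congr carg; field; rewrite !x0 !y0.
  rewrite (cargM_near1 (hy j) (hxy j)) (cargM_near1 (hxy j.+1) (hx j)); lra.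
under eq_bigr do rewrite step.
by rewrite big_split /= telescope_sumr // e subrr addr0.
Qed.

End Arguments.

(** * Determinants near invertible matrices *)

Section Determinants.
Variable R : realType.
Local Notation C := R[i].
Local Notation enorm := (@euclidean_norm R _).

Lemma prod_perturbation (I : Type) (s : seq I) (b e : I -> C) (d : R) : 0 <= d ->
  (forall i, cabs (b i) <= 1) -> (forall i, cabs (e i) <= d) ->
  cabs (\prod_(i <- s) (b i + e i) - \prod_(i <- s) b i) <= (1 + d) ^+ size s - 1.
Proof.
move=> d0 hb he.
have pb r : cabs (\prod_(i <- r) b i) <= 1.
  elim: r => [|i r IH]; first by rewrite big_nil cabs1.
  by rewrite big_cons cabsM mulr_ile1 ?cabs_ge0.
elim: s => [|i s IH]; first by rewrite !big_nil subrr cabs0 expr0 subrr.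
rewrite !big_cons; set P := \prod_(j <- s) _; set Q := \prod_(j <- s) _.
have -> : (b i + e i) * P - b i * Q = (b i + e i) * (P - Q) + e i * Q by ring.
apply: le_trans (cabsD _ _) _; rewrite !cabsM /=.
have h1 : cabs (b i + e i) <= 1 + d.
  by apply: le_trans (cabsD _ _) _; apply: lerD.
have h2 : cabs (b i + e i) * cabs (P - Q) <= (1 + d) * ((1 + d) ^+ size s - 1).
  by apply: ler_pM; rewrite ?cabs_ge0.
have h3 : cabs (e i) * cabs Q <= d * 1 by apply: ler_pM; rewrite ?cabs_ge0 ?pb.
rewrite exprS; lra.
Qed.

Lemma expr_le_linear (n : nat) (d : R) : 0 <= d <= 1 ->
  (1 + d) ^+ n <= 1 + (2 ^+ n - 1) * d.
Proof.
move=> /andP[d0 d1]; elim: n => [|n IH]; first by rewrite !expr0; lra.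
have h2 : 1 <= 2 ^+ n :> R by apply: exprn_ege1; lra.
rewrite !exprS; set a := 2 ^+ n in IH h2 *.
apply: (@le_trans _ _ ((1 + d) * (1 + (a - 1) * d))).
  by rewrite ler_wpM2l //; lra.
have : 0 <= (a - 1) * (d * (1 - d)) by rewrite !mulr_ge0 //; lra.
by rewrite -subr_ge0 => h; rewrite -subr_ge0; nra.
Qed.

Lemma det_near1 n : exists2 d : R, 0 < d & forall E : 'M[C]_n,
  (forall i j, cabs (E i j) <= d) -> cabs (\det (1%:M + E) - 1) <= 1 / 4.
Proof.
(* In the Leibniz formula each permutation contributes an error of at most 2^n d. The radius depends
   on [n], which is harmless because the winding argument is run at one fixed size. *)
pose F : R := (#|{: 'S_n}|)%:R * 2 ^+ n.
have F0 : 0 <= F by rewrite mulr_ge0 // exprn_ge0.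
pose d : R := (4 * (F + 1))^-1.
have dF : d * (4 * (F + 1)) = 1 by rewrite mulVf // gt_eqF //; lra.
have d0 : 0 < d by rewrite invr_gt0; lra.
have d1 : d <= 1 by nra.
exists d => // E hE; rewrite -{2}(det1 C n) /determinant -sumrB.
apply: le_trans (cabs_sum _ _ _) _.
apply: (@le_trans _ _ (\sum_(s : 'S_n) (2 ^+ n * d))); last first.
  rewrite sumr_const -[leLHS]mulr_natl mulrA -/F.
  have -> : F * d = d * (4 * (F + 1)) / 4 - d by field.
  by rewrite dF; lra.
apply: ler_sum => s _; rewrite -mulrBr cabsM.
have -> : cabs ((-1) ^+ perm.odd_perm s : C) = 1.
  by rewrite cabsX cabsN cabs1 expr1n.
rewrite mul1r; under eq_bigr do rewrite mxE.
have hb i : cabs ((1%:M : 'M[C]_n) i (s i)) <= 1.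
  by rewrite mxE; case: (_ == _); rewrite ?cabs1 // cabs0.
have := prod_perturbation (index_enum 'I_n) (ltW d0) hb (fun i => hE i (s i)).
move=> h; apply: le_trans h _.
have -> : size (index_enum 'I_n) = n by rewrite -[RHS]card_ord cardT enumT.
by have := @expr_le_linear n d _; rewrite d1 (ltW d0) => /(_ isT); nra.
Qed.

(** A matrix A within 1/2 of the identity satisfies |x| <= 2 |A x|. For invertibility this is
    applied to the adjoint, since a zero determinant supplies a row vector in the left kernel. *)
Lemma near_identity_unit n (M : 'M[C]_n) : opb (M - 1%:M) (1 / 2) ->
  M \in unitmx /\ opb (invmx M) 2.
Proof.
move=> h; have c0 : 0 <= 1 / 2 :> R by lra.
have low m (A : 'M[C]_m) (x : 'cV[C]_m) : opb (A - 1%:M) (1 / 2) -> enorm x <= 2 * enorm (A *m x).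
  move=> hA; have := hA x; rewrite mulmxBl mul1mx => h1.
  have := enormD (A *m x) (- (A *m x - x)); rewrite opprB addrC subrK.
  have -> : enorm (x - A *m x) = enorm (A *m x - x).
    by rewrite -opprB -scaleN1r enormZ cabsN cabs1 mul1r.
  lra.
have uM : M \in unitmx.
  rewrite unitmxE unitfE; apply/det0P => -[v v0 hv].
  have hA : opb (M^t* - 1%:M) (1 / 2).
    have := opb_adj c0 h.
    by rewrite linearB map_mxB /= adj1.
  have := low n _ (v^t*) hA; rewrite -adjM hv trmx0 map_mx0 enorm0 mulr0 => hx.
  move: v0; rewrite -[v]trmxCK.
  have -> : v^t* = 0 by apply: enorm_eq0; apply/eqP; rewrite eq_le hx enorm_ge0.
  by rewrite trmx0 map_mx0 eqxx.
split=> // x; have := low n M (invmx M *m x) h.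
by rewrite mulmxA mulmxV // mul1mx.
Qed.

Lemma det_ratio_near1 n : exists2 d : R, 0 < d & forall M M' : 'M[C]_n,
  opb (M - 1%:M) (1 / 2) -> opb (M' - M) d ->
  \det M != 0 /\ near1 (\det M' / \det M).
Proof.
have [d d0 hd] := det_near1 n; exists (d / 2) => [|M M' hM hMM]; first by lra.
have [uM hinv] := near_identity_unit hM.
have dM : \det M != 0 by rewrite -unitfE -unitmxE.
split=> //; pose E := invmx M *m (M' - M).
have -> : M' = M *m (1%:M + E).
  by rewrite mulmxDr mulmx1 mulmxA mulmxV // mul1mx addrC subrK.
rewrite det_mulmx mulrAC divff // mul1r; apply: hd => i j.
have e : d = 2 * (d / 2) by field.
apply: opb_entry (ltW d0) _; rewrite {1}e; exact: (opbM (ler0n R 2) hinv hMM).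
Qed.

End Determinants.

Section WordProducts.
Variables (R : realType) (T : eqType) (n : nat).
Local Notation C := R[i].
Implicit Types (f g A B : T -> 'M[C]_n) (w u v : seq T).

Definition wprod f w : 'M[C]_n := foldr (fun x M => f x *m M) 1%:M w.

Lemma det_wprod f w : \det (wprod f w) = \prod_(x <- w) \det (f x).
Proof.
by elim: w => [|x w IH] /=; rewrite ?det1 ?big_nil // det_mulmx IH big_cons.
Qed.

Lemma opb_wprod f w : (forall x, opb (f x) 1) -> opb (wprod f w) 1.
Proof.
move=> h; elim: w => [|x w IH] /=; first exact: opb1.
rewrite -[1]mulr1; exact: (opbM ler01 (h x) IH).
Qed.

Lemma opb_wprod_sub f g w (d : R) : (forall x, opb (f x) 1) ->
  (forall x, opb (g x) 1) -> 0 <= d -> {in w, forall x, opb (f x - g x) d} ->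
  opb (wprod f w - wprod g w) ((size w)%:R * d).
Proof.
move=> hf hg d0; elim: w => [|x w IH] h /=.
  by rewrite subrr mul0r; exact: opb0.
have -> : f x *m wprod f w - g x *m wprod g w =
   (f x - g x) *m wprod f w + g x *m (wprod f w - wprod g w).
  by rewrite mulmxBl mulmxBr addrA subrK.
have hx : opb (f x - g x) d by apply: h; rewrite mem_head.
have hw : {in w, forall y, opb (f y - g y) d}.
  by move=> y yw; apply: h; rewrite inE yw orbT.
have -> : (size w).+1%:R * d = d * 1 + 1 * ((size w)%:R * d).
  by rewrite -natr1; ring.
exact: opbD (opbM d0 hx (opb_wprod w hf)) (opbM ler01 (hg x) (IH hw)).
Qed.

Definition segm (t : R) (X Y : 'M[C]_n) : 'M[C]_n := (1 - t)%:C *: X + t%:C *: Y.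

Lemma opb_segm (t : R) (X Y : 'M[C]_n) c d : 0 <= t <= 1 ->
  opb X c -> opb Y d -> opb (segm t X Y) ((1 - t) * c + t * d).
Proof.
move=> /andP[t0 t1] hX hY; have := opbD (opbZ (1 - t)%:C hX) (opbZ t%:C hY).
by rewrite !cabs_real !ger0_norm // subr_ge0.
Qed.

Lemma segm_sub (t t' : R) (X Y : 'M[C]_n) :
  segm t X Y - segm t' X Y = (t - t')%:C *: (Y - X).
Proof.
rewrite /segm opprD addrACA -!scalerBl -!rmorphB.
have -> : 1 - t - (1 - t') = - (t - t') by ring.
by rewrite rmorphN scaleNr scalerBr addrC.
Qed.

Lemma segmB (t : R) (X Y X' Y' : 'M[C]_n) :
  segm t X Y - segm t X' Y' = segm t (X - X') (Y - Y').
Proof. by rewrite /segm !scalerBr opprD addrACA. Qed.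

Lemma segm_id (t : R) (X : 'M[C]_n) : segm t X X = X.
Proof. by rewrite /segm -scalerDl -rmorphD subrK scale1r. Qed.

Lemma segm0 (X Y : 'M[C]_n) : segm 0 X Y = X.
Proof. by rewrite /segm subr0 scale0r addr0 scale1r. Qed.

Lemma segm1 (X Y : 'M[C]_n) : segm 1 X Y = Y.
Proof. by rewrite /segm subrr scale0r add0r scale1r. Qed.

End WordProducts.

(** * The discretized homotopy of determinant loops *)

Section Winding.
Variables (R : realType) (T : eqType) (n : nat).
Local Notation C := R[i].
Variables (A B : T -> 'M[C]_n) (u v : seq T) (theta e : R).
Hypotheses (uA : forall x, A x \is unitarymx) (uB : forall x, B x \is unitarymx).
Hypotheses (uv : perm_eq u v) (Au : wprod A u = 1%:M) (Av : wprod A v = 1%:M).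
Hypotheses (Bv : wprod B v = 1%:M) (Bu : wprod B u = (cis theta)%:M).
Hypotheses (e0 : 0 <= e) (AB : {in u, forall x, opb (A x - B x) e}).
Hypotheses (small : (size u)%:R * e + cabs (cis theta - 1) <= 1 / 4).
Hypothesis theta1 : `|theta| < pi / 2.

Let path t x : 'M[C]_n := segm t (A x) (B x).
Let W t w := wprod (path t) w.
(* At s = 0 and s = 1 this is W t v and W t u, whose determinants agree; so for each
   t the determinant of M _ t is a loop. It is constant at t = 0, and at t = 1 it is
   the n-th power of the loop 1 - s + s * cis theta through 1 and cis theta. *)
Let M s t : 'M[C]_n := segm s (W t v) (W t u).

Let path1 t x : 0 <= t <= 1 -> opb (path t x) 1.
Proof.
move=> ht; have := opb_segm ht (opb_unitary (uA x)) (opb_unitary (uB x)).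
by rewrite !mulr1 subrK.
Qed.

Let W1 t w : 0 <= t <= 1 -> opb (W t w) 1.
Proof. by move=> ht; apply: opb_wprod => x; exact: path1. Qed.

Let path_close t x : 0 <= t <= 1 -> x \in u -> opb (path t x - B x) e.
Proof.
move=> ht xu; have -> : B x = segm 1 (A x) (B x) by rewrite segm1.
rewrite segm_sub; have := opbZ (t - 1)%:C (opbN (AB xu)); rewrite opprB.
apply: opbW; rewrite cabs_real; apply: ler_piMl => //.
by rewrite ler_norml; lra.
Qed.

Let W_close t w : 0 <= t <= 1 -> perm_eq u w -> opb (W t w - wprod B w) ((size u)%:R * e).
Proof.
move=> ht uw; rewrite (perm_size uw).
apply: (opb_wprod_sub (fun x => path1 x ht) (fun x => opb_unitary (uB x)) e0).
by move=> x; rewrite -(perm_mem uw) => xu; exact: path_close.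
Qed.

Let M_near1 s t : 0 <= s <= 1 -> 0 <= t <= 1 -> opb (M s t - 1%:M) (1 / 2).
Proof.
move=> hs ht; have hv : opb (W t v - 1%:M) (1 / 4).
  have := W_close ht uv; rewrite Bv; apply: opbW.
  by apply: le_trans small; rewrite lerDl cabs_ge0.
have hu : opb (W t u - 1%:M) (1 / 4).
  have h1 := W_close ht (perm_refl u); rewrite Bu in h1.
  have h2 : opb ((cis theta)%:M - 1%:M : 'M[C]_n) (cabs (cis theta - 1)).
    rewrite -raddfB /= -scalemx1 -[cabs _]mulr1; exact: (opbZ _ (@opb1 _ _)).
  have := opbD h1 h2; rewrite addrA subrK; exact: opbW small.
have := opb_segm hs hv hu.
rewrite -segmB segm_id; apply: opbW; lra.
Qed.

Let M_lip_s s s' t : 0 <= t <= 1 -> opb (M s t - M s' t) (`|s - s'| * 2).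
Proof.
move=> ht; rewrite segm_sub -(cabs_real (s - s')).
apply: opbZ; apply: opbB; exact: W1.
Qed.

Let W_lip t t' w : 0 <= t <= 1 -> 0 <= t' <= 1 ->
  opb (W t w - W t' w) ((size w)%:R * (`|t - t'| * 2)).
Proof.
move=> ht ht'; apply: opb_wprod_sub.
- by move=> x; exact: path1.
- by move=> x; exact: path1.
- by rewrite mulr_ge0.
- move=> x _; rewrite segm_sub -(cabs_real (t - t')).
  by apply: opbZ; apply: opbB; exact: opb_unitary.
Qed.

Let M_lip_t s t t' : 0 <= s <= 1 -> 0 <= t <= 1 -> 0 <= t' <= 1 ->
  opb (M s t - M s t') ((size u)%:R * (`|t - t'| * 2)).
Proof.
move=> hs ht ht'.
rewrite /M segmB; have := opb_segm hs (W_lip v ht ht') (W_lip u ht ht').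
rewrite -(perm_size uv); apply: opbW; lra.
Qed.

Let M_ends t : \det (M 0 t) = \det (M 1 t).
Proof.
by rewrite /M segm0 segm1 !det_wprod; apply: perm_big; rewrite perm_sym.
Qed.

(** The rows of a fine grid are loops in s at fixed t. Neighbouring rows have the same total
    argument by [winding_eq]; the first row is constant, and the last one adds up to n theta. The
    hypothesis [small] keeps the matrices within 1/2 of the identity, so no determinant on the grid
    vanishes. *)
Lemma winding_number_zero : n%:R * theta = 0.
Proof.
pose q (s : R) : C := 1 + s%:C * (cis theta - 1).
have ht1 : near1 (cis theta).
  by apply: le_trans small; rewrite lerDr mulr_ge0.
have qn s : 0 <= s <= 1 -> near1 (q s).
  move=> /andP[s0 s1]; rewrite /near1 /q addrAC subrr add0r cabsM cabs_real ger0_norm //.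
  by apply: le_trans ht1; apply: ler_piMl => //; exact: cabs_ge0.
have qpos s : 0 <= s <= 1 -> 0 < complex.Re (q s) by move=> /qn/near1_Re; lra.
have qnz s : 0 <= s <= 1 -> 3 / 4 <= cabs (q s).
  by move=> /qn/near1_Re h; apply: le_trans h (Re_le_cabs _).
have M1 s : \det (M s 1) = q s ^+ n.
  have -> : M s 1 = (q s)%:M.
    rewrite /M /W.
    have e1 w : wprod (path 1) w = wprod B w.
      by elim: w => //= x w ->; rewrite /path segm1.
    rewrite !e1 Bu Bv /segm !scale_scalar_mx -raddfD mulr1; congr (_%:M).
    by rewrite rmorphB rmorph1 /q; ring.
  by rewrite det_scalar.
have M0 s : M s 0 = 1%:M.
  rewrite /M /W.
  have e1 w : wprod (path 0) w = wprod A w.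
    by elim: w => //= x w ->; rewrite /path segm0.
  by rewrite !e1 Au Av segm_id.
have [d d0 hd] := det_ratio_near1 R n.
have pi0 : 0 < pi :> R by exact: pi_gt0.
have n1 : 0 < n.+1%:R :> R by rewrite ltr0n.
(* Steps of [q] must be so small that n times their argument stays below pi/2, where the argument of
   an n-th power is n times the argument. *)
have [d' d'0 hd'] := @carg_small R (pi / 2 / n.+1%:R) ltac:(by rewrite !divr_gt0).
(* The first term makes the mesh fine enough for determinant ratios in both directions, since words
   are 2|u|-Lipschitz in t and segments 2-Lipschitz in s; the second controls the steps of [q]. *)
pose L : R := (size u).+1%:R * 2 / d + 2 / d'.
have L0 : 0 <= L by rewrite addr_ge0 // divr_ge0 ?mulr_ge0 // ltW.
have [N hN] : exists N : nat, L < N.+1%:R.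
  have := archi_boundP L0; set N := Num.bound L => h; exists N.
  by apply: lt_le_trans h _; rewrite ler_nat.
(* Clamped at 1 because [winding_eq] asks for its bounds at every natural index. *)
pose nd (j : nat) : R := Num.min 1 (j%:R / N.+1%:R).
have N0 : 0 < N.+1%:R :> R by rewrite ltr0n.
have nd01 j : 0 <= nd j <= 1.
  by rewrite /nd le_min ler01 divr_ge0 //= ge_min lexx.
have ndE j : (j <= N.+1)%N -> nd j = j%:R / N.+1%:R.
  by move=> jN; rewrite /nd min_r // ler_pdivrMr // mul1r ler_nat.
have ndS j : `|nd j.+1 - nd j| <= N.+1%:R^-1.
  have [jN|jN] := ltnP j N.+1.
    rewrite (ndE j.+1 jN) (ndE j (ltnW jN)) -mulrBl -natr1 addrAC subrr add0r mul1r.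
    by rewrite ger0_norm // invr_ge0 ltW.
  have e1 i : (N.+1 <= i)%N -> nd i = 1.
    by move=> iN; rewrite /nd min_l // ler_pdivlMr // mul1r ler_nat.
  by rewrite !e1 // ?subrr ?normr0 ?invr_ge0 ?(ltW N0) // ltnW.
have hL : (size u).+1%:R * (N.+1%:R^-1 * 2) <= d.
  have -> : (size u).+1%:R * (N.+1%:R^-1 * 2) = (size u).+1%:R * 2 / N.+1%:R :> R.
    by rewrite mulrA mulrAC.
  have h : (size u).+1%:R * 2 / d < N.+1%:R.
    by apply: le_lt_trans hN; rewrite lerDl divr_ge0 // ltW.
  by rewrite ltr_pdivrMr // in h; rewrite ler_pdivrMr // (mulrC d) ltW.
have hL' : N.+1%:R^-1 * 2 <= d'.
  have h : 2 / d' < N.+1%:R.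
    by apply: le_lt_trans hN; rewrite lerDr divr_ge0 ?mulr_ge0 // ltW.
  by rewrite ltr_pdivrMr // in h; rewrite mulrC ler_pdivrMr // (mulrC d') ltW.
pose x l j := \det (M (nd j) (nd l)).
have step_t l j : x l j != 0 /\ near1 (x l.+1 j / x l j).
  apply: hd; first exact: M_near1.
  apply: opbW (M_lip_t (nd01 j) (nd01 l.+1) (nd01 l)).
  apply: le_trans hL; rewrite ler_pM ?mulr_ge0 //; first by rewrite ler_nat.
  by rewrite ler_wpM2r.
have step_s l j : near1 (x l j.+1 / x l j).
  have [] // := hd (M (nd j) (nd l)) (M (nd j.+1) (nd l)) (M_near1 (nd01 j) (nd01 l)) _.
  apply: opbW (M_lip_s _ _ (nd01 l)); apply: le_trans hL.
  apply: (@le_trans _ _ (N.+1%:R^-1 * 2)); first by rewrite ler_wpM2r.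
  by rewrite ler_peMl ?ler1n // mulr_ge0 // invr_ge0 ltW.
have nd0 : nd 0%N = 0 by rewrite ndE // mul0r.
have ndN : nd N.+1 = 1 by rewrite ndE // divff // gt_eqF.
have x_ends l : x l 0%N = x l N.+1.
  by rewrite /x nd0 ndN; exact: M_ends.
have row l : \sum_(0 <= j < N.+1) carg (x l j.+1 / x l j) = 0.
  elim: l => [|l IH].
    by rewrite big1 // => j _; rewrite /x nd0 !M0 det1 divr1 carg1.
  rewrite -[RHS]IH; apply: (@winding_eq R N.+1 (x l) (x l.+1)).
  - by move=> j; have [] := step_t l j.
  - by move=> j; have [] := step_t l.+1 j.
  - exact: step_s.
  - exact: step_s.
  - by move=> j; have [] := step_t l j.
  - by rewrite !x_ends.
have := row N.+1.
pose b j := carg (q (nd j)).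
have hx j : x N.+1 j = q (nd j) ^+ n by rewrite /x ndN M1.
have hq j : carg (x N.+1 j.+1 / x N.+1 j) = n%:R * (b j.+1 - b j).
  have qq0 : q (nd j) != 0.
    by rewrite -cabs_eq0; have := qnz _ (nd01 j) => h; apply/eqP => z; rewrite z in h; lra.
  have rE : q (nd j.+1) / q (nd j) = (cabs (q (nd j.+1)) / cabs (q (nd j)))%:C * cis (b j.+1 - b j).
    apply: (mulIf qq0); rewrite divfK // {1}(polar_form (qpos _ (nd01 j.+1))).
    rewrite {2}(polar_form (qpos _ (nd01 j))) mulrACA -rmorphM -cisD -/(b j) -/(b j.+1) subrK.
    rewrite divfK //; have := qnz _ (nd01 j); lra.
  have small_r : cabs (q (nd j.+1) / q (nd j) - 1) <= d'.
    have -> : q (nd j.+1) / q (nd j) - 1 = (nd j.+1 - nd j)%:C * (cis theta - 1) / q (nd j).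
      by rewrite rmorphB /q; field; rewrite -/(q (nd j)).
    rewrite !cabsM cabsV cabs_real.
    have h1 := ndS j; have h2 : cabs (cis theta - 1) <= 1 / 4 by exact: ht1.
    have h3 := qnz _ (nd01 j).
    apply: le_trans hL'; rewrite ler_pdivrMr; last by lra.
    have h4 : `|nd j.+1 - nd j| * cabs (cis theta - 1) <= N.+1%:R^-1 * 1.
      by apply: ler_pM => //; rewrite ?cabs_ge0 //; lra.
    apply: le_trans h4 _; rewrite -mulrA ler_wpM2l ?invr_ge0 ?(ltW N0) //; lra.
  have rpos : 0 < cabs (q (nd j.+1)) / cabs (q (nd j)).
    by rewrite divr_gt0 //; [have := qnz _ (nd01 j.+1)|have := qnz _ (nd01 j)]; lra.
  have [rn] := hd' _ small_r; rewrite rE => hb.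
  have bb : `|b j.+1 - b j| < pi / 2.
    have b4 i : `|b i| < pi / 4 by apply/near1_carg/qn.
    apply: le_lt_trans (ler_normB _ _) _; have := b4 j; have := b4 j.+1; lra.
  rewrite carg_polar // in hb.
  rewrite !hx -expr_div_n rE exprMn -rmorphXn -cis_mul_nat carg_polar ?exprn_gt0 //.
  rewrite normrM ger0_norm //; move: hb; rewrite ltr_pdivlMr // mulrC => hb.
  apply: le_lt_trans hb; rewrite ler_wpM2r // ler_nat; exact: leqnSn.
under eq_bigr do rewrite hq.
rewrite -mulr_sumr telescope_sumr // /b ndN nd0.
have -> : q 0 = 1 by rewrite /q mul0r addr0.
have -> : q 1 = 1%:C * cis theta by rewrite /q mul1r mul1r addrC subrK.
by rewrite carg1 carg_polar // subr0.
Qed.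

End Winding.

(** * A projective representation that cannot be perturbed *)

Section ProjectiveRepresentation.
Variables (R : realType) (G : groupType) (psi : G -> int) (t : G).
Hypothesis psiM : forall x y, psi (x * y)%g = psi x + psi y.
Local Notation N := (kerg psi).
Variables (phi : G -> int) (c : nat).
Hypothesis phiM : forall x y, N x -> N y -> phi (x * y)%g = phi x + phi y.
Hypothesis adt_nil : forall x, iter c (adt t) x = 1%g.
Local Notation C := R[i].

Let hN : is_subgroup N := kerg_sg psiM.

Definition phid (m : nat) (b : G) : int := phi (iter m (adt t) b).

Let NJt b : N b -> N (b ^ t)%g. Proof. exact: kergJ. Qed.
Let Nadt b : N (adt t b). Proof. exact: adt_kerg. Qed.

(** Commutation with [t] is not a homomorphism, so additivity of the next difference is read off
    from conjugation: it is phid m (b ^ t) - phid m b, a difference of additive maps. The two claims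
    must therefore be proved together. *)
Lemma phid_add_conj m :
  (forall x y, N x -> N y -> phid m (x * y)%g = phid m x + phid m y) /\
  (forall b, N b -> phid m (b ^ t)%g = phid m b + phid m.+1 b).
Proof.
elim: m => [|m [IH1 IH2]].
  by split=> [x y|b hb]; [exact: phiM|rewrite conjg_commg; exact: (phiM hb (Nadt b))].
have addS x y : N x -> N y -> phid m.+1 (x * y)%g = phid m.+1 x + phid m.+1 y.
  move=> hx hy; have hxy : N (x * y)%g by exact: sgM.
  have := IH2 _ hxy; rewrite conjMg (IH1 _ _ (NJt hx) (NJt hy)) (IH1 x y hx hy).
  by rewrite (IH2 x hx) (IH2 y hy); lia.
split=> // b hb; rewrite conjg_commg (addS _ _ hb (Nadt b)); congr (_ + _).
by rewrite /phid -iterSr.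
Qed.

Lemma phidD m x y : N x -> N y -> phid m (x * y)%g = phid m x + phid m y.
Proof. by have [h _] := phid_add_conj m; exact: h. Qed.

Lemma phid_conj m b : N b -> phid m (b ^ t)%g = phid m b + phid m.+1 b.
Proof. by have [_ h] := phid_add_conj m; exact: h. Qed.

Lemma phid_nil b : phid c b = 0.
Proof.
have p1 : phi 1%g = 0 by have := phiM (sg1 hN) (sg1 hN); rewrite mulg1; lia.
by rewrite /phid adt_nil p1.
Qed.

(* A closed form, by Newton's forward difference formula, for the sum of phi over
   b, b ^ t, ..., b ^ (t ^+ j.-1). *)
Definition Phi (j : nat) (b : G) : int := \sum_(m < c) 'C(j, m.+1)%:Z * phid m b.

Lemma PhiD j x y : N x -> N y -> Phi j (x * y)%g = Phi j x + Phi j y.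
Proof.
move=> hx hy; rewrite /Phi -big_split; apply: eq_bigr => m _.
by rewrite phidD // mulrDr.
Qed.

Lemma Phi0 b : Phi 0 b = 0.
Proof. by rewrite /Phi big1 // => m _; rewrite bin0n mul0r. Qed.

Lemma PhiS j b : N b -> Phi j.+1 b = Phi j (b ^ t)%g + phi b.
Proof.
move=> hb; rewrite /Phi.
(* Pascal's rule; the shifted sum gains its top term, which vanishes by [phid_nil], and its bottom
   term, which is phi b. *)
under eq_bigr => m _ do rewrite binS PoszD mulrDl.
under [in RHS]eq_bigr => m _ do rewrite phid_conj // mulrDr.
rewrite !big_split /= -addrA; congr (_ + _).
have e : \sum_(m < c.+1) 'C(j, m)%:Z * phid m b =
    \sum_(m < c) 'C(j, m.+1)%:Z * phid m.+1 b + phi b.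
  by rewrite big_ord_recl /= bin0 mul1r addrC.
by rewrite -e big_ord_recr /= phid_nil mulr0 addr0.
Qed.

(* Coprime to 2, ..., c, so that it divides every binomial coefficient in Phi. *)
Definition dimP (n : nat) := (n * c`!).+1.

(** M divides (m + 1) C(M, m + 1) = M C(M - 1, m), and is coprime to m + 1. *)
Lemma Phi_dim n b : (dimP n %| Phi (dimP n) b)%Z.
Proof.
rewrite /Phi; apply: rpred_sum => m _; apply: dvdz_mulr.
rewrite dvdzE /=.
have cop : coprime (dimP n) m.+1.
  rewrite coprime_sym; apply: coprime_dvdl (coprimenS _).
  by apply: dvdn_mull; apply: dvdn_fact; rewrite /= ltn_ord.
by rewrite -(Gauss_dvdr _ cop) -mul_bin_diag dvdn_mulr.
Qed.

Definition cisz n (z : int) : C := cis (2 * pi * z%:~R / (dimP n)%:R).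

Let dim0 n : (dimP n)%:R != 0 :> R. Proof. by rewrite pnatr_eq0. Qed.

Lemma ciszD n a b : cisz n (a + b) = cisz n a * cisz n b.
Proof. by rewrite /cisz -cisD rmorphD /= mulrDr mulrDl. Qed.

Lemma cisz0 n : cisz n 0 = 1.
Proof. by rewrite /cisz mulr0 mul0r cis0. Qed.

Lemma cisz_dvd n z : (dimP n %| z)%Z -> cisz n z = 1.
Proof.
move=> /dvdzP[q ->].
have e1 : cis (2 * pi) = 1 :> C by rewrite mulr_natl /cis cos2pi sin2pi.
have h (m : nat) : cis (2 * pi * m%:R) = 1 :> C.
  by rewrite mulrC cis_mul_nat e1 expr1n.
have -> : cisz n (q * dimP n) = cis (2 * pi * q%:~R).
  by rewrite /cisz rmorphM /= mulrA -pmulrn mulfK.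
case: q => m; first exact: h.
by rewrite NegzE rmorphN /= mulrN cisN h rmorph1.
Qed.

(** When [b] commutes with [t], the j-th entry is exp(2 i pi j phi b / M), and with [shift] this is
    the classical clock and shift pair. *)
Definition clock n (b : G) : 'M[C]_(dimP n) :=
  diag_mx (\row_j cisz n (Phi j b)).

Definition shift n : 'M[C]_(dimP n) := (perm_mx (perm (@ordS_inj (dimP n))))^T.

Lemma clockM n x y : N x -> N y -> clock n (x * y)%g = clock n x *m clock n y.
Proof.
move=> hx hy; rewrite /clock mulmx_diag; congr diag_mx; apply/rowP => j.
by rewrite !mxE PhiD // ciszD.
Qed.

Lemma clock1 n : clock n 1%g = 1%:M.
Proof.
have p1 j : Phi j 1%g = 0.
  by have := PhiD j (sg1 hN) (sg1 hN); rewrite mulg1; lia.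
by apply/matrixP=> i j; rewrite !mxE p1 cisz0.
Qed.

Lemma conj_cisz n z : Num.conj (cisz n z) = cisz n (- z).
Proof. by rewrite /cisz -cisN rmorphN /= mulrN mulNr. Qed.

Lemma clock_unitary n b : clock n b \is unitarymx.
Proof.
apply/unitarymxP; rewrite /clock tr_diag_mx map_diag_mx mulmx_diag.
apply/matrixP=> i j; rewrite !mxE; congr (_ *+ _).
rewrite -[RHS](cisz0 n) -(subrr (Phi i b)) ciszD; congr (_ * _).
exact: conj_cisz.
Qed.

Lemma shift_unitary n : shift n \is unitarymx.
Proof.
rewrite trmx_unitary; apply/unitarymxP.
by rewrite tr_perm_mx map_perm_mx -perm_mxM fingroup.mulgV perm_mx1.
Qed.

Lemma clock_shift n b : N b ->
  clock n b *m shift n = cisz n (phi b) *: (shift n *m clock n (b ^ t)%g).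
Proof.
move=> hb; apply/matrixP=> i j; rewrite /clock mul_diag_mx mul_mx_diag.
rewrite !mxE permE; case: eqP => [<-|_]; last by rewrite mulr0 mul0r mulr0.
rewrite mulr1 mul1r -ciszD /=.
(* Away from the corner this is the recursion for [Phi]. At the corner the index returns to 0, and
   consistency requires [Phi] at M to be a multiple of M. *)
have [lt|ge] := ltnP j.+1 (dimP n).
  by rewrite modn_small // PhiS // addrC.
have -> : (j.+1 = dimP n)%N by apply/eqP; rewrite eqn_leq ge ltn_ord.
rewrite modnn Phi0 cisz0 addrC -PhiS //.
have -> : (j.+1 = dimP n)%N by apply/eqP; rewrite eqn_leq ge ltn_ord.
by rewrite cisz_dvd // Phi_dim.
Qed.

Definition proj n (x : G) : 'M[C]_(dimP n) :=
  clock n (x * gz t (- psi x))%g *m mpow (shift n) (psi x).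

Lemma proj_unitary n x : proj n x \is unitarymx.
Proof.
exact: (mul_unitarymx (clock_unitary n _) (mpow_unitary _ (shift_unitary n))).
Qed.

(** The order of the quantifiers is the point: the integer z does not depend on n, so the multiplier
    tends to 1 as the dimension grows. *)
Lemma shift_pow_clock (k : int) b : N b -> exists z : int, forall n,
  mpow (shift n) k *m clock n b =
  cisz n z *: (clock n (b ^ gz t (- k))%g *m mpow (shift n) k).
Proof.
have Ngz z x : N x -> N (x ^ gz t z)%g by exact: kergJ.
have h1 n x : N x -> shift n *m clock n x =
    cisz n (- phi (x ^ t^-1)%g) *: (clock n (x ^ t^-1)%g *m shift n).
  move=> hx; have hxt : N (x ^ t^-1)%g by exact: kergJ.
  by rewrite clock_shift // -conjgM mulVg conjg1 scalerA -ciszD addNr cisz0 scale1r.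
have h2 n x : N x -> (shift n)^t* *m clock n x =
    cisz n (phi x) *: (clock n (x ^ t)%g *m (shift n)^t*).
  move=> hx; have uT := shift_unitary n; have /unitarymxP u := uT.
  have := congr1 (fun M => (shift n)^t* *m M *m (shift n)^t*) (clock_shift n hx).
  rewrite /= -!mulmxA u mulmx1 => ->.
  by rewrite -scalemxAl -scalemxAr !mulmxA (unitary_adj uT) mul1mx.
elim: k b => [|k IH|k IH] b hb.
- exists 0 => n; rewrite cisz0 scale1r oppr0 conjg1 /mpow /=.
  by rewrite mul1mx mulmx1.
- have [z hz] := IH b hb; exists (z - phi ((b ^ gz t (- k%:Z)) ^ t^-1)%g) => n.
  have -> : k.+1%:Z = 1 + k%:Z by lia.
  have uT := shift_unitary n; have hb' := Ngz (- k%:Z) b hb.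
  rewrite (mpowD _ _ uT) mpow1 -mulmxA hz -scalemxAr.
  rewrite (mulmxA (shift n) (clock n _)) (h1 n _ hb') -scalemxAl scalerA -ciszD mulmxA; congr (_ *: (clock n _ *m _ *m _)).
  by rewrite -conjgM -{2}(gz1 t) -gzN -gzD; congr (_ ^ gz t _)%g; lia.
- have [z hz] := IH b hb; exists (z + phi (b ^ gz t (- - k%:Z))%g) => n.
  have -> : - k.+1%:Z = -1 + - k%:Z by lia.
  have uT := shift_unitary n; have hb' := Ngz (- - k%:Z) b hb.
  rewrite (mpowD _ _ uT) mpowN1 -mulmxA hz -scalemxAr.
  rewrite (mulmxA _ (clock n _)) (h2 n _ hb') -scalemxAl scalerA -ciszD mulmxA; congr (_ *: (clock n _ *m _ *m _)).
  by rewrite -conjgM -{2}(gz1 t) -gzD; congr (_ ^ gz t _)%g; lia.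
Qed.

Hypothesis psit : psi t = 1.

Lemma proj_mul x y : exists z : int, forall n,
  proj n x *m proj n y = cisz n z *: proj n (x * y)%g.
Proof.
have hdec w : N (w * gz t (- psi w))%g by exact: (kerg_dec psiM psit).
have [z hz] := shift_pow_clock (psi x) (hdec y); exists z => n.
have uT := shift_unitary n.
rewrite /proj -mulmxA (mulmxA (mpow _ _)) hz -!scalemxAl -scalemxAr; congr (_ *: _).
rewrite psiM (mpowD _ _ uT) !mulmxA; congr (_ *m _ *m _).
have hy : N ((y * gz t (- psi y)) ^ gz t (- psi x))%g by exact: kergJ.
rewrite -clockM //; congr clock.
by rewrite /conjg !mulgA mulgK -[(_ * gz _ _ * gz _ _)%g]mulgA -gzD opprD addrC.
Qed.

End ProjectiveRepresentation.

(** * Words with the same letters *)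

Section Words.
Variable G : groupType.
Implicit Types (x y : G) (s u v : seq G).

Definition gprod s : G := foldr (fun x y => x * y)%g 1%g s.

Lemma gprod_cat s u : gprod (s ++ u) = (gprod s * gprod u)%g.
Proof. by elim: s => [|x s IH] /=; rewrite ?mul1g // IH mulgA. Qed.

Lemma gprod_rev_inv s : gprod (rev [seq x^-1%g | x <- s]) = (gprod s)^-1%g.
Proof.
elim: s => [|x s IH]; first by rewrite invg1.
by rewrite /= rev_cons -cats1 gprod_cat IH /= mulg1 invgM.
Qed.

Lemma gprod_closed (H : set G) s : is_subgroup H -> {in s, forall x, H x} -> H (gprod s).
Proof.
move=> hH; elim: s => [|x s IH] hs; first exact: sg1.
by apply: sgM => //; [apply: hs; rewrite mem_head|apply: IH => y ys; apply: hs; rewrite in_cons ys orbT].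
Qed.

Lemma commutator_words (H : set G) x : is_subgroup H -> lcs H 1 x ->
  exists u v, [/\ {in u, forall y, H y}, perm_eq u v, gprod u = x & gprod v = 1%g].
Proof.
move=> hH; pose W : set G := [set x | exists u v,
  [/\ {in u, forall y, H y}, perm_eq u v, gprod u = x & gprod v = 1%g]].
have hW : is_subgroup W.
  split=> [|y z [u [v [hu uv ue ve]]] [u' [v' [hu' uv' ue' ve']]]|y [u [v [hu uv ue ve]]]].
  - by exists [::], [::].
  - exists (u ++ u'), (v ++ v'); split; last 2 first.
    + by rewrite gprod_cat ue ue'.
    + by rewrite gprod_cat ve ve' mulg1.
    + by move=> w; rewrite mem_cat => /orP[/hu|/hu'].
    + exact: perm_cat.
  - exists (rev [seq w^-1%g | w <- u]), (rev [seq w^-1%g | w <- v]); split.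
    + by move=> w; rewrite mem_rev => /mapP[w' /hu hw' ->]; exact: sgV.
    + by rewrite perm_rev perm_sym perm_rev perm_sym; exact: perm_map.
    + by rewrite gprod_rev_inv ue.
    + by rewrite gprod_rev_inv ve invg1.
apply: (gen_min hW) x => _ [y hy [z hz <-]].
(* Reordering the letters of a commutator makes it cancel; equal letters are what forces equal
   determinants along any path of matrices. *)
exists [:: y^-1; z^-1; y; z]%g, [:: y^-1; y; z^-1; z]%g; split.
- move=> w; rewrite !inE => /or4P[] /eqP -> //; exact: sgV.
- by rewrite perm_cons (perm_catCA [:: z^-1%g] [:: y] [:: z]).
- by rewrite /= mulg1.
- by rewrite /= mulg1 mulKg mulVg.
Qed.

End Words.

(** * Asymptotic multiplicativity and the obstruction *)

Section NonPerturbable.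
Variables (R : realType) (G : groupType) (psi : G -> int) (t : G).
Hypothesis psiM : forall x y, psi (x * y)%g = psi x + psi y.
Hypothesis psit : psi t = 1.
Local Notation N := (kerg psi).
Variables (phi : G -> int) (c : nat).
Hypothesis phiM : forall x y, N x -> N y -> phi (x * y)%g = phi x + phi y.
Hypothesis adt_nil : forall x, iter c (adt t) x = 1%g.
Variable p : \bar R.
Hypothesis p1 : (1 < p)%E.
Local Notation C := R[i].
Local Notation rho := (proj R psi t phi c).
Local Notation clock := (clock R t phi c).
Local Notation shift := (shift R c).
Local Notation cisz := (cisz R c).
Local Notation dimP := (dimP c).

Lemma bnd_unitary r k (U : 'M[C]_k) : 1 < r -> U \is unitarymx ->
  bnd r%:E U (k%:R `^ r^-1).
Proof.
move=> r1 uU m V W hV hW.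
have -> : V *m U *m W = (V *m U) *m diag_mx (\row_j (1 : R)%:C) *m W.
  have -> : diag_mx (\row_(j < k) (1 : R)%:C) = 1%:M :> 'M[C]_k.
    by apply/matrixP=> i j; rewrite !mxE.
  by rewrite mulmx1.
have hVU : opb (V *m U) 1 by rewrite -[1]mulr1; exact: (opbM ler01 hV (opb_unitary uU)).
apply: le_trans (bnd_sum_opb r1 hVU hW (fun _ => ler01)) _.
under eq_bigr do rewrite powR1.
rewrite sumr_const card_ord -powRrM mulVf ?powRr1 //; lra.
Qed.

Lemma dimP_ge n : (n < dimP n)%N.
Proof. by rewrite /dimP ltnS leq_pmulr // fact_gt0. Qed.

Lemma dimP_large (s K : R) : 0 < s ->
  exists n0, forall n, (n0 <= n)%N -> K <= (dimP n)%:R `^ s.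
Proof.
move=> s0; pose K' := Num.max K 0; have K0 : 0 <= K' by rewrite le_max lexx orbT.
exists (Num.truncn (K' `^ s^-1)) => n le.
apply: (@le_trans _ _ K'); first by rewrite le_max lexx.
have -> : K' = (K' `^ s^-1) `^ s by rewrite -powRrM mulVf ?powRr1 // gt_eqF.
apply: ge0_ler_powR; rewrite ?nnegrE ?powR_ge0 ?(ltW s0) //.
apply/ltW/(lt_le_trans (truncnS_gt _)).
by rewrite ler_nat; apply: leq_trans (dimP_ge n); rewrite ltnS.
Qed.

Lemma cisz_near1 n z : cabs (1 - cisz n z) <= 4 * pi * `|z%:~R| / (dimP n)%:R.
Proof.
rewrite -cabsN opprB; apply: le_trans (cis_near1 _) _.
have d0 : 0 <= (dimP n)%:R^-1 :> R by rewrite invr_ge0.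
have p0 : 0 <= (2 * pi : R) by rewrite mulr_ge0 // pi_ge0.
by rewrite !normrM (ger0_norm d0) (ger0_norm (pi_ge0 R)) ger0_norm // !mulrA; lra.
Qed.

Lemma proj_asymptotic : asymptotic_representation p (fun n => rho n).
Proof.
split=> [n x|x y]; first exact: proj_unitary.
apply/(null_schatten p1) => e e0.
have [z hz] := proj_mul R psiM phiM adt_nil psit x y.
have eq n : rho n (x * y)%g - rho n x *m rho n y = (1 - cisz n z) *: rho n (x * y)%g.
  by rewrite hz scalerBl scale1r.
pose K : R := 4 * pi * `|z%:~R| / e.
have Ke : 4 * pi * `|z%:~R| = K * e by rewrite /K divfK // gt_eqF.
have dim0 n : 0 < (dimP n)%:R :> R by rewrite ltr0n.
move: p1; case: p => [r|_|//].
  move=> r1e; have r1 : 1 < r by rewrite -lte_fin.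
  have s0 : 0 < 1 - r^-1 by rewrite subr_gt0 invf_lt1 //; lra.
  have [n0 hn] := dimP_large K s0; exists n0 => n /hn hK; rewrite eq.
  have := bndZ (1 - cisz n z) r1e (powR_ge0 _ _) (bnd_unitary r1 (proj_unitary R psi t phi c n (x * y)%g)).
  apply: bndW => //; first by rewrite mulr_ge0 ?cabs_ge0 ?powR_ge0.
  apply: le_trans (ler_wpM2r (powR_ge0 _ _) (cisz_near1 n z)) _.
  (* A unitary of size M has norm at most M^(1/r), so a multiplier error of order 1/M leaves the
     factor M^(1/r - 1). *)
  have eM : (dimP n)%:R = (dimP n)%:R `^ (1 - r^-1) * (dimP n)%:R `^ r^-1 :> R.
    by rewrite -powRD ?subrK ?powRr1 ?ltW // pnatr_eq0 implybT.
  rewrite mulrAC ler_pdivrMr // Ke {2}eM mulrA ler_wpM2r ?powR_ge0 //.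
  by rewrite mulrC ler_wpM2l // ltW.
have [n0 hn] := dimP_large K ltr01; exists n0 => n /hn; rewrite (powRr1 (ltW (dim0 n))) => hK.
rewrite eq /=; have := opbZ (1 - cisz n z) (opb_unitary (proj_unitary R psi t phi c n (x * y)%g)).
apply: opbW; rewrite mulr1; apply: le_trans (cisz_near1 n z) _.
by rewrite ler_pdivrMr // Ke mulrC ler_wpM2l // ltW.
Qed.

Lemma proj_ker n x : N x -> rho n x = clock n x.
Proof. by rewrite /kerg /= /proj => ->; rewrite oppr0 gz0 mulg1 /mpow /= mulmx1. Qed.

Lemma wprod_clock n s : {in s, forall x, N x} -> wprod (rho n) s = clock n (gprod s).
Proof.
elim: s => [|x s IH] hs; first by rewrite /= (clock1 R t psiM c phiM).
have hx : N x by apply: hs; rewrite mem_head.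
have hs' : {in s, forall x, N x} by move=> y ys; apply: hs; rewrite in_cons ys orbT.
rewrite /= (clockM R t psiM c phiM) //; last exact: gprod_closed (kerg_sg psiM) hs'.
by rewrite -(IH hs') -proj_ker.
Qed.

Lemma proj_t n : rho n t = shift n.
Proof.
have e : (t * gz t (- 1))%g = 1%g by rewrite gzN gz1 mulgV.
by rewrite /proj psit mpow1 e (clock1 R t psiM c phiM) mul1mx.
Qed.

Lemma proj_tV n : rho n t^-1%g = (shift n)^t*.
Proof.
have e : psi t^-1%g = -1 by rewrite (psiV psiM) psit.
rewrite /proj e mpowN1 opprK gz1 mulVg.
by rewrite (clock1 R t psiM c phiM) mul1mx.
Qed.

Lemma eventually_all_in (I : eqType) (s : seq I) (P : I -> nat -> Prop) :
  (forall x, exists n0, forall n, (n0 <= n)%N -> P x n) ->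
  exists n0, forall n, (n0 <= n)%N -> {in s, forall x, P x n}.
Proof.
move=> h; elim: s => [|x s [n0 hn0]]; first by exists 0%N.
have [n1 hn1] := h x; exists (maxn n0 n1) => n.
rewrite geq_max => /andP[le0 le1] y; rewrite in_cons => /orP[/eqP ->|ys].
  exact: hn1.
exact: hn0.
Qed.

Lemma proj_not_perturbable a : N a -> phi a <> 0 -> lcs N 1 [~ a, t]%g ->
  ~ perturbable p (fun n => rho n).
Proof.
move=> ha pa hw [pi_ piP pirho].
have hN := kerg_sg psiM.
(* [u0] spells the inverse of [a, t] with letters in N, so it cancels the explicit commutator at the
   head of [u]. *)
have [u0 [v0 [hu0 uv0 u0e v0e]]] := commutator_words hN (sgV (lcs_sg 1 hN) hw).
pose u := [:: a^-1; t^-1; a; t]%g ++ u0; pose v := [:: a^-1; a; t^-1; t]%g ++ v0.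
have uv : perm_eq u v.
  by apply: perm_cat uv0; rewrite perm_cons (perm_catCA [:: t^-1%g] [:: a] [:: t]).
have ue : gprod u = 1%g.
  by rewrite gprod_cat u0e /= mulg1 -[X in (X * _)%g]/([~ a, t]%g) mulgV.
have ve : gprod v = 1%g by rewrite gprod_cat v0e /= !mulg1 mulKg mulVg.
have hv0 : {in v0, forall x, N x} by move=> x; rewrite -(perm_mem uv0); exact: hu0.
have haV := sgV hN ha; have hat : N (a ^ t)%g := kergJ psiM t ha.
have hc : N [~ a, t]^-1%g := sgV hN (psiR psiM a t).
(* Moving the shift past the clock of [a] once produces the scalar; the remaining clocks multiply
   exactly and spell a trivial element. *)
have Bu n : wprod (rho n) u = (cisz n (phi a))%:M.
  rewrite /= proj_t proj_tV (proj_ker n haV) (proj_ker n ha) (wprod_clock n hu0) u0e.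
  rewrite (mulmxA (clock n a)) (clock_shift R psiM phiM adt_nil) //.
  have uT := unitary_adj (shift_unitary R c n).
  rewrite -scalemxAl -!scalemxAr -(mulmxA (shift n)) (mulmxA _ (shift n)) uT mul1mx.
  rewrite -(clockM R t psiM c phiM) // -(clockM R t psiM c phiM) //; last exact: sgM.
  by rewrite mulgA -[(a^-1 * _)%g]/([~ a, t]%g) mulgV (clock1 R t psiM c phiM) scalemx1.
have Bv n : wprod (rho n) v = 1%:M.
  rewrite /= proj_t proj_tV (proj_ker n haV) (proj_ker n ha) (wprod_clock n hv0) v0e (clock1 R t psiM c phiM).
  have uT := unitary_adj (shift_unitary R c n).
  by rewrite mulmx1 uT mulmx1 -(clockM R t psiM c phiM) // mulVg (clock1 R t psiM c phiM).
have A1 n w : gprod w = 1%g -> wprod (pi_ n) w = 1%:M.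
  have [hu hm] := piP n.
  have hh : hom_on [set: G] (pi_ n) by split=> *; [exact: hu|exact: hm].
  have h1 := hom_on1 (sgT G) hh.
  suff -> : wprod (pi_ n) w = pi_ n (gprod w) by move=> ->.
  by elim: w => [|x w IH] /=; rewrite ?h1 // hm -IH.
(* The allowance 1/4 in [small] is split evenly: |u| e is at most 1/8, and the bound 32 pi |phi a|
   <= M below gives |theta| <= 1/16, hence |cis theta - 1| <= 1/8. A single n is enough. *)
pose e : R := (8 * (size u).+1%:R)^-1.
have e0 : 0 < e by rewrite invr_gt0 mulr_gt0.
have [n0 hn0] : exists n0, forall n, (n0 <= n)%N -> {in u, forall x, opb (pi_ n x - rho n x) e}.
  apply: eventually_all_in => x.
  by apply: (null_opb p1 _ e0); apply/(null_schatten p1); exact: pirho.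
have [n1 hn1] := dimP_large (32 * pi * `|(phi a)%:~R|) ltr01.
pose n := maxn n0 n1; have {hn0}hA := hn0 n (leq_maxl _ _).
have := hn1 n (leq_maxr _ _); rewrite powRr1 // => hM {hn1}.
have M0 : 0 < (dimP n)%:R :> R by rewrite ltr0n.
pose theta : R := 2 * pi * (phi a)%:~R / (dimP n)%:R.
have th : `|theta| <= 1 / 16.
  rewrite /theta !normrM [`|_^-1|]ger0_norm ?invr_ge0 // [`|pi|]ger0_norm ?pi_ge0 //.
  by rewrite [`|2|]ger0_norm // ler_pdivrMr //; lra.
(* The left-hand side is 2 pi phi a, non-zero whatever n is. *)
suff : (dimP n)%:R * theta = 0.
  rewrite /theta mulrC divfK ?gt_eqF // => /eqP; rewrite !mulf_eq0 gt_eqF ?pi_gt0 //.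
  by rewrite /= gt_eqF ?pi_gt0 //= intr_eq0 => /eqP.
have th' : `|theta| < pi / 2 by have := pi_ge2 R; lra.
have small : (size u)%:R * e + cabs (cis theta - 1) <= 1 / 4.
  have h1 := cis_near1 theta.
  have h2 : (size u)%:R * e <= 1 / 8.
    rewrite /e invfM mulrCA mul1r ler_piMr ?invr_ge0 // ler_pdivrMr // mul1r ler_nat.
    exact: leqnSn.
  lra.
exact: (winding_number_zero (proj1 (piP n)) (proj_unitary R psi t phi c n) uv
  (A1 n u ue) (A1 n v ve) (Bv n) (Bu n) (ltW e0) hA small th').
Qed.

End NonPerturbable.

Lemma finite_virtually_cyclic (G : groupType) :
  finite_set [set: G] -> virtually_cyclic G.
Proof.
by move=> fG; exists (generated [set 1%g]); [exists 1%g|exact: finite_image fG].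
Qed.

Lemma stable_virtually_cyclic (R : realType) (p : \bar R) (G : groupType) :
  (1 < p)%E -> finitely_generated G -> nilpotent_group G ->
  p_stable p G -> virtually_cyclic G.
Proof.
move=> p1 fg [n Gn] st; apply: contrapT => nvc.
have nfin : ~ finite_set [set: G] by move=> /finite_virtually_cyclic.
have [psi [t psiM psit]] := infinite_nilpotent_onto Gn fg nfin.
have nker : ~ finite_set (kerg psi) by move=> /(finite_kerg_vc psiM psit).
have [phi [a [phiM ha pa hw]]] := kerg_pairing Gn psiM psit fg nker.
have adt0 x : iter n (adt t) x = 1%g := iter_adt1 Gn t x (leqnn n).
apply: (proj_not_perturbable psiM psit phiM adt0 p1 ha pa hw).
exact: st (proj_asymptotic psiM psit phiM adt0 p1).
Qed.

Theorem theorem1p1 (R : realType) (G : groupType) (p : \bar R)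
    (Gfg : finitely_generated G) (Gnil : nilpotent_group G)
    (p_gt1 : (1%:E < p)%E) :
  p_stable p G <-> virtually_cyclic G.
Proof.
split; first exact: stable_virtually_cyclic.
exact: virtually_cyclic_stable.
Qed.
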